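(* Assuming Schanuel's conjecture, the following is decidable: given two finitely ambiguous weighted automata $\mathcal{A},\mathcal{B}$ over the same alphabet $\Sigma$, decide whether $\mathcal{A}$ is big-O of $\mathcal{B}$, i.e. whether there is $C>0$ with $f_{\mathcal{A}}(w)\le C f_{\mathcal{B}}(w)$ for all $w\in\Sigma^*$.
   Context: A (non-negative) weighted automaton is $\langle Q,\Sigma,M,F\rangle$ with finite $Q$, $M:\Sigma\to\mathbb{Q}_{\ge0}^{Q\times Q}$, $F\subseteq Q$, here with a dedicated initial state $q_0$; $f_{\mathcal{A}}(a_1\cdots a_n)=\sum_{t\in F}(M(a_1)\cdots M(a_n))_{q_0,t}$. The NFA of the automaton has the same states, initial and final states, and a transition $q\xrightarrow{a}q'$ whenever $M(a)(q,q')>0$. The automaton is finitely ambiguous if there is a constant $k$ such that every word has at most $k$ accepting paths in this NFA. Schanuel's conjecture: for all $z_1,\dots,z_n\in\mathbb{C}$ linearly independent over $\mathbb{Q}$, $\mathbb{Q}(z_1,\dots,z_n,e^{z_1},\dots,e^{z_n})$ has transcendence degree at least $n$ over $\mathbb{Q}$. *)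

(* Defs.v *)
From HB Require Import structures.
From mathcomp Require Import all_boot all_order all_algebra.
From mathcomp Require Import complex.
From mathcomp Require Import Rstruct.
From mathcomp Require Import mpoly.
From Stdlib Require Rdefinitions Rtrigo_def.

Set Implicit Arguments.
Unset Strict Implicit.
Unset Printing Implicit Defensive.

Import Order.TTheory GRing.Theory Num.Theory.
Local Open Scope ring_scope.

Notation Real := Rdefinitions.R.

Notation Cplx := (Real[i]).

Definition cexp (z : Cplx) : Cplx :=
  Complex (Rtrigo_def.exp (complex.Re z) * Rtrigo_def.cos (complex.Im z))
          (Rtrigo_def.exp (complex.Re z) * Rtrigo_def.sin (complex.Im z)).

Definition Q_lin_indep (n : nat) (z : 'I_n -> Cplx) : Prop :=
  forall c : 'I_n -> rat, \sum_(i < n) ratr (c i) * z i = 0 -> forall i, c i = 0.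

Definition Q_alg_indep (m : nat) (v : 'I_m -> Cplx) : Prop :=
  forall p : mpoly.mpoly m rat,
    mpoly.meval v (mpoly.map_mpoly (ratr : rat -> Cplx) p) = 0 -> p = 0.

Definition schanuel_gens (n : nat) (z : 'I_n -> Cplx) : 'I_(n + n) -> Cplx :=
  fun j => match split j with inl i => z i | inr i => cexp (z i) end.

(* trdeg_Q Q(w_1..w_k) >= n  iff  some n of the generators w_j are
   algebraically independent over Q *)
Definition trdeg_ge (k : nat) (w : 'I_k -> Cplx) (n : nat) : Prop :=
  exists f : 'I_n -> 'I_k, injective f /\ Q_alg_indep (fun i => w (f i)).

Definition Schanuel_conjecture : Prop :=
  forall (n : nat) (z : 'I_n -> Cplx),
    Q_lin_indep z -> trdeg_ge (schanuel_gens z) n.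

Record wa (s : nat) := WA {
  wa_n  : nat;
  wa_q0 : 'I_wa_n;
  wa_M  : 'I_s -> 'M[rat]_wa_n;
  wa_F  : {set 'I_wa_n}
}.

Definition wa_nonneg s (A : wa s) : Prop :=
  forall a i j, 0 <= wa_M A a i j.

Definition wa_mx s (A : wa s) (w : seq 'I_s) : 'M[rat]_(wa_n A) :=
  foldr (fun a P => wa_M A a *m P) 1%:M w.

Definition wa_fun s (A : wa s) (w : seq 'I_s) : rat :=
  \sum_(t in wa_F A) wa_mx A w (wa_q0 A) t.

Fixpoint accpath s (A : wa s) (q : 'I_(wa_n A)) (w : seq 'I_s)
    (qs : seq 'I_(wa_n A)) : bool :=
  match w, qs with
  | [::], [::] => q \in wa_F A
  | a :: w', q' :: qs' => (0 < wa_M A a q q') && accpath q' w' qs'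
  | _, _ => false
  end.

Definition num_acc_paths s (A : wa s) (w : seq 'I_s) : nat :=
  #|[set qs : (size w).-tuple 'I_(wa_n A) | @accpath s A (wa_q0 A) w qs]|.

Definition finitely_ambiguous s (A : wa s) : Prop :=
  exists k : nat, forall w : seq 'I_s, (num_acc_paths A w <= k)%N.

Definition bigO s (A B : wa s) : Prop :=
  exists C : Real, 0 < C /\
    forall w : seq 'I_s, ratr (wa_fun A w) <= C * ratr (wa_fun B w).

Definition raw_wa s (A : wa s) :
    nat * nat * seq (seq (seq rat)) * seq nat :=
  (wa_n A, nat_of_ord (wa_q0 A),
   [seq [seq [seq wa_M A a i j | j <- enum 'I_(wa_n A)] | i <- enum 'I_(wa_n A)]
      | a <- enum 'I_s],
   [seq nat_of_ord t | t <- enum (wa_F A)]).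

Definition instance_code s (A B : wa s) : nat :=
  pickle (s, raw_wa A, raw_wa B).

Inductive prcode : Type :=
  | PZero
  | PSucc
  | PProj of nat
  | PComp of prcode & seq prcode
  | PRec of prcode & prcode
  | PMu of prcode.

(* prval e v y : program e on argument list v halts with output y
   (missing arguments default to 0) *)
Inductive prval : prcode -> seq nat -> nat -> Prop :=
  | pv_zero v : prval PZero v 0
  | pv_succ v : prval PSucc v (nth 0 v 0).+1
  | pv_proj i v : prval (PProj i) v (nth 0 v i)
  | pv_comp f gs v ys y :
      prvals gs v ys -> prval f ys y -> prval (PComp f gs) v y
  | pv_rec0 f g v y : prval f v y -> prval (PRec f g) (0 :: v) y
  | pv_recS f g n v y z :
      prval (PRec f g) (n :: v) y -> prval g (n :: y :: v) z ->
      prval (PRec f g) (n.+1 :: v) z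
  | pv_mu f v n :
      prval f (n :: v) 0 ->
      (forall m, (m < n)%N -> exists y, prval f (m :: v) y.+1) ->
      prval (PMu f) v n
with prvals : seq prcode -> seq nat -> seq nat -> Prop :=
  | pvs_nil v : prvals [::] v [::]
  | pvs_cons g gs v y ys :
      prval g v y -> prvals gs v ys -> prvals (g :: gs) v (y :: ys).

Definition decides_wa_problem (e : prcode)
    (Pre P : forall s, wa s -> wa s -> Prop) : Prop :=
  forall s (A B : wa s), Pre s A B ->
    (P s A B -> prval e [:: instance_code A B] 1) /\
    (~ P s A B -> prval e [:: instance_code A B] 0).

Definition fin_amb_instance s (A B : wa s) : Prop :=
  [/\ wa_nonneg A, wa_nonneg B, finitely_ambiguous A & finitely_ambiguous B].

(* Main.v *)
(* Up to constant factors the weight of a word is the largest weight of an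
   accepting path, so A is not big-O of B iff there are words with an accepting
   path of A whose weight exceeds, by an arbitrarily large factor, that of every
   accepting path of B.  Follow a path of A together with the boundedly many
   accepting paths of B in a finite product graph and record, for each edge, the
   vector of logarithms of the weight ratios.  A run decomposes into a short run
   and closed walks through the set T of its visited states, so for each T the
   question is whether a nonnegative integer combination of the vectors of the
   closed walks inside T is positive in all coordinates.

   If so, pumping these closed walks is a finite certificate of non-big-O.  If
   not, Gordan's theorem gives multipliers y >= 0, y <> 0 that make every closed
   walk nonpositive, hence a potential on T, which bounds all runs inside T: a
   certificate of big-O.  The multipliers and potentials can be taken in the ring
   generated by the logarithms of primes.  Strict inequalities there can be
   verified numerically; under Schanuel's conjecture these logarithms are
   algebraically independent, so equalities hold coefficientwise.  Searching for
   either kind of certificate therefore always terminates. *)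

Require Import Defs.
From HB Require Import structures.
From mathcomp Require Import all_boot all_order all_algebra zify ring lra.
From mathcomp Require Import Rstruct boolp.
From mathcomp Require reals.
From Stdlib Require Rpower Rseries SeqProp.
Set Implicit Arguments.
Unset Strict Implicit.
Unset Printing Implicit Defensive.

(** * Programs and computable functions *)

(** The ambiguity of [B] is not part of the input. A certificate of big-O therefore guesses a bound
    [K], and its checker rules out more than [K] distinct accepting runs. Two runs that have merged
    in a state may or may not be the same run, so the product graph labels each listed run by its
    first copy in the list. It also keeps the set of states reached by unlisted runs. In this way a
    finite graph can tell whether listed runs are distinct and whether all accepting runs of [B] are
    listed; a comparison with the weight of [B] rests on both.

    Certificates must be finite objects. Gordan's alternative is proved by a method that never
    divides, so the multipliers lie in the ring generated by the logarithms and not just in its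
    fraction field. Potentials are maximal gains of walks, hence sums of products of multipliers and
    log-ratios, and lie in the same ring. Each such number is written as two multisets of monomials,
    and the test for zero is equality of the multisets. Both checkers are sound by elementary
    arguments; Schanuel's conjecture enters in the existence of certificates. *)

Definition nat_computable (k : nat) (f : seq nat -> nat) : Prop :=
  exists e, forall v, size v = k -> prval e v (f v).

Lemma nat_computable_ext k f g :
  (forall v, size v = k -> f v = g v) -> nat_computable k f -> nat_computable k g.
Proof. by move=> fg [e eP]; exists e => v vk; rewrite -fg //; apply: eP. Qed.

Lemma nat_computable_proj k i : nat_computable k (fun v => nth 0 v i).
Proof. by exists (PProj i) => v _; constructor. Qed.

Lemma nat_computable_comps k (gs : seq (seq nat -> nat)) :
  foldr (fun g P => nat_computable k g /\ P) True gs ->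
  exists es, forall v, size v = k -> prvals es v [seq g v | g <- gs].
Proof.
elim: gs => [|g gs IH] /=; first by exists [::] => v _; constructor.
case=> -[e eP] /IH[es esP]; exists (e :: es) => v vk.
by constructor; [apply: eP | apply: esP].
Qed.

Lemma nat_computable_comp k (f : seq nat -> nat) (gs : seq (seq nat -> nat)) :
  nat_computable (size gs) f ->
  foldr (fun g P => nat_computable k g /\ P) True gs ->
  nat_computable k (fun v => f [seq g v | g <- gs]).
Proof.
case=> e eP /nat_computable_comps[es esP]; exists (PComp e es) => v vk.
by apply: pv_comp (esP v vk) _; apply: eP; rewrite size_map.
Qed.

Lemma nat_computableS k f :
  nat_computable k f -> nat_computable k (fun v => (f v).+1).
Proof.
move=> fP; apply: (@nat_computable_comp k (fun v => (nth 0 v 0).+1) [:: f]) => //.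
by exists PSucc => v _; constructor.
Qed.

Lemma nat_computable_const k c : nat_computable k (fun=> c).
Proof.
elim: c => [|c IH]; first by exists PZero => v _; constructor.
exact: nat_computableS.
Qed.

(** [PRec] recurses on its first argument and hands the remaining list to its step, so the program
    evaluates the counter and copies all [k] arguments by projections. This is why [nat_computable]
    fixes an arity. *)
Lemma nat_computable_rec k n f g :
  nat_computable k n -> nat_computable k f -> nat_computable k.+2 g ->
  nat_computable k
    (fun v => nat_rect (fun=> nat) (f v) (fun i y => g [:: i, y & v]) (n v)).
Proof.
case=> en enP [ef efP] [eg egP].
exists (PComp (PRec ef eg) (en :: [seq PProj i | i <- iota 0 k])) => v vk.
apply: (@pv_comp _ _ _ (n v :: v)).
  constructor; first exact: enP.
  have: [seq nth 0 v i | i <- iota 0 k] = v.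
    by rewrite -{2}(mkseq_nth 0 v) vk.
  move=> {2}<-; elim: (iota 0 k) => [|i l IH] /=; first by constructor.
  by constructor=> //; constructor.
elim: (n v) => [|m IH] /=; first by constructor; apply: efP.
by apply: pv_recS IH _; apply: egP; rewrite /= vk.
Qed.

(** The premise of [pv_mu] on smaller arguments asks for successor values; they exist because [f] is
    total and nonzero there. *)
Lemma nat_computable_search k n f :
  nat_computable k.+1 f ->
  (forall v, size v = k -> f (n v :: v) = 0) ->
  (forall v m, size v = k -> m < n v -> f (m :: v) != 0) ->
  nat_computable k n.
Proof.
case=> e eP n0 nmin; exists (PMu e) => v vk; constructor.
  by rewrite -(n0 v vk); apply: eP; rewrite /= vk.
move=> m mn; exists (f (m :: v)).-1.
by rewrite prednK ?lt0n ?nmin //; apply: eP; rewrite /= vk.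
Qed.

(** * Arithmetic on natural numbers *)

Definition op1 (o : nat -> nat) (v : seq nat) := o (nth 0 v 0).
Definition op2 (o : nat -> nat -> nat) (v : seq nat) := o (nth 0 v 0) (nth 0 v 1).

Lemma nat_computable1 k o f :
  nat_computable 1 (op1 o) -> nat_computable k f ->
  nat_computable k (fun v => o (f v)).
Proof. by move=> oP fP; apply: (@nat_computable_comp k (op1 o) [:: f]). Qed.

Lemma nat_computable2 k o f g :
  nat_computable 2 (op2 o) -> nat_computable k f -> nat_computable k g ->
  nat_computable k (fun v => o (f v) (g v)).
Proof. by move=> oP fP gP; apply: (@nat_computable_comp k (op2 o) [:: f; g]). Qed.

Lemma nat_computable_rec1 o a g :
  o 0 = a -> (forall n, o n.+1 = g n (o n)) ->
  nat_computable 2 (op2 g) -> nat_computable 1 (op1 o).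
Proof.
move=> o0 oS gP.
apply: nat_computable_ext (nat_computable_rec (nat_computable_proj 1 0)
  (nat_computable_const 1 a)
  (nat_computable2 gP (nat_computable_proj 3 0) (nat_computable_proj 3 1))) => v _.
by rewrite /op1; elim: (nth 0 v 0) => //= n ->; rewrite oS.
Qed.

Lemma nat_computable_rec2 o a g :
  (forall x, o x 0 = a x) -> (forall x n, o x n.+1 = g x (o x n)) ->
  nat_computable 1 (op1 a) -> nat_computable 2 (op2 g) ->
  nat_computable 2 (op2 o).
Proof.
move=> o0 oS aP gP.
(* The step receives the counter, the previous value, [x] and the bound, in this order. *)
apply: nat_computable_ext (nat_computable_rec (nat_computable_proj 2 1)
  (nat_computable1 aP (nat_computable_proj 2 0))
  (nat_computable2 gP (nat_computable_proj 4 2) (nat_computable_proj 4 1))) => v vk.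
case: v vk => [|x [|y []]] //= _; rewrite /op2 /=.
by elim: y => [|n /= ->]; rewrite ?o0 ?oS.
Qed.

Lemma nat_computable_id : nat_computable 1 (op1 id).
Proof. exact: nat_computable_proj. Qed.

Lemma nat_computable_fst : nat_computable 2 (op2 (fun x _ => x)).
Proof. exact: nat_computable_proj. Qed.

Lemma nat_computable_snd : nat_computable 2 (op2 (fun _ y => y)).
Proof. exact: nat_computable_proj. Qed.

Lemma nat_computable_add : nat_computable 2 (op2 addn).
Proof.
apply: (nat_computable_rec2 (g := fun _ y => y.+1) addn0 addnS).
  exact: nat_computable_id.
exact: (nat_computableS nat_computable_snd).
Qed.

Lemma nat_computable_mul : nat_computable 2 (op2 muln).
Proof.
apply: (nat_computable_rec2 muln0 mulnS); last exact: nat_computable_add.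
exact: nat_computable_const.
Qed.

Lemma nat_computable_exp : nat_computable 2 (op2 expn).
Proof.
apply: (nat_computable_rec2 expn0 expnS); last exact: nat_computable_mul.
exact: nat_computable_const.
Qed.

Lemma nat_computable_pred : nat_computable 1 (op1 predn).
Proof. by apply: (@nat_computable_rec1 _ 0 (fun x _ => x)); last exact: nat_computable_proj. Qed.

Lemma nat_computable_sub : nat_computable 2 (op2 subn).
Proof.
apply: (nat_computable_rec2 (g := fun _ y => y.-1) subn0 subnS).
  exact: nat_computable_id.
exact: (nat_computable1 nat_computable_pred nat_computable_snd).
Qed.

(** The recurrence [n.+1./2 = n - n./2] avoids a case distinction on parity. *)
Lemma nat_computable_half : nat_computable 1 (op1 half).
Proof.
apply: (@nat_computable_rec1 _ 0 subn) => // [n|]; last exact: nat_computable_sub.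
by rewrite /= uphalf_half -{3}[n](odd_double_half n) -addnn addnA addnK.
Qed.

Lemma nat_computable_iter_half : nat_computable 2 (op2 (fun x k => iter k half x)).
Proof.
apply: (@nat_computable_rec2 _ id (fun _ y => y./2)) => //; first exact: nat_computable_id.
exact: (nat_computable1 nat_computable_half nat_computable_snd).
Qed.

Lemma nat_computable_odd : nat_computable 1 (op1 (fun n => odd n : nat)).
Proof.
apply: (@nat_computable_rec1 _ 0 (fun _ y => 1 - y)) => //.
  by move=> n /=; case: (odd n).
exact: (nat_computable2 nat_computable_sub (nat_computable_const 2 1) nat_computable_snd).
Qed.

(** * Lists coded as natural numbers *)

Definition code_head n := head 0 (CodeSeq.decode n).
Definition code_behead n := CodeSeq.code (behead (CodeSeq.decode n)).
(** [CodeSeq.code] sends the empty list to 0 and [x :: s] to [2 ^ x] times the odd number built from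
    the code of [s]; this is that step on codes. *)
Definition code_cons x n := 2 ^ x * n.*2.+1.

Lemma iter_half_code x n : iter x half (code_cons x n) = n.*2.+1.
Proof.
rewrite /code_cons; elim: x => [|x IH]; first by rewrite expn0 mul1n.
by rewrite iterSr expnS -mulnA mul2n doubleK.
Qed.

Lemma code_headE x s : code_head (CodeSeq.code (x :: s)) = x.
Proof. by rewrite /code_head CodeSeq.codeK. Qed.

Lemma code_beheadE x s : code_behead (CodeSeq.code (x :: s)) = CodeSeq.code s.
Proof. by rewrite /code_behead CodeSeq.codeK. Qed.

Lemma nat_computable_code_cons : nat_computable 2 (op2 code_cons).
Proof.
apply: (@nat_computable2 2 muln (fun v => 2 ^ (nth 0 v 0)) (fun v => (nth 0 v 1).*2.+1)
  nat_computable_mul).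
  exact: (nat_computable2 nat_computable_exp (nat_computable_const 2 2)
           nat_computable_fst).
apply: nat_computableS.
apply: nat_computable_ext (nat_computable2 nat_computable_add nat_computable_snd
         nat_computable_snd) => v _.
by rewrite -addnn.
Qed.

(* The head of a code is its 2-adic valuation, found by searching for the first
   odd iterated half; replacing the code 0 by 1 makes the search terminate. *)
Lemma nat_computable_code_head : nat_computable 1 (op1 code_head).
Proof.
pose nz n := n + (1 - n).
have nzP : nat_computable 2 (fun v => nz (nth 0 v 1)).
  apply: (nat_computable2 nat_computable_add); first exact: nat_computable_proj.
  apply: (nat_computable2 nat_computable_sub); first exact: nat_computable_const.
  exact: nat_computable_proj.
have sP : nat_computable 2 (fun v => 1 - odd (iter (nth 0 v 0) half (nz (nth 0 v 1)))).
  apply: (nat_computable2 nat_computable_sub); first exact: nat_computable_const.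
  apply: (nat_computable1 nat_computable_odd).
  exact: (nat_computable2 nat_computable_iter_half nzP nat_computable_fst).
have nzE n : exists m, nz n = code_cons (code_head n) m.
  rewrite -[n]CodeSeq.decodeK; case: (CodeSeq.decode n) => [|x s].
    by exists 0; rewrite /code_head CodeSeq.codeK.
  exists (CodeSeq.code s); rewrite code_headE /nz.
  rewrite -[CodeSeq.code (x :: s)]/(code_cons x (CodeSeq.code s)) /code_cons.
  suff /eqP->: 1 - 2 ^ x * (CodeSeq.code s).*2.+1 == 0 by rewrite addn0.
  by rewrite subn_eq0 muln_gt0 expn_gt0.
apply: (nat_computable_search sP) => [[|n []] //|[|n []] // m] _; rewrite /op1 /=.
  by have [m ->] := nzE n; rewrite iter_half_code /= odd_double.
have [r ->] := nzE n; move: (code_head n) => x mx.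
rewrite /code_cons -(subnK (ltnW mx)) addnC expnD -mulnA.
have ->: iter m half (2 ^ m * (2 ^ (x - m) * r.*2.+1)) = 2 ^ (x - m) * r.*2.+1.
  elim: m {mx} (_ * r.*2.+1) => [|m IH] y; first by rewrite mul1n.
  by rewrite iterSr expnS -mulnA mul2n doubleK.
have ->: odd (2 ^ (x - m) * r.*2.+1) = false; last by [].
by rewrite oddM oddX orbF subn_eq0 leqNgt mx.
Qed.

(** After as many halvings as the head says, the odd number [m.*2.+1] remains, with [m] the code of
    the tail; one more halving yields [m]. The code 0 stays 0. *)
Lemma nat_computable_code_behead : nat_computable 1 (op1 code_behead).
Proof.
have H := nat_computable2 nat_computable_iter_half nat_computable_id
   (nat_computableS nat_computable_code_head).
apply: nat_computable_ext H => v _; rewrite /op1; move: (nth 0 v 0) => n.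
rewrite -[n]CodeSeq.decodeK; case: (CodeSeq.decode n) => [|x s].
  by rewrite /code_head /code_behead.
rewrite code_beheadE code_headE iterS.
by rewrite -[CodeSeq.code (x :: s)]/(code_cons x (CodeSeq.code s)) iter_half_code /= uphalf_double.
Qed.

(** * Computability between countable types *)

Definition computable (T U : countType) (f : T -> U) : Prop :=
  exists e, forall x, prval e [:: pickle x] (pickle (f x)).

Lemma computable_ext (T U : countType) (f g : T -> U) :
  f =1 g -> computable f -> computable g.
Proof. by move=> fg [e eP]; exists e => x; rewrite -fg. Qed.

Lemma computable_comp (C T U : countType) (f : T -> U) (g : C -> T) :
  computable f -> computable g -> computable (fun c => f (g c)).
Proof.
case=> ef efP [eg egP]; exists (PComp ef [:: eg]) => c.
by apply: pv_comp (efP _); constructor; [exact: egP | constructor].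
Qed.

Lemma computable_id (T : countType) : computable (fun x : T => x).
Proof. by exists (PProj 0) => x; apply: (pv_proj 0). Qed.

Lemma computable_const (T U : countType) (u : U) : computable (fun _ : T => u).
Proof. by have [e eP] := nat_computable_const 1 (pickle u); exists e => x; apply: eP. Qed.

(** [pickle] stores pairs, lists and Booleans arithmetically, so an operation on them is computable
    once an arithmetic one on codes matches it. *)
Lemma computable_code1 (C T U : countType) (f : C -> T) (h : C -> U) o :
  nat_computable 1 (op1 o) -> (forall c, pickle (h c) = o (pickle (f c))) ->
  computable f -> computable h.
Proof.
case=> eo eoP hP [ef efP]; exists (PComp eo [:: ef]) => c; rewrite hP.
apply: pv_comp (eoP [:: pickle (f c)] erefl).
by constructor; [exact: efP | constructor].
Qed.

Lemma computable_code2 (C T T' U : countType) (f : C -> T) (g : C -> T') (h : C -> U) o :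
  nat_computable 2 (op2 o) -> (forall c, pickle (h c) = o (pickle (f c)) (pickle (g c))) ->
  computable f -> computable g -> computable h.
Proof.
case=> eo eoP hP [ef efP] [eg egP]; exists (PComp eo [:: ef; eg]) => c; rewrite hP.
apply: pv_comp (eoP [:: pickle (f c); pickle (g c)] erefl).
by constructor; [exact: efP | constructor; [exact: egP | constructor]].
Qed.

Lemma computable_same_code (C T U : countType) (f : C -> T) (h : C -> U) :
  (forall c, pickle (h c) = pickle (f c)) -> computable f -> computable h.
Proof. by move=> hP; apply: (computable_code1 nat_computable_id). Qed.

Lemma computable_pair (C T U : countType) (f : C -> T) (g : C -> U) :
  computable f -> computable g -> computable (fun c => (f c, g c)).
Proof.
apply: (computable_code2 (o := fun x y => code_cons x (code_cons y 0))) => //.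
apply: (nat_computable2 nat_computable_code_cons); first exact: nat_computable_proj.
apply: (nat_computable2 nat_computable_code_cons); first exact: nat_computable_proj.
exact: nat_computable_const.
Qed.

Lemma computable_fst (C T U : countType) (f : C -> T * U) :
  computable f -> computable (fun c => (f c).1).
Proof.
apply: (computable_code1 nat_computable_code_head) => c.
by case: (f c) => x y; rewrite -[pickle (x, y)]/(CodeSeq.code [:: pickle x; pickle y]) code_headE.
Qed.

Lemma computable_snd (C T U : countType) (f : C -> T * U) :
  computable f -> computable (fun c => (f c).2).
Proof.
apply: (computable_code1 (o := fun x => code_head (code_behead x))) => [|c].
  by apply: (nat_computable1 nat_computable_code_head); apply: nat_computable_code_behead.
case: (f c) => x y; rewrite -[pickle (x, y)]/(CodeSeq.code [:: pickle x; pickle y]).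
by rewrite code_beheadE code_headE.
Qed.

(** The step program has to be right only below [n c]; in a fold over a list, this is where the
    [i]-th element exists. *)
Lemma computable_rec (C U : countType) (F : C -> nat -> U) (n : C -> nat) eg :
  computable (fun c => F c 0) -> computable n ->
  (forall c i, i < n c ->
    prval eg [:: i; pickle (F c i); pickle c] (pickle (F c i.+1))) ->
  computable (fun c => F c (n c)).
Proof.
case=> ea eaP [en enP] egP.
exists (PComp (PRec ea eg) [:: en; PProj 0]) => c.
apply: (@pv_comp _ _ _ [:: n c; pickle c]).
  by constructor; [exact: enP | constructor; [exact: (pv_proj 0) | constructor]].
suff: forall m, m <= n c -> prval (PRec ea eg) [:: m; pickle c] (pickle (F c m)).
  exact.
elim=> [_|m IH mn]; first by constructor; apply: eaP.
by apply: pv_recS (IH (ltnW mn)) _; apply: egP.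
Qed.

Lemma computable_nat_rect (C U : countType) (n : C -> nat) (a : C -> U)
    (g : C -> nat -> U -> U) :
  computable n -> computable a ->
  computable (fun p : C * (nat * U) => g p.1 p.2.1 p.2.2) ->
  computable (fun c => nat_rect (fun=> U) (a c) (g c) (n c)).
Proof.
move=> nP aP [eg egP].
have [pk pkP] : nat_computable 3 (fun v => code_cons (nth 0 v 2)
    (code_cons (code_cons (nth 0 v 0) (code_cons (nth 0 v 1) 0)) 0)).
  do ?[exact: nat_computable_proj | exact: nat_computable_const
      | apply: (nat_computable2 nat_computable_code_cons)].
apply: (@computable_rec _ _ (fun c i => nat_rect (fun=> U) (a c) (g c) i) n
         (PComp eg [:: pk])) => // c i _.
set y := nat_rect _ _ _ i.
apply: pv_comp (egP (c, (i, y))).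
by constructor; [exact: (pkP [:: _; _; _]) | constructor].
Qed.

Lemma nat_computable_iter_behead :
  nat_computable 2 (op2 (fun x k => iter k code_behead x)).
Proof.
apply: (@nat_computable_rec2 _ id (fun _ y => code_behead y)) => //.
  exact: nat_computable_id.
exact: (nat_computable1 nat_computable_code_behead nat_computable_snd).
Qed.

Lemma iter_code_behead i (t : seq nat) :
  iter i code_behead (CodeSeq.code t) = CodeSeq.code (drop i t).
Proof.
elim: i t => [|i IH] t; first by rewrite drop0.
by rewrite iterSr; case: t => [|x t]; [rewrite (IH [::]) | rewrite code_beheadE IH].
Qed.

(** A code is at least as large as the length of its list, so it bounds a count of the non-empty
    iterated tails. *)
Lemma computable_size (C T : countType) (s : C -> seq T) :
  computable s -> computable (fun c => size (s c)).
Proof.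
pose o n := nat_rect (fun=> nat) 0 (fun i y => y + (0 < iter i code_behead n)) n.
have oP : nat_computable 1 (op1 o).
  have I1 := nat_computable_id.
  apply: (nat_computable_rec (f := fun=> 0) (g := fun v =>
     nth 0 v 1 + (0 < iter (nth 0 v 0) code_behead (nth 0 v 2))) I1).
    exact: nat_computable_const.
  apply: (nat_computable2 nat_computable_add); first exact: nat_computable_proj.
  have P i := nat_computable_proj 3 i.
  have S := nat_computable2 nat_computable_sub.
  have H := S _ _ _ (nat_computable_const 3 1)
     (S _ _ _ (nat_computable_const 3 1) (nat_computable2 nat_computable_iter_behead (P 2) (P 0))).
  apply: nat_computable_ext H => v _; by case: (iter _ _ _).
apply: (computable_code1 oP) => c; rewrite /o -[pickle _]/(size (s c)).
have code0 (t : seq nat) : (0 < CodeSeq.code t) = (0 < size t).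
  by case: t => [|x t] //=; rewrite muln_gt0 expn_gt0.
have bound (t : seq nat) : size t <= CodeSeq.code t.
  elim: t => [|x t IH] //=; rewrite (leq_trans _ (leq_pmull _ _)) ?expn_gt0 //.
  by rewrite ltnS -addnn (leq_trans IH) ?leq_addr.
rewrite -[pickle (s c)]/(CodeSeq.code (map pickle (s c))) -(size_map pickle (s c)).
move: (map _ _) => t.
have E n : nat_rect (fun=> nat) 0
   (fun i y => y + (0 < iter i code_behead (CodeSeq.code t))) n = minn n (size t).
  elim: n => [|n /= ->]; first by rewrite min0n.
  rewrite iter_code_behead code0 size_drop subn_gt0 /minn.
  by case: (ltngtP n.+1 (size t)); case: (ltngtP n (size t)) => //=; try lia.
by rewrite E; apply/esym/minn_idPr.
Qed.

(** Recursion over the prefixes [take i]. The next element is read off the code as the head of the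
    [i]-th tail, so the program works without a default element of [T]. *)
Lemma computable_foldl (C T U : countType) (h : C -> U -> T -> U) z (s : C -> seq T) :
  computable z -> computable s ->
  computable (fun p : C * (U * T) => h p.1 p.2.1 p.2.2) ->
  computable (fun c => foldl (h c) (z c) (s c)).
Proof.
move=> zP sP [eh ehP]; have [es esP] := sP.
have [pk pkP] : nat_computable 4 (fun v => code_cons (nth 0 v 2) (code_cons
    (code_cons (nth 0 v 1)
    (code_cons (code_head (iter (nth 0 v 0) code_behead (nth 0 v 3))) 0)) 0)).
  do ?[exact: nat_computable_proj | exact: nat_computable_const
      | apply: (nat_computable2 nat_computable_code_cons)
      | apply: (nat_computable1 nat_computable_code_head)
      | apply: (nat_computable2 nat_computable_iter_behead)].
have [step stepP] : exists e, forall i y c, 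
    prval e [:: i; y; pickle c] (CodeSeq.code [:: pickle c; CodeSeq.code
       [:: y; code_head (iter i code_behead (pickle (s c)))]]).
  exists (PComp pk [:: PProj 0; PProj 1; PProj 2; PComp es [:: PProj 2]]) => i y c.
  apply: pv_comp (pkP [:: i; y; pickle c; pickle (s c)] erefl).
  constructor; first exact: (pv_proj 0).
  constructor; first exact: (pv_proj 1).
  constructor; first exact: (pv_proj 2).
  constructor; last by constructor.
  apply: pv_comp (esP c).
  by constructor; [exact: (pv_proj 2) | constructor].
suff: computable (fun c => foldl (h c) (z c) (take (size (s c)) (s c))).
  by apply: computable_ext => c; rewrite take_size.
apply: (@computable_rec _ _ (fun c i => foldl (h c) (z c) (take i (s c)))
          (fun c => size (s c)) (PComp eh [:: step])).
- by apply: computable_ext zP => c; rewrite take0.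
- exact: computable_size.
move=> c i isz; set y := foldl _ _ _.
have x0 : T by case: (s c) isz.
have E: code_head (iter i code_behead (pickle (s c))) = pickle (nth x0 (s c) i).
  rewrite -[pickle (s c)]/(CodeSeq.code (map pickle (s c))) iter_code_behead.
  by rewrite -map_drop (drop_nth x0) // map_cons code_headE.
apply: pv_comp (_ : prval eh [:: pickle (c, (y, nth x0 (s c) i))] _).
  constructor; last by constructor.
  by have := stepP i (pickle y) c; rewrite E.
have := ehP (c, (y, nth x0 (s c) i)).
by rewrite /= (take_nth x0) ?foldl_rcons.
Qed.

Create HintDb computable.

(* Proves [computable (fun c => E)] by recursion on the structure of [E]; the hint
   base maps the head symbol of [E] to the corresponding closure lemma. *)
Ltac comp :=
  lazymatch goal with |- computable ?f => change (computable (fun c => f c)) end;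
  cbv beta;
  first
  [ assumption
  | match goal with |- computable (fun _ => ?k) => exact: computable_const end
  | exact: computable_id
  | match goal with
    | |- computable (fun c => (_, _)) => apply: computable_pair; comp
    | |- computable (fun c => _.1) => apply: computable_fst; comp
    | |- computable (fun c => _.2) => apply: computable_snd; comp
    | H : computable ?f |- computable (fun c => ?f (@?g c)) =>
        refine (@computable_comp _ _ _ f g H _); comp
    | H : computable (fun p => ?f (fst p) (snd p)) |- computable (fun c => ?f (@?a c) (@?b c)) =>
        refine (@computable_comp _ _ _ _ (fun c => (a c, b c)) H _); comp
    | H : computable (fun p => ?f (fst p) (fst (snd p)) (snd (snd p)))
      |- computable (fun c => ?f (@?a c) (@?b c) (@?d c)) =>
        refine (@computable_comp _ _ _ _ (fun c => (a c, (b c, d c))) H _); comp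
    end
  | solve [auto 1 with computable nocore] ].

(** * Closure of computable functions under list, arithmetic and Boolean operations *)

Lemma computable_cons (C T : countType) (x : C -> T) s :
  computable x -> computable s -> computable (fun c => x c :: s c).
Proof. exact: (computable_code2 nat_computable_code_cons). Qed.
#[local] Hint Extern 0 (computable (fun c => _ :: _)) =>
  (apply: computable_cons; comp) : computable.

Lemma computable_foldr (C T U : countType) (h : C -> T -> U -> U) z (s : C -> seq T) :
  computable z -> computable s ->
  computable (fun p : C * (T * U) => h p.1 p.2.1 p.2.2) ->
  computable (fun c => foldr (h c) (z c) (s c)).
Proof.
move=> zP sP hP.
have revP : computable (fun c => rev (s c)).
  apply: (@computable_ext _ _ (fun c => foldl (fun l x => x :: l) [::] (s c))) => [c|].
    by elim/last_ind: (s c) => // t x IH; rewrite foldl_rcons rev_rcons IH.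
  apply: (@computable_foldl _ _ _ (fun _ l x => x :: l)) => //; first exact: computable_const.
  comp.
apply: (@computable_ext _ _ (fun c => foldl (fun y x => h c x y) (z c) (rev (s c)))) => [c|].
  by rewrite foldl_rev.
apply: (@computable_foldl _ _ _ (fun c y x => h c x y)) => //.
apply: (computable_comp (g := fun p : C * (U * T) => (p.1, (p.2.2, p.2.1))) hP).
comp.
Qed.
#[local] Hint Extern 0 (computable (fun c => foldr _ _ _)) =>
  (apply: computable_foldr; comp) : computable.
#[local] Hint Extern 0 (computable (fun c => foldl _ _ _)) =>
  (apply: computable_foldl; comp) : computable.
#[local] Hint Extern 0 (computable (fun c => size _)) =>
  (apply: computable_size; comp) : computable.

Section Nat.
Variables (C : countType).
Implicit Types f g : C -> nat.

Lemma computable_succ f : computable f -> computable (fun c => (f c).+1).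
Proof.
by apply: (computable_code1 (o := succn)) => //; apply: nat_computableS; apply: nat_computable_id.
Qed.
Lemma computable_addn f g : computable f -> computable g -> computable (fun c => f c + g c).
Proof. exact: (computable_code2 nat_computable_add). Qed.
Lemma computable_subn f g : computable f -> computable g -> computable (fun c => f c - g c).
Proof. exact: (computable_code2 nat_computable_sub). Qed.
Lemma computable_muln f g : computable f -> computable g -> computable (fun c => f c * g c).
Proof. exact: (computable_code2 nat_computable_mul). Qed.
Lemma computable_expn f g : computable f -> computable g -> computable (fun c => f c ^ g c).
Proof. exact: (computable_code2 nat_computable_exp). Qed.

Lemma computable_eqn f g : computable f -> computable g -> computable (fun c => f c == g c).
Proof.
move=> fP gP.
apply: (@computable_same_code _ _ _ (fun c => 1 - ((f c - g c) + (g c - f c)))).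
  by move=> c; rewrite -[RHS]/(_ - _) -[LHS]/(nat_of_bool _); case: (ltngtP (f c) (g c)); lia.
apply: computable_subn; first exact: computable_const.
by apply: computable_addn; apply: computable_subn.
Qed.

Lemma computable_leq f g : computable f -> computable g -> computable (fun c => f c <= g c).
Proof. by move=> fP gP; apply: computable_eqn; [exact: computable_subn | exact:
  computable_const]. Qed.

End Nat.
#[local] Hint Extern 0 (computable (fun c => _.+1)) =>
  (apply: computable_succ; comp) : computable.
#[local] Hint Extern 0 (computable (fun c => addn _ _)) =>
  (apply: computable_addn; comp) : computable.
#[local] Hint Extern 0 (computable (fun c => subn _ _)) =>
  (apply: computable_subn; comp) : computable.
#[local] Hint Extern 0 (computable (fun c => muln _ _)) =>
  (apply: computable_muln; comp) : computable.
#[local] Hint Extern 0 (computable (fun c => expn _ _)) =>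
  (apply: computable_expn; comp) : computable.
#[local] Hint Extern 0 (computable (fun c => leq _ _)) =>
  (apply: computable_leq; comp) : computable.

Section Generic.
Variables (C T U : countType).
Implicit Types (b : C -> bool) (s : C -> seq T).

Lemma computable_eq (f g : C -> T) : computable f -> computable g ->
  computable (fun c => f c == g c).
Proof.
move=> fP gP.
apply: (@computable_ext _ _ (fun c => pickle (f c) == pickle (g c))) => [c|].
  by rewrite (inj_eq (pcan_inj pickleK)).
by apply: computable_eqn; [apply: computable_same_code fP | apply: computable_same_code gP].
Qed.

Lemma computable_if b (f g : C -> T) :
  computable b -> computable f -> computable g -> computable (fun c => if b c then f c else g c).
Proof.
move=> bP fP gP.
apply: (@computable_ext _ _ (fun c => nat_rect (fun=> T) (g c) (fun _ _ => f c) (b c : nat))).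
  by move=> c; case: (b c).
apply: (@computable_nat_rect _ _ (fun c => b c : nat) g (fun c _ _ => f c)) => //.
by apply: (computable_comp fP); apply: computable_fst; apply: computable_id.
Qed.

End Generic.
#[local] Hint Extern 0 (computable (fun c => _ == _)) =>
  (apply: computable_eq; comp) : computable.
#[local] Hint Extern 0 (computable (fun c => if _ then _ else _)) =>
  (apply: computable_if; comp) : computable.

Section Bool.
Variables (C : countType).
Implicit Types a b : C -> bool.

Lemma computable_negb b : computable b -> computable (fun c => ~~ b c).
Proof. by move=> bP; apply: computable_if => //; apply: computable_const. Qed.
Lemma computable_andb a b : computable a -> computable b -> computable (fun c => a c && b c).
Proof. by move=> aP bP; apply: computable_if => //; apply: computable_const. Qed.
Lemma computable_orb a b : computable a -> computable b -> computable (fun c => a c || b c).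
Proof. by move=> aP bP; apply: computable_if => //; apply: computable_const. Qed.
Lemma computable_implyb a b : computable a -> computable b -> computable (fun c => a c ==> b c).
Proof. by move=> aP bP; apply: computable_if => //; apply: computable_const. Qed.

End Bool.
#[local] Hint Extern 0 (computable (fun c => ~~ _)) =>
  (apply: computable_negb; comp) : computable.
#[local] Hint Extern 0 (computable (fun c => _ && _)) =>
  (apply: computable_andb; comp) : computable.
#[local] Hint Extern 0 (computable (fun c => _ || _)) =>
  (apply: computable_orb; comp) : computable.
#[local] Hint Extern 0 (computable (fun c => _ ==> _)) =>
  (apply: computable_implyb; comp) : computable.

Lemma computable_map (C T U : countType) (f : C -> T -> U) (s : C -> seq T) :
  computable s -> computable (fun p : C * T => f p.1 p.2) ->
  computable (fun c => [seq f c x | x <- s c]).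
Proof.
move=> sP fP; apply: (@computable_ext _ _ (fun c => foldr (fun x l => f c x :: l) [::] (s c))) =>
  [c|].
  by elim: (s c) => //= x t ->.
comp.
Qed.
#[local] Hint Extern 0 (computable (fun c => map _ _)) =>
  (apply: computable_map; comp) : computable.

Lemma computable_filter (C T : countType) (a : C -> T -> bool) (s : C -> seq T) :
  computable s -> computable (fun p : C * T => a p.1 p.2) ->
  computable (fun c => [seq x <- s c | a c x]).
Proof.
move=> sP aP; apply: (@computable_ext _ _
   (fun c => foldr (fun x l => if a c x then x :: l else l) [::] (s c))) => [c|].
  by elim: (s c) => //= x t ->.
comp.
Qed.
#[local] Hint Extern 0 (computable (fun c => filter _ _)) =>
  (apply: computable_filter; comp) : computable.

Lemma computable_has (C T : countType) (a : C -> T -> bool) (s : C -> seq T) :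
  computable s -> computable (fun p : C * T => a p.1 p.2) ->
  computable (fun c => has (a c) (s c)).
Proof.
move=> sP aP; apply: (@computable_ext _ _ (fun c => foldr (fun x b =>
  a c x || b) false (s c))) => [c|].
  by elim: (s c) => //= x t ->.
comp.
Qed.
#[local] Hint Extern 0 (computable (fun c => has _ _)) =>
  (apply: computable_has; comp) : computable.

Lemma computable_all (C T : countType) (a : C -> T -> bool) (s : C -> seq T) :
  computable s -> computable (fun p : C * T => a p.1 p.2) ->
  computable (fun c => all (a c) (s c)).
Proof.
move=> sP aP; apply: (@computable_ext _ _ (fun c => foldr (fun x b => a c x && b) true (s c))) =>
  [c|].
  by elim: (s c) => //= x t ->.
comp.
Qed.
#[local] Hint Extern 0 (computable (fun c => all _ _)) =>
  (apply: computable_all; comp) : computable.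

Lemma computable_count (C T : countType) (a : C -> T -> bool) (s : C -> seq T) :
  computable s -> computable (fun p : C * T => a p.1 p.2) ->
  computable (fun c => count (a c) (s c)).
Proof.
move=> sP aP; apply: (@computable_ext _ _
   (fun c => foldr (fun x n => if a c x then n.+1 else n) 0 (s c))) => [c|].
  by elim: (s c) => //= x t ->; case: (a c x).
comp.
Qed.
#[local] Hint Extern 0 (computable (fun c => count _ _)) =>
  (apply: computable_count; comp) : computable.

Lemma computable_cat (C T : countType) (s t : C -> seq T) : computable s -> computable t ->
  computable (fun c => s c ++ t c).
Proof.
move=> sP tP; apply: (@computable_ext _ _ (fun c => foldr cons (t c) (s c))) => [c|].
  by elim: (s c) => //= x u ->.
apply: computable_foldr => //; comp.
Qed.
#[local] Hint Extern 0 (computable (fun c => _ ++ _)) =>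
  (apply: computable_cat; comp) : computable.

Lemma computable_flatten (C T : countType) (s : C -> seq (seq T)) :
  computable s -> computable (fun c => flatten (s c)).
Proof.
move=> sP; apply: (@computable_ext _ _ (fun c => foldr (fun x l => x ++ l) [::] (s c))) => //.
comp.
Qed.
#[local] Hint Extern 0 (computable (fun c => flatten _)) =>
  (apply: computable_flatten; comp) : computable.

Lemma computable_head (C T : countType) x0 (s : C -> seq T) : computable s ->
  computable (fun c => head x0 (s c)).
Proof.
move=> sP; apply: (@computable_ext _ _ (fun c => foldr (fun x _ => x) x0 (s c))) => [c|].
  by case: (s c).
comp.
Qed.
#[local] Hint Extern 0 (computable (fun c => head _ _)) =>
  (apply: computable_head; comp) : computable.

Lemma computable_behead (C T : countType) (s : C -> seq T) : computable s ->
  computable (fun c => behead (s c)).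
Proof.
apply: (computable_code1 nat_computable_code_behead) => c.
rewrite -[RHS]/(code_behead (CodeSeq.code [seq pickle x | x <- s c])).
by case: (s c) => [|x t] //=; rewrite code_beheadE.
Qed.
#[local] Hint Extern 0 (computable (fun c => behead _)) =>
  (apply: computable_behead; comp) : computable.

Lemma computable_nth (C T : countType) x0 (s : C -> seq T) (i : C -> nat) : computable s ->
  computable i ->
  computable (fun c => nth x0 (s c) (i c)).
Proof.
move=> sP iP; apply: (@computable_ext _ _
   (fun c => head x0 (nat_rect (fun=> seq T) (s c) (fun _ t => behead t) (i c)))) => [c|].
  rewrite -nth0; set d := nat_rect _ _ _ _; suff ->: d = drop (i c) (s c).
    by rewrite nth_drop addn0.
  by rewrite /d; elim: (i c) => [|n /= ->]; rewrite ?drop0 // -drop1 drop_drop.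
apply: computable_head; apply: computable_nat_rect => //.
comp.
Qed.
#[local] Hint Extern 0 (computable (fun c => nth _ _ _)) =>
  (apply: computable_nth; comp) : computable.

Lemma computable_index (C T : countType) (x : C -> T) (s : C -> seq T) : computable x ->
  computable s ->
  computable (fun c => index (x c) (s c)).
Proof.
move=> xP sP; apply: (@computable_ext _ _
   (fun c => foldr (fun y n => if y == x c then 0 else n.+1) 0 (s c))) => [c|].
  by elim: (s c) => //= y t ->; rewrite /index /=; case: eqP.
comp.
Qed.
#[local] Hint Extern 0 (computable (fun c => index _ _)) =>
  (apply: computable_index; comp) : computable.

Lemma computable_in (C T : countType) (x : C -> T) (s : C -> seq T) : computable x ->
  computable s ->
  computable (fun c => x c \in s c).
Proof.
move=> xP sP; apply: (@computable_ext _ _ (fun c => has (fun y => y == x c) (s c))) => [c|].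
  by rewrite has_pred1.
comp.
Qed.
#[local] Hint Extern 0 (computable (fun c => _ \in _)) =>
  (apply: computable_in; comp) : computable.

Lemma computable_iter (C T : countType) (f : C -> T -> T) (n : C -> nat) (x : C -> T) :
  computable n -> computable x -> computable (fun p : C * T => f p.1 p.2) ->
  computable (fun c => iter (n c) (f c) (x c)).
Proof.
move=> nP xP fP; apply: (@computable_ext _ _
   (fun c => nat_rect (fun=> T : Type) (x c) (fun _ => f c) (n c))) => [c|].
  by elim: (n c) => //= k ->.
apply: (@computable_nat_rect _ _ n x (fun c _ => f c)) => //; comp.
Qed.
#[local] Hint Extern 0 (computable (fun c => iter _ _ _)) =>
  (apply: computable_iter; comp) : computable.

Lemma computable_nseq (C T : countType) (n : C -> nat) (x : C -> T) : computable n ->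
  computable x ->
  computable (fun c => nseq (n c) (x c)).
Proof.
move=> nP xP; apply: (@computable_ext _ _
   (fun c => nat_rect (fun=> seq T) [::] (fun _ => cons (x c)) (n c))) => [c|].
  by elim: (n c) => //= k ->.
apply: (@computable_nat_rect _ _ n (fun _ => [::]) (fun c _ => cons (x c))) => //; comp.
Qed.
#[local] Hint Extern 0 (computable (fun c => nseq _ _)) =>
  (apply: computable_nseq; comp) : computable.

Lemma computable_uniq (C T : countType) (s : C -> seq T) : computable s ->
  computable (fun c => uniq (s c)).
Proof.
move=> sP; apply: (@computable_ext _ _ (fun c =>
   (foldr (fun x (st : seq T * bool) => (x :: st.1, ~~ (x \in st.1) && st.2))
      ([::], true) (s c)).2)) => [c|].
  set F := (foldr _ _); suff ->: F (s c) = (s c, uniq (s c)) by [].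
  by elim: (s c) => //= x t ->.
comp.
Qed.
#[local] Hint Extern 0 (computable (fun c => uniq _)) =>
  (apply: computable_uniq; comp) : computable.

(** The rest of [t c] travels along the fold; its first element is taken as a list of length at most
    one, which avoids a default value. *)
Lemma computable_zip (C T U : countType) (s : C -> seq T) (t : C -> seq U) :
  computable s -> computable t -> computable (fun c => zip (s c) (t c)).
Proof.
move=> sP tP; apply: (@computable_ext _ _ (fun c =>
   (foldl (fun (st : seq U * seq (T * U)) x =>
       (behead st.1, st.2 ++ [seq (x, y) | y <- foldr (fun y _ => [:: y]) [::] st.1]))
     (t c, [::]) (s c)).2)) => [c|].
  set F := foldl _; suff E u v acc : (F (v, acc) u).2 = acc ++ zip u v by rewrite E.
  elim: u v acc => [|x u IH] [|y v] acc; rewrite /F /= ?cats0 // -/F IH ?cats0 -?catA //.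
  by case: u {IH} => [|? ?]; rewrite cats0.
comp.
Qed.
#[local] Hint Extern 0 (computable (fun c => zip _ _)) =>
  (apply: computable_zip; comp) : computable.

Lemma computable_iota (C : countType) (m n : C -> nat) :
  computable m -> computable n -> computable (fun c => iota (m c) (n c)).
Proof.
move=> mP nP; apply: (@computable_ext _ _ (fun c =>
   nat_rect (fun=> seq nat) [::] (fun i l => l ++ [:: m c + i]) (n c))) => [c|].
  elim: (n c) => // k IH; suff ->: iota (m c) k.+1 = iota (m c) k ++ [:: m c + k] by rewrite -IH.
  by rewrite -addn1 iotaD.
apply: (@computable_nat_rect _ _ n (fun _ => [::]) (fun c i l => l ++ [:: m c + i])) => //; comp.
Qed.
#[local] Hint Extern 0 (computable (fun c => iota _ _)) =>
  (apply: computable_iota; comp) : computable.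

Lemma computable_perm_eq (C T : countType) (s t : C -> seq T) :
  computable s -> computable t -> computable (fun c => perm_eq (s c) (t c)).
Proof.
move=> sP tP; apply: (@computable_ext _ _ (fun c =>
   all (fun x => count (fun y => y == x) (s c) == count (fun y =>
     y == x) (t c)) (s c ++ t c))) => //.
comp.
Qed.
#[local] Hint Extern 0 (computable (fun c => perm_eq _ _)) =>
  (apply: computable_perm_eq; comp) : computable.

Lemma computable_dvdn (C : countType) (m n : C -> nat) :
  computable m -> computable n -> computable (fun c => m c %| n c).
Proof.
move=> mP nP; apply: (@computable_ext _ _ (fun c =>
   has (fun k => k * m c == n c) (iota 0 (n c).+1))) => [c|].
  apply/hasP/idP => [[k _ /eqP<-]|/dvdnP[k nE]]; first exact: dvdn_mull.
  have [m0|m0] := posnP (m c).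
    by exists 0; [rewrite mem_iota | rewrite nE m0 !muln0].
  by exists k; [rewrite mem_iota ltnS nE leq_pmulr | rewrite nE].
comp.
Qed.
#[local] Hint Extern 0 (computable (fun c => dvdn _ _)) =>
  (apply: computable_dvdn; comp) : computable.

Lemma computable_prime (C : countType) (p : C -> nat) :
  computable p -> computable (fun c => prime (p c)).
Proof.
move=> pP; apply: (@computable_ext _ _ (fun c =>
   (1 < p c) && all (fun d => ~~ (d %| p c)) (iota 2 (p c - 2)))) => [c|].
  apply/andP/primeP => -[p1 /= H]; split=> //; [|apply/allP] => d.
    move=> dp; have := dvdn_leq (ltnW p1) dp; have := dvdn_gt0 (ltnW p1) dp => d0 dle.
    apply/norP => -[/eqP d1 /eqP dnp]; have /(allP H) /= : d \in iota 2 (p c - 2).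
      by rewrite mem_iota; lia.
    by rewrite dp.
  rewrite mem_iota => dI; apply/negP => /H /orP[/eqP|/eqP]; lia.
comp.
Qed.
#[local] Hint Extern 0 (computable (fun c => prime _)) =>
  (apply: computable_prime; comp) : computable.

(** * Certificates and their checkers *)

Definition raw_aut : Type := (nat * nat * seq (seq (seq rat)) * seq nat)%type.
Definition instance : Type := (nat * raw_aut * raw_aut)%type.
HB.instance Definition _ := Countable.on raw_aut.
HB.instance Definition _ := Countable.on instance.

(** Meant for nonnegative weights; a negative numerator would be read as 0. *)
Definition int_natpart (z : int) : nat := if z is Posz n then n else 0.
Definition num_den (r : rat) : nat * nat :=
  (int_natpart (numq r), int_natpart (denq r)).

Definition raw_size (R : raw_aut) : nat := R.1.1.1.
Definition raw_init (R : raw_aut) : nat := R.1.1.2.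
Definition raw_final (R : raw_aut) (q : nat) : bool := q \in R.2.
(** Indices out of range give the weight 0, that is, no transition. *)
Definition raw_weight (R : raw_aut) (a i j : nat) : nat * nat :=
  num_den (nth 0%R (nth [::] (nth [::] R.1.2 a) i) j).

Notation alphabet x := x.1.1.
Notation autA x := x.1.2.
Notation autB x := x.2.

(* A run of [A] together with a list of runs of [B] on the same word.  Each listed
   run of [B] is kept as (index of its first copy in the list, current state);
   the last component is the set of states reached by the runs of [B] that are
   not listed. *)
Definition pstate : Type := (nat * seq (nat * nat) * seq nat)%type.
HB.instance Definition _ := Countable.on pstate.
Notation stateA p := p.1.1.
Notation tracks p := p.1.2.
Notation others p := p.2.

(* Letter, next state of [A], next states of the listed runs of [B]. *)
Definition edge : Type := (nat * nat * seq nat)%type.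
HB.instance Definition _ := Countable.on edge.

Section Checker.
Variable x : instance.
Implicit Types (p : pstate) (e : edge).

Definition trans (R : raw_aut) (a i j : nat) : bool := 0 < (raw_weight R a i j).1.

Definition moves p e : seq (nat * nat) := zip [seq z.2 | z <- tracks p] e.2.
(** Among the one-step extensions of listed runs, equal pairs of label and new state mean equal
    runs. *)
Definition keys p e : seq (nat * nat) := zip [seq z.1 | z <- tracks p] e.2.

Definition enabled p e : bool :=
  [&& trans (autA x) e.1.1 (stateA p) e.1.2, size e.2 == size (tracks p) &
      all (fun u => trans (autB x) e.1.1 u.1 u.2) (moves p e)].

(** An unlisted run extends an unlisted one, or branches off a listed one along a transition that no
    copy of it takes. *)
Definition step_others p e : seq nat :=
  [seq r <- iota 0 (raw_size (autB x)) |
     has (fun d => trans (autB x) e.1.1 d r) (others p) ||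
     has (fun z => trans (autB x) e.1.1 z.2 r && ((z.1, r) \notin keys p e)) (tracks p)].

Definition step p e : pstate :=
  (e.1.2, [seq (index k (keys p e), k.2) | k <- keys p e], step_others p e).

(** All tracks start as copies of the empty run and share the label 0; without tracks the empty run
    itself is unlisted. *)
Definition init (m : nat) : pstate :=
  (raw_init (autA x), nseq m (0, raw_init (autB x)), if m == 0 then [:: raw_init (autB x)] else
    [::]).

Definition accepting p : bool :=
  raw_final (autA x) (stateA p) && all (fun z => raw_final (autB x) z.2) (tracks p).

(** Holds when every accepting run of [B] is listed, since [others] collects the ends of all
    unlisted ones. *)
Definition complete p : bool := all (fun d => ~~ raw_final (autB x) d) (others p).

Definition lists (n m : nat) : seq (seq nat) :=
  iter m (fun L => flatten [seq [seq i :: t | t <- L] | i <- iota 0 n]) [:: [::]].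

Definition edges p : seq edge :=
  [seq e <- flatten [seq flatten [seq [seq (a, q, ps)
          | ps <- lists (raw_size (autB x)) (size (tracks p))]
        | q <- iota 0 (raw_size (autA x))]
      | a <- iota 0 (alphabet x)] | enabled p e].

(** Entry 0 belongs to the run of [A], entry [j.+1] to the [j]-th listed run of [B]; a pair stands
    for a fraction. *)
Definition edge_weights p e : seq (nat * nat) :=
  raw_weight (autA x) e.1.1 (stateA p) e.1.2 ::
  [seq raw_weight (autB x) e.1.1 u.1 u.2 | u <- moves p e].

Definition mul_weights (u v : seq (nat * nat)) : seq (nat * nat) :=
  [seq (w.1.1 * w.2.1, w.1.2 * w.2.2) | w <- zip u v].

Definition unit_weights (m : nat) : seq (nat * nat) := nseq m.+1 (1, 1).

Definition walk_step (st : bool * pstate * seq (nat * nat)) e :=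
  (st.1.1 && enabled st.1.2 e, step st.1.2 e, mul_weights st.2 (edge_weights st.1.2 e)).

Definition walk p (es : seq edge) : bool * pstate * seq (nat * nat) :=
  foldl walk_step (true, p, unit_weights (size (tracks p))) es.

(** [uv.1] connects and [uv.2] is a loop at its end. Only loop weights are accumulated, because
    connecting walks contribute factors that pumping does not change. *)
Definition pump_step (st : bool * pstate * seq (nat * nat)) (uv : seq edge * seq edge) :=
  ([&& st.1.1, (walk st.1.2 uv.1).1.1, (walk (walk st.1.2 uv.1).1.2 uv.2).1.1 &
      (walk (walk st.1.2 uv.1).1.2 uv.2).1.2 == (walk st.1.2 uv.1).1.2],
   (walk st.1.2 uv.1).1.2,
   mul_weights st.2 (walk (walk st.1.2 uv.1).1.2 uv.2).2).

Definition pump (m : nat) (s : seq (seq edge * seq edge)) :=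
  foldl pump_step (true, init m, unit_weights m) s.

Definition dominates (u : seq (nat * nat)) : bool :=
  all (fun b => b.1 * (head (0, 1) u).2 < (head (0, 1) u).1 * b.2) (behead u).

Definition check_not_bigO (c : nat * seq (seq edge * seq edge)) : bool :=
  [&& (pump c.1 c.2).1.1, accepting (pump c.1 c.2).1.2, complete (pump c.1 c.2).1.2 &
      dominates (pump c.1 c.2).2].

End Checker.

(* An integer polynomial in the logarithms of the primes: its monomials with
   positive sign and those with negative sign, repeated according to
   multiplicity; the monomial [\prod_p (ln p)^e_p] is represented by the positive
   integer [\prod_p p^e_p]. *)
Definition logpoly : Type := (seq nat * seq nat)%type.
HB.instance Definition _ := Countable.on logpoly.

(** The prime factors with multiplicity, expressed by bounded searches so that computability is
    immediate. *)
Definition factors (n : nat) : seq nat :=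
  flatten [seq [seq p | i <- [seq i <- iota 1 n | p ^ i %| n]] | p <- [seq p <- iota 2 n | prime
    p]].

Definition mono_mul (s t : seq nat) : seq nat := flatten [seq [seq m * n | n <- t] | m <- s].

Definition lp_add (P Q : logpoly) : logpoly := (P.1 ++ Q.1, P.2 ++ Q.2).
Definition lp_opp (P : logpoly) : logpoly := (P.2, P.1).
Definition lp_mul (P Q : logpoly) : logpoly :=
  (mono_mul P.1 Q.1 ++ mono_mul P.2 Q.2, mono_mul P.1 Q.2 ++ mono_mul P.2 Q.1).
Definition lp_log (u : nat * nat) : logpoly := (factors u.1, factors u.2).
Definition lp_wf (P : logpoly) : bool :=
  all (fun m => 0 < m) P.1 && all (fun m => 0 < m) P.2.

Definition frac_add (u v : nat * nat) := (u.1 * v.2 + v.1 * u.2, u.2 * v.2).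
Definition frac_mul (u v : nat * nat) := (u.1 * v.1, u.2 * v.2).

(* Riemann sums for the logarithm with mesh [1 / n]. *)
Definition log_lo (n p : nat) : nat * nat :=
  foldr (fun i u => frac_add (1, i) u) (0, 1) (iota n.+1 (p * n - n)).
Definition log_hi (n p : nat) : nat * nat :=
  foldr (fun i u => frac_add (1, i) u) (0, 1) (iota n (p * n - n)).
Definition mono_lo (n m : nat) : nat * nat :=
  foldr (fun p u => frac_mul (log_lo n p) u) (1, 1) (factors m).
Definition mono_hi (n m : nat) : nat * nat :=
  foldr (fun p u => frac_mul (log_hi n p) u) (1, 1) (factors m).
Definition monos_lo (n : nat) (s : seq nat) : nat * nat :=
  foldr (fun m u => frac_add (mono_lo n m) u) (0, 1) s.
Definition monos_hi (n : nat) (s : seq nat) : nat * nat :=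
  foldr (fun m u => frac_add (mono_hi n m) u) (0, 1) s.
Definition frac_lt (u v : nat * nat) : bool := u.1 * v.2 < v.1 * u.2.

Definition lp_pos (n : nat) (P : logpoly) : bool := frac_lt (monos_hi n P.2) (monos_lo n P.1).
(** Equality of multisets is the test for the value zero; the precision [n] serves strict
    positivity. *)
Definition lp_nonneg (n : nat) (P : logpoly) : bool := perm_eq P.1 P.2 || lp_pos n P.

(* The list of visited states, with multipliers [ys] of the runs of [B] and a
   potential [phis] on the visited states. *)
Definition item : Type := ((pstate * seq pstate) * (seq logpoly * seq logpoly))%type.
HB.instance Definition _ := Countable.on item.

Definition visit (T : seq pstate) (p : pstate) : seq pstate := if p \in T then T else p :: T.

(** The sum of [y_j * (ln b_j - ln a)], where [a] is the weight of [A] and the [b_j] are those of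
    the listed runs of [B]. *)
Definition lp_drift (u : seq (nat * nat)) (ys : seq logpoly) : logpoly :=
  foldr (fun yb P => lp_add (lp_mul yb.1 (lp_add (lp_log yb.2) (lp_opp (lp_log (head (0, 1)
    u))))) P)
    ([::], [::]) (zip ys (behead u)).

Definition potential (T : seq pstate) (phis : seq logpoly) (p : pstate) : logpoly :=
  nth ([::], [::]) phis (index p T).

(** Nonnegative exactly if the weighted log-advantage of [A] on the edge is at most the drop of the
    potential. *)
Definition lp_slack (x : instance) (T : seq pstate) (ys phis : seq logpoly) (p : pstate) (e :
  edge) :=
  lp_add (potential T phis p)
    (lp_add (lp_opp (potential T phis (step x p e))) (lp_drift (edge_weights x p e) ys)).

Definition check_potential (x : instance) (n : nat) (T : seq pstate) (ys phis : seq logpoly) :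
  bool :=
  all (fun t => all (fun e => (step x t e \in T) ==> lp_nonneg n (lp_slack x T ys phis t e))
    (edges x t)) T.

Definition check_item (x : instance) (n : nat) (it : item) : bool :=
  [&& size it.2.1 == size (tracks it.1.1), all lp_wf it.2.1, all lp_wf it.2.2,
      all (lp_nonneg n) it.2.1, has (lp_pos n) it.2.1 &
      check_potential x n it.1.2 it.2.1 it.2.2].

(** Unique labels mean distinct runs, so the first conjunct verifies the guessed bound [K] on the
    ambiguity of [B]. Multipliers are demanded where all accepting runs of [B] are listed. *)
Definition check_final (x : instance) (K n : nat) (it : item) : bool :=
  accepting x it.1.1 ==>
    ~~ ((K < size (tracks it.1.1)) && uniq [seq z.1 | z <- tracks it.1.1]) &&
    (complete x it.1.1 ==> check_item x n it).

Definition check_closed (x : instance) (I : seq item) (it : item) : bool :=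
  all (fun e => (step x it.1.1 e, visit it.1.2 (step x it.1.1 e)) \in [seq i.1 | i <- I])
    (edges x it.1.1).

(** Track numbers go up to [K.+1], since it takes [K.+1] tracks to expose an excess over [K]. The
    precision is a successor because the bounds on logarithms hold for positive mesh parameters. *)
Definition check_bigO (x : instance) (c : nat * nat * seq item) : bool :=
  [&& all (fun m => (init x m, [:: init x m]) \in [seq i.1 | i <- c.2]) (iota 0 c.1.1.+2),
      all (check_closed x c.2) c.2 & all (check_final x c.1.1 c.1.2.+1) c.2].

(** * Computability of the checkers *)

Lemma computable_num_den (C : countType) (r : C -> rat) :
  computable r -> computable (fun c => num_den (r c)).
Proof.
(* [g] turns a rational into nested lists with the same code, whose parts are reachable by list
   operations. *)
move=> rP; pose ci z : seq (seq nat) := match z with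
  | Posz n => [:: [:: n]; [::]] | Negz n => [:: [::]; [:: n]] end.
pose g q := [:: ci (numq q); ci (denq q)].
have gP : computable (fun c => g (r c)).
  apply: computable_same_code rP => c; rewrite /g; case: (r c) => -[[n|n] [d|d]] h //.
apply: (@computable_ext _ _ (fun c =>
   (head 0 (head [::] (head [::] (g (r c)))), head 0 (head [::] (head [::] (behead (g (r c)))))))).
  by move=> c; rewrite /g /num_den /=; case: (numq _); case: (denq _).
comp.
Qed.
#[local] Hint Extern 0 (computable (fun c => num_den _)) =>
  (apply: computable_num_den; comp) : computable.

Ltac comp_via H :=
  first
  [ match goal with |- computable (fun c => _ (@?a c)) =>
      refine (@computable_comp _ _ _ _ (fun c => a c) H _) end
  | match goal with |- computable (fun c => _ (@?a c) (@?b c)) =>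
      refine (@computable_comp _ _ _ _ (fun c => (a c, b c)) H _) end
  | match goal with |- computable (fun c => _ (@?a c) (@?b c) (@?d c)) =>
      refine (@computable_comp _ _ _ _ (fun c => (a c, b c, d c)) H _) end
  | match goal with |- computable (fun c => _ (@?a c) (@?b c) (@?d c) (@?e c)) =>
      refine (@computable_comp _ _ _ _ (fun c => (a c, b c, d c, e c)) H _) end
  | match goal with |- computable (fun c => _ (@?a c) (@?b c) (@?d c) (@?e c) (@?f c) (@?g c)) =>
      refine (@computable_comp _ _ _ _ (fun c => (a c, b c, d c, e c, f c, g c)) H _) end ];
  comp.

Lemma computable_raw_weight :
  computable (fun u : raw_aut * nat * nat * nat =>
    raw_weight u.1.1.1 u.1.1.2 u.1.2 u.2).
Proof. by rewrite /raw_weight; comp. Qed.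
#[local] Hint Extern 0 (computable (fun c => raw_weight _ _ _ _)) =>
  comp_via computable_raw_weight : computable.

Lemma computable_trans :
  computable (fun u : raw_aut * nat * nat * nat =>
    trans u.1.1.1 u.1.1.2 u.1.2 u.2).
Proof. by rewrite /trans; comp. Qed.
#[local] Hint Extern 0 (computable (fun c => trans _ _ _ _)) =>
  comp_via computable_trans : computable.

Lemma computable_enabled :
  computable (fun u : instance * pstate * edge =>
    enabled u.1.1 u.1.2 u.2).
Proof. by rewrite /enabled /moves; comp. Qed.
#[local] Hint Extern 0 (computable (fun c => enabled _ _ _)) =>
  comp_via computable_enabled : computable.

Lemma computable_step : computable (fun u : instance * pstate * edge => step u.1.1 u.1.2 u.2).
Proof. by rewrite /step /step_others /keys /raw_size; comp. Qed.
#[local] Hint Extern 0 (computable (fun c => step _ _ _)) =>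
  comp_via computable_step : computable.

Lemma computable_init : computable (fun u : instance * nat => init u.1 u.2).
Proof. by rewrite /init /raw_init; comp. Qed.
#[local] Hint Extern 0 (computable (fun c => init _ _)) =>
  comp_via computable_init : computable.

Lemma computable_accepting : computable (fun u : instance * pstate => accepting u.1 u.2).
Proof. by rewrite /accepting /raw_final; comp. Qed.
#[local] Hint Extern 0 (computable (fun c => accepting _ _)) =>
  comp_via computable_accepting : computable.

Lemma computable_complete : computable (fun u : instance * pstate => complete u.1 u.2).
Proof. by rewrite /complete /raw_final; comp. Qed.
#[local] Hint Extern 0 (computable (fun c => complete _ _)) =>
  comp_via computable_complete : computable.

Lemma computable_lists : computable (fun u : nat * nat => lists u.1 u.2).
Proof. by rewrite /lists; comp. Qed.
#[local] Hint Extern 0 (computable (fun c => lists _ _)) =>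
  comp_via computable_lists : computable.

Lemma computable_edges : computable (fun u : instance * pstate => edges u.1 u.2).
Proof. by rewrite /edges /raw_size; comp. Qed.
#[local] Hint Extern 0 (computable (fun c => edges _ _)) =>
  comp_via computable_edges : computable.

Lemma computable_edge_weights :
  computable (fun u : instance * pstate * edge =>
    edge_weights u.1.1 u.1.2 u.2).
Proof. by rewrite /edge_weights /moves; comp. Qed.
#[local] Hint Extern 0 (computable (fun c => edge_weights _ _ _)) =>
  comp_via computable_edge_weights : computable.

Lemma computable_mul_weights :
  computable (fun u : seq (nat * nat) * seq (nat * nat) =>
    mul_weights u.1 u.2).
Proof. by rewrite /mul_weights; comp. Qed.
#[local] Hint Extern 0 (computable (fun c => mul_weights _ _)) =>
  comp_via computable_mul_weights : computable.

Lemma computable_walk :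
  computable (fun u : instance * pstate * seq edge =>
    walk u.1.1 u.1.2 u.2).
Proof. by rewrite /walk /walk_step /unit_weights; comp. Qed.
#[local] Hint Extern 0 (computable (fun c => walk _ _ _)) =>
  comp_via computable_walk : computable.

Lemma computable_pump :
  computable (fun u : instance * nat * seq (seq edge * seq edge) =>
    pump u.1.1 u.1.2 u.2).
Proof. by rewrite /pump /pump_step /unit_weights; comp. Qed.
#[local] Hint Extern 0 (computable (fun c => pump _ _ _)) =>
  comp_via computable_pump : computable.

Lemma computable_check_not_bigO :
  computable (fun u : instance * (nat * seq (seq edge * seq edge)) =>
    check_not_bigO u.1 u.2).
Proof. by rewrite /check_not_bigO /dominates; comp. Qed.
#[local] Hint Extern 0 (computable (fun c => check_not_bigO _ _)) =>
  comp_via computable_check_not_bigO : computable.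

Lemma computable_factors : computable (fun u : nat => factors u).
Proof. by rewrite /factors; comp. Qed.
#[local] Hint Extern 0 (computable (fun c => factors _)) =>
  comp_via computable_factors : computable.

Lemma computable_mono_mul : computable (fun u : seq nat * seq nat => mono_mul u.1 u.2).
Proof. by rewrite /mono_mul; comp. Qed.
#[local] Hint Extern 0 (computable (fun c => mono_mul _ _)) =>
  comp_via computable_mono_mul : computable.

Lemma computable_lp_add : computable (fun u : logpoly * logpoly => lp_add u.1 u.2).
Proof. by rewrite /lp_add; comp. Qed.
#[local] Hint Extern 0 (computable (fun c => lp_add _ _)) =>
  comp_via computable_lp_add : computable.

Lemma computable_lp_mul : computable (fun u : logpoly * logpoly => lp_mul u.1 u.2).
Proof. by rewrite /lp_mul; comp. Qed.
#[local] Hint Extern 0 (computable (fun c => lp_mul _ _)) =>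
  comp_via computable_lp_mul : computable.

Lemma computable_lp_wf : computable (fun u : logpoly => lp_wf u).
Proof. by rewrite /lp_wf; comp. Qed.
#[local] Hint Extern 0 (computable (fun c => lp_wf _)) =>
  comp_via computable_lp_wf : computable.

Lemma computable_frac_add :
  computable (fun u : (nat * nat) * (nat * nat) =>
    frac_add u.1 u.2).
Proof. by rewrite /frac_add; comp. Qed.
#[local] Hint Extern 0 (computable (fun c => frac_add _ _)) =>
  comp_via computable_frac_add : computable.

Lemma computable_log_lo : computable (fun u : nat * nat => log_lo u.1 u.2).
Proof. by rewrite /log_lo; comp. Qed.
#[local] Hint Extern 0 (computable (fun c => log_lo _ _)) =>
  comp_via computable_log_lo : computable.

Lemma computable_log_hi : computable (fun u : nat * nat => log_hi u.1 u.2).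
Proof. by rewrite /log_hi; comp. Qed.
#[local] Hint Extern 0 (computable (fun c => log_hi _ _)) =>
  comp_via computable_log_hi : computable.

Lemma computable_mono_lo : computable (fun u : nat * nat => mono_lo u.1 u.2).
Proof. by rewrite /mono_lo /frac_mul; comp. Qed.
#[local] Hint Extern 0 (computable (fun c => mono_lo _ _)) =>
  comp_via computable_mono_lo : computable.

Lemma computable_mono_hi : computable (fun u : nat * nat => mono_hi u.1 u.2).
Proof. by rewrite /mono_hi /frac_mul; comp. Qed.
#[local] Hint Extern 0 (computable (fun c => mono_hi _ _)) =>
  comp_via computable_mono_hi : computable.

Lemma computable_lp_pos : computable (fun u : nat * logpoly => lp_pos u.1 u.2).
Proof. by rewrite /lp_pos /frac_lt /monos_hi /monos_lo; comp. Qed.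
#[local] Hint Extern 0 (computable (fun c => lp_pos _ _)) =>
  comp_via computable_lp_pos : computable.

Lemma computable_lp_nonneg : computable (fun u : nat * logpoly => lp_nonneg u.1 u.2).
Proof. by rewrite /lp_nonneg; comp. Qed.
#[local] Hint Extern 0 (computable (fun c => lp_nonneg _ _)) =>
  comp_via computable_lp_nonneg : computable.

Lemma computable_lp_drift :
  computable (fun u : seq (nat * nat) * seq logpoly =>
    lp_drift u.1 u.2).
Proof. by rewrite /lp_drift /lp_opp /lp_log; comp. Qed.
#[local] Hint Extern 0 (computable (fun c => lp_drift _ _)) =>
  comp_via computable_lp_drift : computable.

Lemma computable_lp_slack :
  computable (fun u : instance * seq pstate * seq logpoly * seq logpoly * pstate * edge =>
    lp_slack u.1.1.1.1.1 u.1.1.1.1.2 u.1.1.1.2 u.1.1.2 u.1.2 u.2).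
Proof. by rewrite /lp_slack /potential /lp_opp; comp. Qed.
#[local] Hint Extern 0 (computable (fun c => lp_slack _ _ _ _ _ _)) =>
  comp_via computable_lp_slack : computable.

Lemma computable_check_item :
  computable (fun u : instance * nat * item =>
    check_item u.1.1 u.1.2 u.2).
Proof. by rewrite /check_item /check_potential; comp. Qed.
#[local] Hint Extern 0 (computable (fun c => check_item _ _ _)) =>
  comp_via computable_check_item : computable.

Lemma computable_check_final :
  computable (fun u : instance * nat * nat * item =>
    check_final u.1.1.1 u.1.1.2 u.1.2 u.2).
Proof. by rewrite /check_final; comp. Qed.
#[local] Hint Extern 0 (computable (fun c => check_final _ _ _ _)) =>
  comp_via computable_check_final : computable.

Lemma computable_check_closed :
  computable (fun u : instance * seq item * item =>
    check_closed u.1.1 u.1.2 u.2).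
Proof. by rewrite /check_closed /visit; comp. Qed.
#[local] Hint Extern 0 (computable (fun c => check_closed _ _ _)) =>
  comp_via computable_check_closed : computable.

Lemma computable_check_bigO :
  computable (fun u : instance * (nat * nat * seq item) =>
    check_bigO u.1 u.2).
Proof. by rewrite /check_bigO; comp. Qed.
#[local] Hint Extern 0 (computable (fun c => check_bigO _ _)) =>
  comp_via computable_check_bigO : computable.

(** * Deciding by a search for certificates *)

(* Every natural number is read as a certificate, so that an unbounded search
   never runs into an ill-formed code. *)
Definition parsable (T : countType) : Prop :=
  exists2 g : nat -> T, computable g & cancel pickle g.

Lemma parsable_nat : parsable nat.
Proof. by exists id => //; apply: computable_id. Qed.

(** On codes, decoding is the identity. *)
Lemma computable_decode : computable CodeSeq.decode.
Proof.
apply: (@computable_same_code _ _ _ id) (computable_id _) => n.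
by rewrite -[LHS]/(CodeSeq.code (map id (CodeSeq.decode n))) map_id CodeSeq.decodeK.
Qed.

Lemma parsable_seq (T : countType) : parsable T -> parsable (seq T).
Proof.
case=> g gP gK; exists (fun n => [seq g m | m <- CodeSeq.decode n]).
  by have dP := computable_decode; comp.
move=> s; rewrite -[pickle s]/(CodeSeq.code (map pickle s)) CodeSeq.codeK -map_comp.
by rewrite map_id_in // => y _; apply: gK.
Qed.

Lemma parsable_prod (T U : countType) : parsable T -> parsable U -> parsable (T * U)%type.
Proof.
case=> g gP gK [h hP hK].
exists (fun n => (g (head 0 (CodeSeq.decode n)), h (head 0 (behead (CodeSeq.decode n))))).
  by have dP := computable_decode; comp.
case=> y z; rewrite -[pickle (y, z)]/(CodeSeq.code [:: pickle y; pickle z]).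
by rewrite CodeSeq.codeK /= gK hK.
Qed.

(** Each number is tried as a certificate of both kinds. The search stops at the first success;
    since the two kinds never coexist, the value of [check1] there is the answer. *)
Lemma decide_by_certificates (I T0 T1 : countType)
    (check0 : I -> T0 -> bool) (check1 : I -> T1 -> bool) :
  parsable T0 -> parsable T1 ->
  computable (fun p : I * T0 => check0 p.1 p.2) ->
  computable (fun p : I * T1 => check1 p.1 p.2) ->
  exists e, forall x,
    ((exists c, check0 x c) \/ (exists c, check1 x c)) ->
    ((exists c, check0 x c) -> (exists c, check1 x c) -> False) ->
    ((exists c, check1 x c) -> prval e [:: pickle x] 1) /\
    ((exists c, check0 x c) -> prval e [:: pickle x] 0).
Proof.
case=> g0 g0P g0K [g1 g1P g1K] c0P c1P.
have [es esP] : computable (fun p : nat * I => ~~ (check0 p.2 (g0 p.1) || check1 p.2 (g1 p.1))).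
  by comp.
have [eo eoP] : computable (fun p : nat * I => check1 p.2 (g1 p.1)) by comp.
have [pk pkP] : nat_computable 2 (fun v => code_cons (nth 0 v 0) (code_cons (nth 0 v 1) 0)).
  do ?[exact: nat_computable_proj | exact: nat_computable_const
      | apply: (nat_computable2 nat_computable_code_cons)].
exists (PComp eo [:: PComp pk [:: PMu (PComp es [:: pk]); PProj 0]]) => x ex nboth.
have exn : exists n, check0 x (g0 n) || check1 x (g1 n).
  case: ex => -[c cP]; exists (pickle c); first by rewrite g0K cP.
  by rewrite g1K cP orbT.
case: (ex_minnP exn) => n nP nmin.
have run : prval (PComp eo [:: PComp pk [:: PMu (PComp es [:: pk]); PProj 0]])
    [:: pickle x] (check1 x (g1 n)).
  have esP' m : prval (PComp es [:: pk]) [:: m; pickle x]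
      (~~ (check0 x (g0 m) || check1 x (g1 m))).
    apply: pv_comp (esP (m, x)).
    by constructor; [exact: (pkP [:: m; pickle x]) | constructor].
  apply: pv_comp (eoP (n, x)).
  constructor; last by constructor.
  apply: pv_comp (pkP [:: n; pickle x] erefl).
  constructor; last by constructor; [exact: (pv_proj 0) | constructor].
  constructor; first by have := esP' n; rewrite nP.
  move=> m mn; exists 0; have := esP' m.
  by case cm: (_ || _) (nmin m) => [|] // /(_ isT); rewrite leqNgt mn.
split=> [ex1|ex0].
  suff c1 : check1 x (g1 n) by rewrite c1 in run.
  by case/orP: nP => // c0; case: nboth => //; exists (g0 n).
suff c1 : check1 x (g1 n) = false by rewrite c1 in run.
by apply/negP => c1; case: nboth => //; exists (g1 n).
Qed.

Definition instance_of s (A B : wa s) : instance := (s, raw_wa A, raw_wa B).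

Lemma wa_decision :
  (forall s (A B : wa s), fin_amb_instance A B ->
     [/\ (exists c, check_not_bigO (instance_of A B) c) \/
         (exists c, check_bigO (instance_of A B) c),
         forall c, check_not_bigO (instance_of A B) c -> ~ bigO A B &
         forall c, check_bigO (instance_of A B) c -> bigO A B]) ->
  exists e : prcode, decides_wa_problem e fin_amb_instance bigO.
Proof.
move=> H.
have pN := parsable_nat; have pS := parsable_seq; have pP := parsable_prod.
have pst : parsable pstate := pP _ _ (pP _ _ pN (pS _ (pP _ _ pN pN))) (pS _ pN).
have ped : parsable edge := pP _ _ (pP _ _ pN pN) (pS _ pN).
have plp : parsable logpoly := pP _ _ (pS _ pN) (pS _ pN).
have p0 := pP _ _ pN (pS _ (pP _ _ (pS _ ped) (pS _ ped))).
have p1 := pP _ _ (pP _ _ pN pN)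
  (pS _ (pP _ _ (pP _ _ pst (pS _ pst)) (pP _ _ (pS _ plp) (pS _ plp)))).
have [| |e eP] := decide_by_certificates (check0 := check_not_bigO) (check1 := check_bigO) p0 p1.
- exact: computable_check_not_bigO.
- exact: computable_check_bigO.
exists e => s A B /H[ex s0 s1].
have [|run1 run0] := eP (instance_of A B) ex.
  by case=> c0 /s0 nb [c1 /s1].
split=> b.
  by apply: run1; case: ex => // -[c /s0].
by apply: run0; case: ex => // -[c /s1].
Qed.

(** * Weights of paths *)

Import Order.TTheory GRing.Theory Num.Theory.
Local Open Scope ring_scope.

Definition frac_val (u : nat * nat) : rat := u.1%:R / u.2%:R.

Lemma frac_val_num_den (r : rat) : 0 <= r -> frac_val (num_den r) = r.
Proof.
move=> r0; rewrite /frac_val /num_den /= -[RHS]divq_num_den.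
have := denq_gt0 r; have : 0 <= numq r by rewrite numq_ge0.
by case: (numq r) => // n _; case: (denq r) => // d _.
Qed.

Lemma num_den_gt0 (r : rat) : (0 < (num_den r).2)%N.
Proof. by rewrite /num_den /=; have := denq_gt0 r; case: (denq r). Qed.

Lemma head_rev (T : Type) (x : T) s : head x (rev s) = last x s.
Proof. by case/lastP: s => // s y; rewrite rev_rcons last_rcons. Qed.

Section Paths.
Variable R : raw_aut.

Lemma raw_weight_den a i j : (0 < (raw_weight R a i j).2)%N.
Proof. exact: num_den_gt0. Qed.

Definition wt a i j : rat := frac_val (raw_weight R a i j).

Lemma wt_ge0 a i j : 0 <= wt a i j.
Proof. by rewrite divr_ge0 ?ler0n. Qed.

Lemma wt_gt0 a i j : (0 < wt a i j) = trans R a i j.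
Proof.
rewrite /wt /frac_val /trans; have := raw_weight_den a i j.
by case: (raw_weight R a i j) => n d /= d0; rewrite pmulr_lgt0 ?invr_gt0 ltr0n.
Qed.

Lemma wt_eq0 a i j : ~~ trans R a i j -> wt a i j = 0.
Proof. by rewrite -wt_gt0 lt_def wt_ge0 andbT negbK => /eqP. Qed.

(* Words and paths are read backwards: both lists start with the last step. *)
Fixpoint rpath (w h : seq nat) : bool :=
  match w, h with
  | [::], [::] => true
  | a :: w', q :: h' => rpath w' h' && trans R a (head (raw_init R) h') q
  | _, _ => false
  end.

Fixpoint rweight (w h : seq nat) : rat :=
  match w, h with
  | a :: w', q :: h' => rweight w' h' * wt a (head (raw_init R) h') q
  | _, _ => 1
  end.

Definition racc (w h : seq nat) : bool := rpath w h && raw_final R (head (raw_init R) h).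

Lemma rweight_ge0 w h : 0 <= rweight w h.
Proof. by elim: w h => [|a w IH] [|q h] //=; rewrite mulr_ge0 ?wt_ge0. Qed.

Lemma rweight_eq0 w h : size h = size w -> ~~ rpath w h -> rweight w h = 0.
Proof.
elim: w h => [|a w IH] [|q h] //= [sz]; rewrite negb_and => /orP[/IH-> //|/wt_eq0->].
  by rewrite mul0r.
by rewrite mulr0.
Qed.

Lemma rpath_size w h : rpath w h -> size h = size w.
Proof. by elim: w h => [|a w IH] [|q h] //= /andP[/IH->]. Qed.

End Paths.

Lemma mem_lists n m (t : seq nat) :
  (t \in lists n m) = (size t == m) && all (fun i => i < n)%N t.
Proof.
elim: m t => [|m IH] t; first by rewrite inE /=; case: t.
rewrite /lists iterS -/(lists n m); apply/flatten_mapP/idP => [[i] |].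
  rewrite mem_iota => /= lin /mapP[u uL ->] /=; move: uL; rewrite IH eqSS => /andP[-> ->].
  by rewrite lin.
case: t => [|i t] //=; rewrite eqSS => /and3P[st lin at_].
by exists i; rewrite ?mem_iota //; apply/map_f; rewrite IH st.
Qed.

Lemma uniq_lists n m : uniq (lists n m).
Proof.
elim: m => // m IH; rewrite /lists iterS -/(lists n m).
apply: (allpairs_uniq (f := fun i t => i :: t)) => //; first exact: iota_uniq.
by move=> [i t] [j u] _ _ /= [-> ->].
Qed.

Section Automaton.
Variables (s : nat) (A : wa s).
Hypothesis A0 : wa_nonneg A.
Notation R := (raw_wa A).
Notation n := (wa_n A).

Lemma wt_wa (a : 'I_s) (i j : 'I_n) : wt R a i j = wa_M A a i j.
Proof.
rewrite /wt /raw_weight /raw_wa /=.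
rewrite (nth_map a) ?size_enum_ord // nth_ord_enum.
rewrite (nth_map i) ?size_enum_ord // nth_ord_enum.
rewrite (nth_map j) ?size_enum_ord // nth_ord_enum.
by rewrite frac_val_num_den // A0.
Qed.

Lemma trans_wa a i j : trans R a i j -> [/\ (a < s)%N, (i < n)%N & (j < n)%N].
Proof.
rewrite -wt_gt0 /wt /raw_weight /raw_wa /=.
case: (ltnP a s) => [as_|?]; last first.
  by rewrite [X in nth [::] X i]nth_default; last rewrite size_map size_enum_ord //;
    rewrite !nth_nil /frac_val mul0r ltxx.
rewrite (nth_map (Ordinal as_)) ?size_enum_ord //.
case: (ltnP i n) => [i_|?]; last first.
  by rewrite [X in nth _ X j]nth_default; last rewrite size_map size_enum_ord //;
    rewrite !nth_nil /frac_val mul0r ltxx.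
rewrite (nth_map (Ordinal i_)) ?size_enum_ord //.
case: (ltnP j n) => [//|?].
by rewrite nth_default; last rewrite size_map size_enum_ord //; rewrite /frac_val mul0r ltxx.
Qed.

Lemma raw_final_wa (t : 'I_n) : raw_final R t = (t \in wa_F A).
Proof.
rewrite /raw_final /=; apply/mapP/idP => [[u]|tF]; last by exists t; rewrite ?mem_enum.
by rewrite mem_enum => uF /val_inj->.
Qed.

Definition rword (w : seq 'I_s) : seq nat := [seq val a | a <- rev w].

Lemma wa_mx_rcons w a : wa_mx A (rcons w a) = wa_mx A w *m wa_M A a.
Proof.
rewrite /wa_mx -cats1 foldr_cat /= mulmx1; elim: w => [|b w IH] /=; first by rewrite mul1mx.
by rewrite IH mulmxA.
Qed.

(** The expansion of a matrix product over paths; as lists are stored backwards, the last letter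
    prepends the last state. *)
Lemma wa_mxE w (t : 'I_n) : wa_mx A w (wa_q0 A) t =
  \sum_(h <- lists n (size w) | head (wa_q0 A : nat) h == t) rweight R (rword w) h.
Proof.
elim/last_ind: w t => [|w a IH] t.
  rewrite big_mkcond big_seq1 mxE /= (inj_eq val_inj).
  by case: eqP.
rewrite wa_mx_rcons mxE size_rcons /lists iterS -/(lists n (size w)).
rewrite big_flatten big_map /= (_ : iota 0 n = index_iota 0 n); last by rewrite /index_iota subn0.
rewrite big_mkord [RHS](bigD1 t) //= [X in _ = _ + X]big1 ?addr0; last first.
  by move=> j /negbTE jt; rewrite big_map big_pred0 // => u /=; rewrite (inj_eq val_inj) jt.
rewrite big_map /= eqxx.
have rw u : rweight R (rword (rcons w a)) (val t :: u) =
    rweight R (rword w) u * wt R a (head (val (wa_q0 A)) u) t.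
  by rewrite /rword rev_rcons.
under [RHS]eq_bigr do rewrite rw.
under eq_bigr do rewrite IH big_distrl /= big_mkcond.
rewrite exchange_big /= big_seq [RHS]big_seq; apply: eq_bigr => u.
rewrite mem_lists => /andP[_ un].
have hn : (head (val (wa_q0 A)) u < n)%N by case: u un {rw} => //= i u /andP[].
rewrite (bigD1 (Ordinal hn)) //= eqxx big1 ?addr0 ?wt_wa //.
  by rewrite -(wt_wa a (Ordinal hn)).
by move=> j jh; case: eqP => // e; rewrite -val_eqE /= e eqxx in jh.
Qed.

Lemma wa_funE w : wa_fun A w =
  \sum_(h <- lists n (size w) | racc R (rword w) h) rweight R (rword w) h.
Proof.
rewrite /wa_fun; under eq_bigr do rewrite wa_mxE big_mkcond.
rewrite exchange_big /= [RHS]big_mkcond big_seq [RHS]big_seq; apply: eq_bigr => u.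
rewrite mem_lists => /andP[/eqP su un].
have hn : (head (val (wa_q0 A)) u < n)%N by case: u un {su} => //= i u /andP[].
have rH : raw_final R (head (raw_init R) u) = (Ordinal hn \in wa_F A) := raw_final_wa (Ordinal hn).
rewrite /racc rH; case: (boolP (rpath _ _ _)) => [_|np] /=; last first.
  by rewrite big1 // => j _; rewrite rweight_eq0 ?if_same // su size_map size_rev.
case: ifP => hF.
  rewrite (bigD1 (Ordinal hn)) //= eqxx big1 ?addr0 // => j /andP[_ jh].
  by case: eqP => // e; rewrite -val_eqE /= e eqxx in jh.
rewrite big1 // => j jF; case: eqP => // e.
by rewrite (_ : Ordinal hn = j) ?jF // in hF; apply: val_inj.
Qed.

Lemma rpath_all w h : rpath R w h -> all (fun i => i < n)%N h.
Proof. by elim: w h => [|a w IH] [|q h] //= /andP[/IH-> /trans_wa[_ _ ->]]. Qed.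

Lemma racc_lists w h : racc R (rword w) h -> h \in lists n (size w).
Proof.
move=> /andP[p _]; rewrite mem_lists (rpath_size p) (rpath_all p).
by rewrite size_map size_rev eqxx.
Qed.

Lemma rweight_le_wa_fun w h : racc R (rword w) h -> rweight R (rword w) h <= wa_fun A w.
Proof.
move=> hh; rewrite wa_funE -big_filter (bigD1_seq h) /= ?filter_uniq ?uniq_lists //; last first.
  by rewrite mem_filter hh racc_lists.
rewrite lerDl.
by rewrite sumr_ge0 // => u _; apply: rweight_ge0.
Qed.

(** [hs] may contain repetitions and further lists, as lists of tracked runs do: the additional
    terms are nonnegative. *)
Lemma wa_fun_le_sum w (hs : seq (seq nat)) :
  (forall h, racc R (rword w) h -> h \in hs) ->
  wa_fun A w <= \sum_(h <- hs) rweight R (rword w) h.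
Proof.
move=> hsP; rewrite wa_funE -big_filter.
set l := filter _ _.
have ul : uniq l by rewrite filter_uniq ?uniq_lists.
have sub : {subset l <= hs} by move=> h; rewrite mem_filter => /andP[/hsP].
elim: hs {hsP} l ul sub => [|g hs IH] l ul sub.
  by case: l ul sub => [|u l] _; rewrite ?big_nil // => /(_ u (mem_head _ _)).
rewrite big_cons; have [gl|gl] := boolP (g \in l).
  rewrite (perm_big _ (perm_to_rem gl)) big_cons lerD2l; apply: IH; first exact: rem_uniq.
  move=> h; rewrite mem_rem_uniq // inE => /andP[/= hg /sub]; rewrite inE.
  by rewrite (negbTE hg).
rewrite -[leLHS]add0r lerD ?rweight_ge0 //; apply: IH => // h hl.
by have := sub h hl; rewrite inE => /orP[/eqP e|//]; rewrite e (negbTE gl) in hl.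
Qed.

Lemma wa_fun_le_mul w k X : 0 <= X ->
  (forall hs, uniq hs -> all (racc R (rword w)) hs -> (size hs <= k)%N) ->
  (forall h, racc R (rword w) h -> rweight R (rword w) h <= X) ->
  wa_fun A w <= k%:R * X.
Proof.
move=> X0 hk hX; rewrite wa_funE -big_filter.
set l := filter _ _.
have lk : (size l <= k)%N by apply: hk; rewrite ?filter_uniq ?uniq_lists ?filter_all.
have : \sum_(h <- l) rweight R (rword w) h <= \sum_(h <- l) X.
  rewrite big_seq [leRHS]big_seq; apply: ler_sum => h; rewrite mem_filter => /andP[hh _].
  exact: hX.
move=> /le_trans; apply; rewrite big_const_seq count_predT iter_addr_0 -[leLHS]mulr_natl.
by rewrite ler_wpM2r // ler_nat.
Qed.

Fixpoint fpath (q : 'I_n) (w : seq 'I_s) (qs : seq 'I_n) : bool :=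
  match w, qs with
  | [::], [::] => true
  | a :: w', q' :: qs' => (0 < wa_M A a q q') && fpath q' w' qs'
  | _, _ => false
  end.

Lemma accpathE q w qs : accpath q w qs = fpath q w qs && (last q qs \in wa_F A).
Proof.
by elim: w q qs => [|a w IH] q [|p qs] //=; rewrite IH andbA.
Qed.

Lemma fpath_rcons q w a qs p : fpath q (rcons w a) (rcons qs p) =
  fpath q w qs && (0 < wa_M A a (last q qs) p).
Proof.
elim: w q qs => [|b w IH] q [|r qs] //=; rewrite ?andbT ?IH ?andbA //.
  by case: qs => [|? ?]; rewrite andbF.
by case: w {IH} => [|? ?]; rewrite andbF.
Qed.

Lemma rpath_fpath w h : rpath R (rword w) h ->
  exists2 qs, h = rev (map val qs) & fpath (wa_q0 A) w qs.
Proof.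
elim/last_ind: w h => [|w a IH] h; first by case: h => // _; exists [::].
rewrite /rword rev_rcons; case: h => [|q h] //= /andP[/IH[qs -> qsP] t].
have [_ _ qn] := trans_wa t.
exists (rcons qs (Ordinal qn)); first by rewrite map_rcons rev_rcons.
have hl := last_map val qs (wa_q0 A).
by move: t; rewrite head_rev hl fpath_rcons qsP /= -wt_wa wt_gt0.
Qed.

(** Reversal embeds backward accepting paths into the tuples counted by [num_acc_paths]. *)
Lemma racc_size w (hs : seq (seq nat)) : uniq hs -> all (racc R (rword w)) hs ->
  (size hs <= num_acc_paths A w)%N.
Proof.
move=> uhs hsP; rewrite /num_acc_paths cardE.
set E := enum _; pose f (t : (size w).-tuple 'I_n) : seq nat := rev (map val t).
rewrite -(size_map f); apply: uniq_leq_size => // h hhs.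
have /andP[hp hf] := allP hsP h hhs.
have [qs hE qsP] := rpath_fpath hp.
have sqs : size qs == size w.
  by rewrite -(size_map val) -size_rev -hE (rpath_size hp) size_map size_rev.
apply/mapP; exists (Tuple sqs) => //; rewrite mem_enum inE accpathE qsP /=.
have hl := last_map val qs (wa_q0 A).
by rewrite -raw_final_wa -hl -(head_rev (val (wa_q0 A))) -hE.
Qed.
End Automaton.

(** * Runs of the product graph *)

Definition well_ranged (k : nat) (R : raw_aut) : Prop :=
  forall a i j, trans R a i j -> [/\ (a < k)%N, (i < raw_size R)%N & (j < raw_size R)%N].

Lemma zip_mapl (T T' U : Type) (f : T -> T') s (t : seq U) :
  zip (map f s) t = [seq (f u.1, u.2) | u <- zip s t].
Proof. by elim: s t => [|y s IH] [|z t] //=; rewrite IH. Qed.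

Lemma mem_zip (T U : eqType) (s : seq T) (t : seq U) y z :
  (y, z) \in zip s t -> y \in s /\ z \in t.
Proof.
elim: s t => [|y' s IH] [|z' t] //=; rewrite !inE => /orP[/eqP[-> ->]|/IH[-> ->]].
  by rewrite !eqxx.
by rewrite !orbT.
Qed.

Section Runs.
Variable x : instance.
Implicit Types (p : pstate) (e : edge) (es : seq edge).

Fixpoint runs p es : bool :=
  if es is e :: es' then enabled x p e && runs (step x p e) es' else true.

Fixpoint wprod p es (j : nat) : rat :=
  if es is e :: es' then
    frac_val (nth (0, 1)%N (edge_weights x p e) j) * wprod (step x p e) es' j
  else 1.

Notation run_end p es := (foldl (step x) p es).

Lemma runs_cat p es fs : runs p (es ++ fs) = runs p es && runs (run_end p es) fs.
Proof. by elim: es p => //= e es IH p; rewrite IH andbA. Qed.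

Lemma wprod_cat p es fs j : wprod p (es ++ fs) j = wprod p es j * wprod (run_end p es) fs j.
Proof. by elim: es p => [|e es IH] p /=; rewrite ?mul1r // IH mulrA. Qed.

Lemma size_tracks_step p e : enabled x p e -> size (tracks (step x p e)) = size (tracks p).
Proof.
by case/and3P => _ /eqP sz _; rewrite size_map size_zip size_map sz minnn.
Qed.

Lemma size_tracks_run p es : runs p es -> size (tracks (run_end p es)) = size (tracks p).
Proof.
by elim: es p => //= e es IH p /andP[en /IH->]; rewrite size_tracks_step.
Qed.

Lemma size_edge_weights p e : enabled x p e -> size (edge_weights x p e) = (size (tracks p)).+1.
Proof.
by case/and3P => _ /eqP sz _; rewrite /= size_map size_zip size_map sz minnn.
Qed.

Lemma nth_mul_weights u v j : size u = size v ->
  frac_val (nth (0, 1)%N (mul_weights u v) j) =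
  frac_val (nth (0, 1)%N u j) * frac_val (nth (0, 1)%N v j).
Proof.
move=> uv; have [jv|jv] := ltnP j (size v); last first.
  by rewrite !nth_default ?uv // /mul_weights ?size_map ?size_zip ?uv ?minnn // /frac_val !mul0r.
rewrite (nth_map ((0, 1), (0, 1))%N) ?size_zip ?uv ?minnn // nth_zip //=.
by rewrite /frac_val /= !natrM invfM mulrACA.
Qed.

Lemma walkP p es : runs p es = (walk x p es).1.1 /\
  (runs p es -> [/\ (walk x p es).1.2 = run_end p es,
     size (walk x p es).2 = (size (tracks p)).+1 &
     forall j, (j <= size (tracks p))%N ->
       frac_val (nth (0, 1)%N (walk x p es).2 j) = wprod p es j]).
Proof.
rewrite /walk.
have: size (unit_weights (size (tracks p))) = (size (tracks p)).+1 by rewrite size_nseq.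
have: forall j, (j <= size (tracks p))%N ->
    frac_val (nth (0, 1)%N (unit_weights (size (tracks p))) j) = 1.
  by move=> j jp; rewrite nth_nseq ltnS jp /frac_val divr1.
move: (unit_weights _) => acc accv accs.
have foldF q a fs : (foldl (walk_step x) (false, q, a) fs).1.1 = false.
  by elim: fs q a => //= e fs IH q a; rewrite IH.
suff: runs p es = (foldl (walk_step x) (true, p, acc) es).1.1 /\
  (runs p es -> [/\ (foldl (walk_step x) (true, p, acc) es).1.2 = run_end p es,
     size (foldl (walk_step x) (true, p, acc) es).2 = (size (tracks p)).+1 &
     forall j, (j <= size (tracks p))%N ->
       frac_val (nth (0, 1)%N (foldl (walk_step x) (true, p, acc) es).2 j) =
       frac_val (nth (0, 1)%N acc j) * wprod p es j]).
  case=> e1 e2; split=> // /e2[? ? H]; split=> // j jp.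
  by rewrite H // accv // mul1r.
elim: es p acc {accv} accs => [|e es IH] p acc accs /=.
  by split=> // _; split=> // j _; rewrite mulr1.
rewrite -[walk_step x (true, p, acc) e]/(enabled x p e, step x p e, mul_weights acc (edge_weights
  x p e)).
case: (boolP (enabled x p e)) => [en|] /=; last first.
  by rewrite foldF.
have szw : size acc = size (edge_weights x p e) by rewrite size_edge_weights.
have [|e1 e2] := IH (step x p e) (mul_weights acc (edge_weights x p e)).
  by rewrite /mul_weights size_map size_zip -szw minnn accs size_tracks_step.
split=> // /e2; rewrite size_tracks_step // => -[? ? H]; split=> // j jp.
by rewrite H // nth_mul_weights // mulrA.
Qed.

Notation RA := (autA x).
Notation RB := (autB x).

(** The meaning of a product state: [h] and [hs] are the full histories on [w] of the run of [A] and
    of the listed runs of [B], and [others] holds exactly the ends of all other runs of [B]. *)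
Record tracked p (w h : seq nat) (hs : seq (seq nat)) : Prop := Tracked {
  tracked_A : stateA p = head (raw_init RA) h;
  tracked_B : tracks p = [seq (index g hs, head (raw_init RB) g) | g <- hs];
  tracked_others : forall r, r \in others p <->
    exists g, [/\ rpath RB w g, head (raw_init RB) g = r & g \notin hs];
  tracked_rpathA : rpath RA w h;
  tracked_rpathB : all (rpath RB w) hs }.

Lemma tracked_init m : tracked (init x m) [::] [::] (nseq m [::]).
Proof.
split=> //; rewrite /init /=.
- by case: m => // m; rewrite map_nseq.
- move=> r; case: eqP => [->|m0]; rewrite ?inE; split=> //.
  + by move/eqP->; exists [::].
  + by case=> -[|? ?] [] // _ <- _.
  + by case=> -[|? ?] [] // _ _; rewrite mem_nseq eqxx andbT lt0n => /negPn/eqP.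
- by rewrite all_nseq orbT.
Qed.

Definition extend (hs : seq (seq nat)) (ps : seq nat) : seq (seq nat) :=
  [seq u.2 :: u.1 | u <- zip hs ps].

Hypothesis HB : well_ranged (alphabet x) RB.

(** A label is the position of a first copy, so label and new state determine the extended history:
    comparing keys replaces comparing unbounded histories. *)
Lemma tracked_step p w h hs e : tracked p w h hs -> enabled x p e ->
  tracked (step x p e) (e.1.1 :: w) (e.1.2 :: h) (extend hs e.2).
Proof.
move=> [tA tB tO rA rB] /and3P[enA /eqP sz enB].
have szh : size e.2 = size hs by rewrite sz tB size_map.
pose key (g : seq nat) := (index (behead g) hs, head 0%N g).
have keysE : keys p e = [seq key g | g <- extend hs e.2].
  by rewrite /keys tB -map_comp zip_mapl /extend -map_comp.
have transE g q : (g, q) \in zip hs e.2 -> trans RB e.1.1 (head (raw_init RB) g) q.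
  by move=> gq; move: enB; rewrite /moves tB -map_comp zip_mapl all_map => /allP /(_ _ gq).
have key_inj g g' : behead g \in hs -> g != [::] -> g' != [::] -> key g = key g' -> g = g'.
  by case: g g' => [|q g] [|q' g'] //= gh _ _ [ii ->];
    rewrite (index_inj [::] gh _ ii) // -index_mem -ii index_mem.
have extP g : g \in extend hs e.2 -> behead g \in hs /\ g != [::].
  case/mapP => -[g0 q] /= gq ->; split=> //.
  by have [] := mem_zip gq.
split=> //=.
- rewrite keysE -map_comp; apply/eq_in_map => g gE /=.
  have [gh g0] := extP g gE; congr (_, _); last by case: g g0 {gE gh}.
  elim: (extend hs e.2) extP gE => // g1 l IH extP gE /=.
  have [h1 n1] := extP g1 (mem_head _ _).
  case: (eqVneq g1 g) => [->|ne]; first by rewrite eqxx.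
  case: eqP => [/(key_inj _ _ h1 n1 g0) e1|_]; first by rewrite e1 eqxx in ne.
  congr S; apply: IH; first by move=> u ul; apply: extP; rewrite inE ul orbT.
  by move: gE; rewrite inE eq_sym (negbTE ne).
- move=> r; rewrite mem_filter mem_iota /=; split.
    case/andP => /orP[/hasP[d dD td]|/hasP[z zT zt]] _.
      have [g [rg gd gh]] := (tO d).1 dD.
      exists (r :: g); rewrite /= rg gd td; split=> //.
      by apply/negP => /extP[/= /(negP gh)].
    move: zT zt; rewrite tB => /mapP[g gh ->] /= /andP[tg nk].
    exists (r :: g); rewrite /= (allP rB g gh) tg; split=> //.
    apply: contra nk => /(map_f key); rewrite keysE.
    by rewrite {1}/key.
  case=> -[|r' g] [] //= /andP[rg tg] er; rewrite {r'}er in tg *.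
  move=> gext; have [_ _ ->] := HB tg; rewrite andbT; apply/orP.
  have [gh|gh] := boolP (g \in hs); [right|left]; apply/hasP.
    exists (index g hs, head (raw_init RB) g); first by rewrite tB; apply: map_f.
    rewrite /= tg /= keysE; apply: contra gext => /mapP[g1 g1E] k1.
    have [h1 n1] := extP g1 g1E.
    by rewrite (key_inj (r :: g) g1 gh isT n1 k1).
  by exists (head (raw_init RB) g) => //; apply/tO; exists g.
- by rewrite rA /= -tA.
- apply/allP => g /mapP[[g0 q] /= gq ->] /=.
  by have [g0h _] := mem_zip gq; rewrite (allP rB g0 g0h) /= transE.
Qed.

Lemma nth_extend hs ps j : size ps = size hs -> (j < size hs)%N ->
  nth [::] (extend hs ps) j = nth 0%N ps j :: nth [::] hs j.
Proof.
move=> sz jh; rewrite (nth_map ([::], 0%N)) ?size_zip ?sz ?minnn //.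
by rewrite nth_zip.
Qed.

Lemma wt_edgeB p w h hs e j : tracked p w h hs -> size e.2 = size hs -> (j < size hs)%N ->
  frac_val (nth (0, 1)%N (edge_weights x p e) j.+1) =
  wt RB e.1.1 (head (raw_init RB) (nth [::] hs j)) (nth 0%N e.2 j).
Proof.
move=> [_ tB _ _ _] sz jh; rewrite /= /moves tB -map_comp.
rewrite (nth_map (0, 0)%N) ?size_zip ?size_map ?sz ?minnn //.
by rewrite nth_zip ?size_map //= (nth_map [::]).
Qed.

Record represents (m : nat) (es : seq edge) w h hs : Prop := Represents {
  repr_runs : runs (init x m) es;
  repr_size : size hs = m;
  repr_tracked : tracked (run_end (init x m) es) w h hs;
  repr_A : wprod (init x m) es 0 = rweight RA w h;
  repr_B : forall j, (j < m)%N ->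
    wprod (init x m) es j.+1 = rweight RB w (nth [::] hs j) }.

Lemma represents_nil m : represents m [::] [::] [::] (nseq m [::]).
Proof.
split; rewrite ?size_nseq //; exact: tracked_init.
Qed.

Lemma represents_rcons m es w h hs e : represents m es w h hs ->
  enabled x (run_end (init x m) es) e ->
  represents m (rcons es e) (e.1.1 :: w) (e.1.2 :: h) (extend hs e.2).
Proof.
move=> [rr rs rt rA rB] en.
have sz : size e.2 = size hs.
  by case/and3P: en => _ /eqP-> _; rewrite (tracked_B rt) size_map.
split.
- by rewrite -cats1 runs_cat rr /= en.
- by rewrite size_map size_zip sz minnn.
- by rewrite -cats1 foldl_cat; apply: tracked_step.
- by rewrite -cats1 wprod_cat /= mulr1 rA -(tracked_A rt).
move=> j jm; rewrite -cats1 wprod_cat /= mulr1 rB //.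
by rewrite (wt_edgeB rt sz) ?rs // (nth_extend sz) ?rs.
Qed.

Lemma runs_represents m es : runs (init x m) es ->
  exists w h hs, represents m es w h hs.
Proof.
elim/last_ind: es => [|es e IH].
  by exists [::], [::], (nseq m [::]); apply: represents_nil.
rewrite -cats1 runs_cat /= andbT => /andP[/IH[w [h [hs r]]] en].
by exists (e.1.1 :: w), (e.1.2 :: h), (extend hs e.2); rewrite cats1; apply: represents_rcons.
Qed.

(** Every run of [A] can be followed together with any list of runs of [B] on the same word: cutting
    off the last step of each leaves a shorter instance. *)
Lemma paths_represents w h hs : rpath RA w h -> all (rpath RB w) hs ->
  exists es, represents (size hs) es w h hs.
Proof.
elim: w h hs => [|a w IH] [|q h] hs //=.
  move=> _ hsP; exists [::].
  suff -> : hs = nseq (size hs) [::] by rewrite size_nseq; apply: represents_nil.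
  by elim: hs hsP => //= -[|? ?] hs IH //= /IH {1}->.
move=> /andP[rh th] hsP.
have [|es r] := IH h [seq behead g | g <- hs] rh.
  by rewrite all_map; apply: sub_all hsP => -[|? ?] //= /andP[].
have hsE : extend [seq behead g | g <- hs] [seq head 0%N g | g <- hs] = hs.
  by elim: hs hsP {IH r} => //= -[|? ?] hs IH //= /andP[_ /IH]; rewrite /extend /= => ->.
rewrite size_map in r; exists (rcons es (a, q, [seq head 0%N g | g <- hs])).
have := represents_rcons (e := (a, q, [seq head 0%N g | g <- hs])) r.
rewrite /= hsE; apply.
have [tA tB _ _ _] := repr_tracked r.
rewrite /enabled /= tA th tB !size_map eqxx /= /moves tB -map_comp /=.
rewrite -map_comp zip_map /= all_map.
by apply: sub_all hsP => -[|q' g] //= /andP[].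
Qed.

End Runs.

(** * Soundness of pumping *)

Notation run_end x p es := (foldl (step x) p es).

Lemma edge_weights_gt0 x p e j : enabled x p e -> (j <= size (tracks p))%N ->
  0 < frac_val (nth (0, 1)%N (edge_weights x p e) j).
Proof.
move=> en; have sz := size_edge_weights en; case/and3P: en => eA /eqP se eB.
case: j => [_|j jp]; first by rewrite -[frac_val _]/(wt _ _ _ _) wt_gt0.
have jm : (j < size (moves p e))%N by rewrite size_zip size_map se minnn.
rewrite /= (nth_map (0, 0)%N) // -[frac_val _]/(wt _ _ _ _) wt_gt0.
by have /allP := eB; apply; apply: mem_nth.
Qed.

Lemma wprod_gt0 x p es j : runs x p es -> (j <= size (tracks p))%N -> 0 < wprod x p es j.
Proof.
elim: es p => //= e es IH p /andP[en rn] jp.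
by rewrite mulr_gt0 ?edge_weights_gt0 // IH // size_tracks_step.
Qed.

Definition pumped (N : nat) (segs : seq (seq edge * seq edge)) : seq edge :=
  flatten [seq uv.1 ++ flatten (nseq N uv.2) | uv <- segs].

Lemma runs_loop x p v N : runs x p v -> run_end x p v = p ->
  [/\ runs x p (flatten (nseq N v)), run_end x p (flatten (nseq N v)) = p &
      forall j, wprod x p (flatten (nseq N v)) j = wprod x p v j ^+ N].
Proof.
move=> rv ev; elim: N => [|N [IH1 IH2 IH3]] //=; split=> [||j].
- by rewrite runs_cat rv ev IH1.
- by rewrite foldl_cat ev IH2.
- by rewrite wprod_cat ev IH3 exprS.
Qed.

(** All loops are repeated [N] times, so each weight is a geometric sequence in [N], whose ratio is
    the product of loop weights accumulated by the checker. *)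
Lemma pump_foldP x p acc segs : size acc = (size (tracks p)).+1 ->
  (foldl (pump_step x) (true, p, acc) segs).1.1 ->
  exists c r : nat -> rat,
    [/\ forall N, runs x p (pumped N segs),
        forall N, run_end x p (pumped N segs) = (foldl (pump_step x) (true, p, acc) segs).1.2,
        size (foldl (pump_step x) (true, p, acc) segs).2 = (size (tracks p)).+1 &
        forall j, (j <= size (tracks p))%N ->
        [/\ 0 < c j, 0 < r j,
          frac_val (nth (0, 1)%N (foldl (pump_step x) (true, p, acc) segs).2 j) =
            frac_val (nth (0, 1)%N acc j) * r j &
          forall N, wprod x p (pumped N segs) j = c j * r j ^+ N]].
Proof.
have pumpF q a fs : (foldl (pump_step x) (false, q, a) fs).1.1 = false.
  by elim: fs q a => //= e fs IH q a; rewrite IH.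
elim: segs p acc => [|[u v] segs IH] p acc sacc.
  by move=> _; exists (fun=> 1), (fun=> 1); split=> // j jp; split=> // [|N]; rewrite ?expr1n mulr1.
rewrite -[foldl _ _ (_ :: _)]/(foldl (pump_step x) (pump_step x (true, p, acc) (u, v)) segs).
have [ru1 ru2] := walkP x p u.
rewrite /pump_step /= -ru1; case: (boolP (runs x p u)) => [ru|]; last by rewrite /= pumpF.
have [-> _ _] := ru2 ru; set q := run_end x p u.
have sq : size (tracks q) = size (tracks p) by apply: size_tracks_run.
have [rv1 rv2] := walkP x q v.
rewrite -rv1; case: (boolP (runs x q v)) => [rv|]; last by rewrite /= pumpF.
have [-> sv wv] := rv2 rv; case: eqP => [ev|_]; last by rewrite /= pumpF.
move=> /= ok; have szw : size acc = size (walk x q v).2 by rewrite sacc sv sq.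
have [|c [r [IH1 IH2 IH3 IH4]]] := IH q (mul_weights acc (walk x q v).2) _ ok.
  by rewrite /mul_weights size_map size_zip -szw minnn sacc sq.
exists (fun j => wprod x p u j * c j), (fun j => wprod x q v j * r j).
have pE N : pumped N ((u, v) :: segs) = u ++ (flatten (nseq N v) ++ pumped N segs).
  by rewrite /pumped /= catA.
have L N := runs_loop N rv ev.
split=> [N|N||j jp].
- have [L1 L2 _] := L N.
  by rewrite pE !runs_cat ru -/q L1 L2 IH1.
- have [L1 L2 _] := L N.
  by rewrite pE !foldl_cat -/q L2 IH2.
- by rewrite IH3 sq.
have [|H1 H2 H3 H4] := IH4 j; first by rewrite sq.
have jq : (j <= size (tracks q))%N by rewrite sq.
split; rewrite ?mulr_gt0 ?wprod_gt0 //.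
  by rewrite H3 nth_mul_weights // wv // mulrA.
move=> N; have [_ L2 L3] := L N.
by rewrite pE !wprod_cat -/q L2 L3 H4 exprMn; ring.
Qed.

(** Bernoulli's inequality for [r0 / r = 1 + d]; the index is chosen so that [N * d] exceeds the
    absolute value of [c]. *)
Lemma pow_beats (c r r0 : rat) : 0 < r -> r < r0 ->
  exists N0, forall N, (N0 <= N)%N -> c * r ^+ N < r0 ^+ N.
Proof.
move=> rp rr0; have r0p : 0 < r0 := lt_trans rp rr0.
pose d := r0 / r - 1; have d0 : 0 < d by rewrite subr_gt0 ltr_pdivlMr ?mul1r.
have bern N : 1 + N%:R * d <= (r0 / r) ^+ N.
  elim: N => [|N IH]; first by rewrite mul0r addr0.
  rewrite exprS; have -> : r0 / r = 1 + d by rewrite /d; ring.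
  have : (1 + d) * (1 + N%:R * d) <= (1 + d) * (r0 / r) ^+ N.
    by rewrite ler_wpM2l // addr_ge0 // ltW.
  have -> : r0 / r = 1 + d by rewrite /d; ring.
  apply: le_trans; rewrite -natr1; have : 0 <= N%:R * d * d :> rat.
    by rewrite !mulr_ge0 // ltW.
  by move=> ?; lra.
exists (Num.bound (`|c| / d)) => N NN.
suff : c < (r0 / r) ^+ N by rewrite expr_div_n ltr_pdivlMr ?exprn_gt0.
apply: lt_le_trans (bern N).
have /archi_boundP : 0 <= `|c| / d by rewrite divr_ge0 // ltW.
rewrite ltr_pdivrMr // => cd; apply: le_lt_trans (ler_norm c) _.
apply: lt_le_trans cd _; rewrite -[leLHS]add0r lerD // ler_wpM2r ?ler_nat //; exact: ltW.
Qed.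

(** Half of [c0] pays for the first term and the other half for the rest. *)
Lemma sum_pow_beats (l : seq (rat * rat)) (c0 r0 : rat) : 0 < c0 -> 0 < r0 ->
  (forall u, u \in l -> 0 < u.2 < r0) ->
  exists N0, forall N, (N0 <= N)%N -> \sum_(u <- l) u.1 * u.2 ^+ N < c0 * r0 ^+ N.
Proof.
elim: l c0 => [|u l IH] c0 c0p r0p ul.
  by exists 0%N => N _; rewrite big_nil mulr_gt0 ?exprn_gt0.
have [||N1 P1] := IH (c0 / 2) _ r0p; first by rewrite divr_gt0.
  by move=> v vl; apply: ul; rewrite inE vl orbT.
have /andP[u0 ur] := ul u (mem_head _ _).
have [N2 P2] := pow_beats (u.1 / (c0 / 2)) u0 ur.
exists (maxn N1 N2) => N; rewrite geq_max => /andP[/P1 H1 /P2 H2]; rewrite big_cons.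
have -> : c0 * r0 ^+ N = c0 / 2 * r0 ^+ N + c0 / 2 * r0 ^+ N by field.
apply: ltrD H1; have -> : u.1 * u.2 ^+ N = c0 / 2 * (u.1 / (c0 / 2) * u.2 ^+ N).
  by field; rewrite gt_eqF.
by rewrite ltr_pM2l // divr_gt0.
Qed.

Lemma dominates_lt u j : dominates u -> 0 < frac_val (nth (0, 1)%N u 0) ->
  (j.+1 < size u)%N -> frac_val (nth (0, 1)%N u j.+1) < frac_val (nth (0, 1)%N u 0).
Proof.
case: u => [|a u] //= /allP ua a0 ju; have /ua /= := mem_nth (0, 1)%N ju.
case: (nth _ u j) => b1 b2 /=; case: a a0 {ua} => a1 a2 /=; rewrite /frac_val /= => a0 lt.
have a2p : (0 < a2)%N by rewrite lt0n; apply: contraTneq a0 => ->; rewrite invr0 mulr0 ltxx.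
have b2p : (0 < b2)%N by rewrite lt0n; apply: contraTneq lt => ->; rewrite muln0.
by rewrite ltr_pdivrMr ?ltr0n // mulrAC ltr_pdivlMr ?ltr0n // -!natrM ltr_nat.
Qed.

Section Soundness.
Variables (s : nat) (A B : wa s).
Hypotheses (A0 : wa_nonneg A) (B0 : wa_nonneg B).
Notation x := (instance_of A B).

Lemma well_ranged_B : well_ranged (alphabet x) (autB x).
Proof. by move=> a i j /trans_wa. Qed.

Lemma rpath_rword w h : rpath (autA x) w h -> exists w' : seq 'I_s, w = rword w'.
Proof.
elim: w h => [|a w IH] [|q h] //=; first by exists [::].
move=> /andP[/IH[w' ->] /trans_wa[as_ _ _]].
by exists (rcons w' (Ordinal as_)); rewrite /rword rev_rcons.
Qed.

(* Pumping multiplies the ratio between the run of [A] and the sum of the runs of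
   [B] by a factor tending to infinity, and no run of [B] is missing. *)
Lemma check_not_bigO_sound c : check_not_bigO x c -> ~ bigO A B.
Proof.
case: c => m segs /and4P[/= ok acc comp dom] [C [C0 CP]].
have [|c [r [P1 P2 P3 P4]]] := @pump_foldP x (init x m) (unit_weights m) segs _ ok.
  by rewrite /unit_weights !size_nseq.
rewrite -/(pump x m segs) in P2 P3 P4; rewrite size_nseq in P3 P4.
have rE j : (j <= m)%N -> frac_val (nth (0, 1)%N (pump x m segs).2 j) = r j.
  move=> jm; have [_ _ -> _] := P4 j jm.
  by rewrite nth_nseq ltnS jm /frac_val divr1 mul1r.
have rlt j : (j < m)%N -> r j.+1 < r 0%N.
  move=> jm; rewrite -!rE //; apply: dominates_lt => //; last by rewrite P3.
  by rewrite rE //; have [] := P4 0%N (leq0n m).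
(* The real constant [C] is rounded up to a natural number, so that the comparison takes place in
   [rat]. *)
pose l := [seq ((Num.bound C)%:R * c j.+1, r j.+1) | j <- iota 0 m].
have [c00 r00 _ _] := P4 0%N (leq0n m).
have [|N0 /(_ _ (leqnn _))] := @sum_pow_beats l (c 0%N) (r 0%N) c00 r00.
  move=> u /mapP[j]; rewrite mem_iota add0n /= => jm ->.
  by have [_ -> _ _ /=] := P4 _ jm; apply: rlt.
rewrite ltNge => /negP; apply.
have [w0 [h [hs R]]] := runs_represents well_ranged_B (P1 N0).
have [rr rs rt rA rB] := R; rewrite P2 in rt.
have [w wE] := rpath_rword (tracked_rpathA rt); rewrite {w0}wE in R rt rA rB.
have hacc : racc (autA x) (rword w) h.
  rewrite /racc (tracked_rpathA rt) /=.
  by case/andP: acc => accA _; rewrite (tracked_A rt) in accA.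
have [_ _ _ w0E] := P4 0%N (leq0n m).
rewrite -w0E rA.
have fA := rweight_le_wa_fun A0 hacc; apply: le_trans fA _.
(* A run outside [hs] ends in [others], where [comp] forbids final states. *)
have fB : wa_fun B w <= \sum_(g <- hs) rweight (autB x) (rword w) g.
  apply: wa_fun_le_sum => // g /andP[gp gf]; apply/negPn/negP => ghs.
  have /(tracked_others rt) gO : exists g', [/\ rpath (autB x) (rword w) g',
     head (raw_init (autB x)) g' = head (raw_init (autB x)) g & g' \notin hs] by exists g.
  by have := allP comp _ gO; rewrite gf.
have fAB : wa_fun A w <= (Num.bound C)%:R * wa_fun B w.
  rewrite -(ler_rat Real) rmorphM /= ratr_nat; apply: le_trans (CP w) _.
  rewrite ler_wpM2r //; last by apply/ltW/archi_boundP/ltW.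
  by rewrite ler0q wa_funE // sumr_ge0 // => g _; apply: rweight_ge0.
apply: le_trans fAB _; apply: le_trans (ler_wpM2l _ fB) _ => //.
rewrite /l big_map mulr_sumr.
rewrite (big_nth [::]) rs -[index_iota 0 m]/(iota 0 (m - 0)) subn0.
rewrite big_seq [leRHS]big_seq; apply: ler_sum => j; rewrite mem_iota add0n /= => jm.
by rewrite -rB //; have [_ _ _ ->] := P4 _ jm; rewrite mulrA.
Qed.

End Soundness.

(** * Logarithms of rational numbers *)

Notation ln := Rpower.ln.
Notation exp := Rtrigo_def.exp.

Lemma ln_mul (u v : Real) : 0 < u -> 0 < v -> ln (u * v) = ln u + ln v.
Proof. by move=> /RltP u0 /RltP v0; apply: Rpower.ln_mult. Qed.

Lemma exp_lnK (u : Real) : 0 < u -> exp (ln u) = u.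
Proof. by move=> /RltP u0; apply: Rpower.exp_ln. Qed.

Lemma ln1 : ln (1 : Real) = 0.
Proof. exact: Rpower.ln_1. Qed.

Lemma ln_inv (u : Real) : 0 < u -> ln u^-1 = - ln u.
Proof.
move=> u0; apply/eqP; rewrite -addr_eq0 -ln_mul ?invr_gt0 // mulVf ?ln1 //.
by rewrite gt_eqF.
Qed.

Lemma ln_div (u v : Real) : 0 < u -> 0 < v -> ln (u / v) = ln u - ln v.
Proof. by move=> u0 v0; rewrite ln_mul ?invr_gt0 // ln_inv. Qed.

Lemma ln_le_sub1 (u : Real) : 0 < u -> ln u <= u - 1.
Proof.
move=> u0; rewrite lerBrDl -[leRHS](exp_lnK u0).
by apply/RleP; apply: Rpower.exp_ineq1_le.
Qed.

Lemma ln_ge_1sub (u : Real) : 0 < u -> 1 - u^-1 <= ln u.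
Proof.
move=> u0; have : ln u^-1 <= u^-1 - 1 by apply: ln_le_sub1; rewrite invr_gt0.
by rewrite ln_inv //; lra.
Qed.

Lemma le_ln (u v : Real) : 0 < u -> u <= v -> ln u <= ln v.
Proof.
move=> u0; rewrite le_eqVlt => /orP[/eqP->//|uv]; apply/ltW/RltP.
by apply: Rpower.ln_increasing; apply/RltP.
Qed.

Lemma exp_gt0 (u : Real) : 0 < exp u.
Proof. by apply/RltP; apply: Exp_prop.exp_pos. Qed.

Lemma le_exp (u v : Real) : u <= v -> exp u <= exp v.
Proof.
rewrite le_eqVlt => /orP[/eqP->//|/RltP uv]; apply/ltW/RltP.
exact: Rpower.exp_increasing.
Qed.

Lemma ln_prod (l : seq nat) : all (fun p => 0 < p)%N l ->
  ln ((\prod_(p <- l) p)%N%:R : Real) = \sum_(p <- l) ln p%:R.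
Proof.
elim: l => [|p l IH] /=; first by rewrite !big_nil ln1.
move=> /andP[p0 /[dup] lp /IH e]; rewrite !big_cons natrM ln_mul ?e ?ltr0n //.
by rewrite big_seq prodn_cond_gt0 // => i /(allP lp).
Qed.

Lemma count_factors q n : (0 < n)%N -> count_mem q (factors n) = logn q n.
Proof.
move=> n0; rewrite /factors count_flatten -map_comp.
have sz p : prime p -> size [seq i <- iota 1 n | p ^ i %| n]%N = logn p n.
  move=> pp; rewrite size_filter.
  have ln : (logn p n <= n)%N by apply: ltnW; apply: ltn_logl.
  rewrite (eq_count (a2 := fun i => (i <= logn p n)%N)); last by move=> i; rewrite /= pfactor_dvdn.
  have -> : iota 1 n = iota 1 (logn p n) ++ iota (1 + logn p n) (n - logn p n).
    by rewrite -iotaD subnKC.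
  rewrite count_cat.
  rewrite (eq_in_count (a2 := xpredT)); last by move=> i; rewrite mem_iota /=; lia.
  rewrite count_predT size_iota (eq_in_count (a2 := xpred0)) ?count_pred0 ?addn0 //.
  by move=> i; rewrite mem_iota /=; lia.
have cq p : prime p -> (count_mem q \o (fun p => [seq p | i <- [seq i <- iota 1 n | p ^ i %|
  n]%N])) p
    = ((p == q) * logn p n)%N.
  move=> pp /=; rewrite count_map (eq_count (a2 := fun=> p == q)) //.
  case: eqP => _; last by rewrite count_pred0.
  by rewrite count_predT sz ?mul1n.
have -> : map (count_mem q \o (fun p => [seq p | i <- [seq i <- iota 1 n | p ^ i %| n]%N]))
    [seq p <- iota 2 n | prime p] =
    [seq ((p == q) * logn p n)%N | p <- [seq p <- iota 2 n | prime p]].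
  by apply/eq_in_map => p; rewrite mem_filter => /andP[/cq].
rewrite sumnE big_map.
case: (boolP (prime q && (q <= n)%N)) => [/andP[pq qn]|nq].
  rewrite (bigD1_seq q) /= ?filter_uniq ?iota_uniq ?eqxx ?mul1n //; last first.
    by rewrite mem_filter pq mem_iota prime_gt1 //=; lia.
  by rewrite big1 ?addn0 // => p /negbTE->.
have q0 : logn q n = 0%N.
  move: nq; rewrite negb_and => /orP[nq|]; first by rewrite lognE (negbTE nq).
  by rewrite -ltnNge => nq; rewrite lognE n0; case: ifP => // /andP[_ /dvdn_leq]; lia.
by rewrite q0 big1 // => p _; case: eqP => // ->; rewrite q0.
Qed.

Lemma factors_prime n : all prime (factors n).
Proof.
apply/allP => q /flatten_mapP[p]; rewrite mem_filter => /andP[pp _].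
by case/mapP => _ _ ->.
Qed.

Lemma factors_gt0 n : all (fun p => 0 < p)%N (factors n).
Proof. by apply: sub_all (factors_prime n) => p /prime_gt0. Qed.

Lemma factorsP (n : nat) (l : seq nat) : (0 < n)%N ->
  (forall q, count_mem q l = logn q n) -> perm_eq (factors n) l.
Proof. by move=> n0 nl; apply/allP => q _ /=; rewrite count_factors ?nl. Qed.

Lemma factorsM m n : (0 < m)%N -> (0 < n)%N ->
  perm_eq (factors (m * n)) (factors m ++ factors n).
Proof.
move=> m0 n0; apply: factorsP => [|q]; first by rewrite muln_gt0 m0.
by rewrite count_cat !count_factors // lognM.
Qed.

Lemma factors_of_prime p : prime p -> perm_eq (factors p) [:: p].
Proof.
move=> pp; apply: factorsP => [|q]; first exact: prime_gt0.
by rewrite /= addn0 logn_prime // eq_sym.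
Qed.

Lemma prod_factors n : (0 < n)%N -> (\prod_(p <- factors n) p)%N = n.
Proof.
move=> n0; have f0 := factors_gt0 n.
have p0 l : all (fun p => 0 < p)%N l -> (0 < \prod_(p <- l) p)%N.
  by move=> /allP l0; rewrite big_seq prodn_cond_gt0 // => i /l0.
apply: eqn_from_log => [||q]; rewrite ?p0 //= -[RHS]count_factors //.
elim: (factors n) (factors_prime n) => [|p l IH] /=; first by rewrite big_nil logn1.
move=> /andP[pp /[dup] lp /IH <-]; rewrite big_cons lognM ?(prime_gt0 pp) //.
  by rewrite logn_prime // eq_sym.
by apply: p0; apply: sub_all lp => u /prime_gt0.
Qed.

(** * Values of integer polynomials in the logarithms of primes *)

Definition mono_val (m : nat) : Real := \prod_(p <- factors m) ln p%:R.
Definition lp_val (P : logpoly) : Real :=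
  \sum_(m <- P.1) mono_val m - \sum_(m <- P.2) mono_val m.

Lemma mono_valM m n : (0 < m)%N -> (0 < n)%N -> mono_val (m * n) = mono_val m * mono_val n.
Proof. by move=> m0 n0; rewrite /mono_val (perm_big _ (factorsM m0 n0)) big_cat. Qed.

Lemma mono_val_prime p : prime p -> mono_val p = ln p%:R.
Proof. by move=> pp; rewrite /mono_val (perm_big _ (factors_of_prime pp)) big_seq1. Qed.

Lemma sum_mono_mul s t : all (fun m => 0 < m)%N s -> all (fun m => 0 < m)%N t ->
  \sum_(m <- mono_mul s t) mono_val m =
  (\sum_(m <- s) mono_val m) * (\sum_(m <- t) mono_val m).
Proof.
move=> /allP s0 /allP t0; rewrite /mono_mul big_flatten big_map mulr_suml.
rewrite big_seq [RHS]big_seq; apply: eq_bigr => m ms; rewrite big_map mulr_sumr.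
rewrite big_seq [RHS]big_seq; apply: eq_bigr => n nt.
by rewrite mono_valM //; [apply: s0 | apply: t0].
Qed.

Lemma lp_val0 : lp_val ([::], [::]) = 0.
Proof. by rewrite /lp_val !big_nil subrr. Qed.

Lemma lp_valD P Q : lp_val (lp_add P Q) = lp_val P + lp_val Q.
Proof. by rewrite /lp_val /= !big_cat /=; ring. Qed.

Lemma lp_valN P : lp_val (lp_opp P) = - lp_val P.
Proof. by rewrite /lp_val /= opprB. Qed.

Lemma lp_valM P Q : lp_wf P -> lp_wf Q -> lp_val (lp_mul P Q) = lp_val P * lp_val Q.
Proof.
case/andP => P1 P2 /andP[Q1 Q2]; rewrite /lp_val /= !big_cat /= !sum_mono_mul //.
by ring.
Qed.

Lemma lp_wf_add P Q : lp_wf P -> lp_wf Q -> lp_wf (lp_add P Q).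
Proof. by case/andP => P1 P2 /andP[Q1 Q2]; rewrite /lp_wf /= !all_cat P1 P2 Q1 Q2. Qed.

Lemma lp_wf_opp P : lp_wf P -> lp_wf (lp_opp P).
Proof. by rewrite /lp_wf andbC. Qed.

Lemma mono_mul_gt0 s t : all (fun m => 0 < m)%N s -> all (fun m => 0 < m)%N t ->
  all (fun m => 0 < m)%N (mono_mul s t).
Proof.
move=> /allP s0 /allP t0; apply/allP => q /flatten_mapP[m ms /mapP[n nt ->]].
by rewrite muln_gt0; apply/andP; split; [apply: s0 | apply: t0].
Qed.

Lemma lp_wf_mul P Q : lp_wf P -> lp_wf Q -> lp_wf (lp_mul P Q).
Proof.
by case/andP => P1 P2 /andP[Q1 Q2]; rewrite /lp_wf /= !all_cat !mono_mul_gt0.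
Qed.

Lemma lp_wf_log u : lp_wf (lp_log u).
Proof. by rewrite /lp_wf !factors_gt0. Qed.

Lemma sum_factors n : (0 < n)%N -> \sum_(m <- factors n) mono_val m = ln n%:R.
Proof.
move=> n0; rewrite -{2}(prod_factors n0) ln_prod ?factors_gt0 //.
rewrite big_seq [RHS]big_seq; apply: eq_bigr => p /(allP (factors_prime n)).
exact: mono_val_prime.
Qed.

Lemma lp_val_log u : (0 < u.1)%N -> (0 < u.2)%N ->
  lp_val (lp_log u) = ln (ratr (frac_val u)).
Proof.
move=> u1 u2; rewrite /lp_val /= !sum_factors // /frac_val fmorph_div /= !ratr_nat.
by rewrite ln_div ?ltr0n.
Qed.

Lemma perm_lp_val P : perm_eq P.1 P.2 -> lp_val P = 0.
Proof. by move=> PP; rewrite /lp_val (perm_big _ PP) subrr. Qed.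

(** * Rational enclosures of logarithms *)

Definition rfrac (u : nat * nat) : Real := u.1%:R / u.2%:R.

Lemma rfracD u v : (0 < u.2)%N -> (0 < v.2)%N -> rfrac (frac_add u v) = rfrac u + rfrac v.
Proof.
move=> u0 v0; rewrite /rfrac /= natrD !natrM addf_div ?pnatr_eq0 -?lt0n //.
Qed.

Lemma rfracM u v : rfrac (frac_mul u v) = rfrac u * rfrac v.
Proof. by rewrite /rfrac /= !natrM invfM mulrACA. Qed.

Lemma frac_ltE u v : (0 < u.2)%N -> (0 < v.2)%N -> frac_lt u v = (rfrac u < rfrac v).
Proof.
move=> u0 v0; rewrite /rfrac ltr_pdivrMr ?ltr0n // mulrAC ltr_pdivlMr ?ltr0n //.
by rewrite -!natrM ltr_nat.
Qed.

(** Two-sided bounds stable under sums and products; for products the lower bounds have to be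
    nonnegative. Denominators are positive for all [n], bounds are claimed for positive [n]. *)
Record approx (lo hi : nat -> nat * nat) (l : Real) : Prop := Approx {
  approx_den : forall n, (0 < (lo n).2)%N /\ (0 < (hi n).2)%N;
  approx_bounds : forall n, (0 < n)%N ->
    [/\ 0 <= rfrac (lo n), rfrac (lo n) <= l & l <= rfrac (hi n)];
  approx_cvg_lo : Rseries.Un_cv (fun n => rfrac (lo n)) l;
  approx_cvg_hi : Rseries.Un_cv (fun n => rfrac (hi n)) l }.

Lemma Un_cv_const l : Rseries.Un_cv (fun=> l) l.
Proof. by move=> e e0; exists 0%N => n _; rewrite Rfunctions.Rdist_eq. Qed.

Lemma Un_cv_ext (f g : nat -> Real) l : f =1 g -> Rseries.Un_cv f l -> Rseries.Un_cv g l.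
Proof. by move=> fg fl e /fl[N NP]; exists N => n /NP; rewrite fg. Qed.

Lemma approx_const u : (0 < u.2)%N -> approx (fun=> u) (fun=> u) (rfrac u).
Proof.
by move=> u0; split=> // [n _||]; try exact: Un_cv_const; rewrite lexx divr_ge0 ?ler0n.
Qed.

Lemma approxD lo hi l lo' hi' l' : approx lo hi l -> approx lo' hi' l' ->
  approx (fun n => frac_add (lo n) (lo' n)) (fun n => frac_add (hi n) (hi' n)) (l + l').
Proof.
move=> [d b cl ch] [d' b' cl' ch']; split=> [n|n n0||].
- by rewrite /= !muln_gt0; have [-> ->] := d n; have [-> ->] := d' n.
- have [d1 d2] := d n; have [d3 d4] := d' n; rewrite !rfracD //.
  by have [? ? ?] := b n n0; have [? ? ?] := b' n n0; rewrite addr_ge0 ?lerD.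
- apply: Un_cv_ext (SeqProp.CV_plus _ _ _ _ cl cl') => n.
  by have [d1 d2] := d n; have [d3 d4] := d' n; rewrite rfracD.
- apply: Un_cv_ext (SeqProp.CV_plus _ _ _ _ ch ch') => n.
  by have [d1 d2] := d n; have [d3 d4] := d' n; rewrite rfracD.
Qed.

Lemma approxM lo hi l lo' hi' l' : approx lo hi l -> approx lo' hi' l' ->
  approx (fun n => frac_mul (lo n) (lo' n)) (fun n => frac_mul (hi n) (hi' n)) (l * l').
Proof.
move=> [d b cl ch] [d' b' cl' ch']; split=> [n|n n0||].
- by rewrite /= !muln_gt0; have [-> ->] := d n; have [-> ->] := d' n.
- have [p1 p2 p3] := b n n0; have [q1 q2 q3] := b' n n0; rewrite !rfracM.
  split; [exact: mulr_ge0 | exact: ler_pM |].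
  by apply: ler_pM => //; [apply: le_trans p2 | apply: le_trans q2].
- by apply: Un_cv_ext (SeqProp.CV_mult _ _ _ _ cl cl') => n; rewrite rfracM.
- by apply: Un_cv_ext (SeqProp.CV_mult _ _ _ _ ch ch') => n; rewrite rfracM.
Qed.

Definition harmonic (n k : nat) : nat * nat :=
  foldr (fun i u => frac_add (1%N, i) u) (0, 1)%N (iota n k).

Lemma harmonic_den n k : (0 < n)%N -> (0 < (harmonic n k).2)%N.
Proof.
rewrite /harmonic; elim: k n => //= k IH n n0.
by rewrite muln_gt0 n0 IH.
Qed.

Lemma rfrac_harmonic n k : (0 < n)%N -> rfrac (harmonic n k.+1) = n%:R^-1 + rfrac (harmonic n.+1 k).
Proof.
move=> n0; rewrite -[harmonic n k.+1]/(frac_add (1%N, n) (harmonic n.+1 k)).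
by rewrite rfracD ?harmonic_den // /rfrac /= div1r.
Qed.

(** [harmonic n k] sums [1 / i] over [n <= i < n + k]. Term by term,
    [1 / (n + 1) <= ln ((n + 1) / n) <= 1 / n], and the difference of the two shifted sums
    telescopes to [1 / n - 1 / (n + k)]. *)
Lemma harmonic_bounds n k : (0 < n)%N ->
  [/\ 0 <= rfrac (harmonic n.+1 k),
      rfrac (harmonic n.+1 k) <= ln (n + k)%:R - ln n%:R,
      ln (n + k)%:R - ln n%:R <= rfrac (harmonic n k) &
      rfrac (harmonic n k) - rfrac (harmonic n.+1 k) <= n%:R^-1].
Proof.
move=> n0; split.
- by rewrite divr_ge0 ?ler0n.
- elim: k n n0 => [|k IH] n n0; first by rewrite addn0 subrr /rfrac mul0r.
  rewrite rfrac_harmonic // addnS -addSn; have := IH n.+1 isT.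
  have : n.+1%:R^-1 <= ln n.+1%:R - ln n%:R.
    rewrite -ln_div ?ltr0n //; apply: le_trans (ln_ge_1sub _); last by rewrite divr_gt0 ?ltr0n.
    rewrite invf_div -{2}(@divff _ n.+1%:R) ?pnatr_eq0 // -mulrBl -natrB // subSnn.
    by rewrite div1r.
  by move=> H1 H2; apply: le_trans (lerD H1 H2) _; rewrite addrC subrKA.
- elim: k n n0 => [|k IH] n n0; first by rewrite addn0 subrr /rfrac mul0r.
  rewrite rfrac_harmonic // addnS -addSn; have := IH n.+1 isT.
  have : ln n.+1%:R - ln n%:R <= n%:R^-1.
    rewrite -ln_div ?ltr0n //; apply: le_trans (ln_le_sub1 _) _; first by rewrite divr_gt0 ?ltr0n.
    have nz : n%:R != 0 :> Real by rewrite pnatr_eq0 -lt0n.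
    by have -> : n.+1%:R / n%:R - 1 = n%:R^-1 :> Real by rewrite -natr1; field.
  by move=> H1 H2; apply: le_trans _ (lerD H1 H2); rewrite [leRHS]addrC subrKA.
- suff : rfrac (harmonic n k) - rfrac (harmonic n.+1 k) = n%:R^-1 - (n + k)%:R^-1.
    by move->; rewrite lerBlDr lerDl invr_ge0 ler0n.
  elim: k n n0 => [|k IH] n n0; first by rewrite addn0 !subrr.
  by rewrite rfrac_harmonic // (rfrac_harmonic k) // addnS -addSn opprD addrACA IH //; ring.
Qed.

Lemma Un_cv_of_bound (f : nat -> Real) l :
  (forall n, (0 < n)%N -> `|f n - l| <= n%:R^-1) -> Rseries.Un_cv f l.
Proof.
move=> fl e /RltP e0; exists (Num.bound e^-1).+1 => n /ssrnat.leP nN.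
rewrite RdistE; apply/RltP; apply: le_lt_trans (fl n _) _; first by lia.
rewrite invf_plt ?posrE ?ltr0n //; last by lia.
apply: lt_le_trans (archi_boundP _) _; first by rewrite invr_ge0 ltW.
by rewrite ler_nat ltnW.
Qed.

(** The number of terms is chosen so that [n + k = p * n], which makes the enclosed difference of
    logarithms equal to [ln p]. *)
Lemma approx_log p : (0 < p)%N -> approx (log_lo^~ p) (log_hi^~ p) (ln p%:R).
Proof.
move=> p0.
have B n : (0 < n)%N -> [/\ 0 <= rfrac (log_lo n p), rfrac (log_lo n p) <= ln p%:R,
     ln p%:R <= rfrac (log_hi n p) & rfrac (log_hi n p) - rfrac (log_lo n p) <= n%:R^-1].
  move=> n0; have := harmonic_bounds (p * n - n) n0.
  by rewrite subnKC ?leq_pmull // natrM ln_mul ?ltr0n // addrK.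
split.
- move=> [|n]; last by split; apply: harmonic_den.
  by rewrite /log_lo /log_hi muln0.
- by move=> n /B[].
- by apply: Un_cv_of_bound => n /B[*]; rewrite distrC ger0_norm; lra.
- by apply: Un_cv_of_bound => n /B[*]; rewrite ger0_norm; lra.
Qed.

Lemma approx_mono m : approx (mono_lo^~ m) (mono_hi^~ m) (mono_val m).
Proof.
rewrite /mono_lo /mono_hi /mono_val.
elim: (factors m) (factors_gt0 m) => [_|p l IH /andP[/= p0 /IH lA]].
  by rewrite big_nil -[1]/(1%:R) -[X in approx _ _ X]divr1; apply: (@approx_const (1, 1)%N).
by rewrite big_cons; apply: approxM lA; apply: approx_log.
Qed.

Lemma approx_monos s : approx (monos_lo^~ s) (monos_hi^~ s) (\sum_(m <- s) mono_val m).
Proof.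
elim: s => [|m s IH].
  by rewrite big_nil -[0](mul0r 1^-1); apply: (@approx_const (0, 1)%N).
by rewrite big_cons; apply: approxD IH; apply: approx_mono.
Qed.

Lemma lp_pos_sound n P : (0 < n)%N -> lp_pos n P -> 0 < lp_val P.
Proof.
move=> n0; have [d1 b1 _ _] := approx_monos P.1; have [d2 b2 _ _] := approx_monos P.2.
rewrite /lp_pos frac_ltE; [|by case: (d2 n)|by case: (d1 n)].
by have [? ? ?] := b1 n n0; have [? ? ?] := b2 n n0 => ?; rewrite /lp_val; lra.
Qed.

Lemma lp_nonneg_sound n P : (0 < n)%N -> lp_nonneg n P -> 0 <= lp_val P.
Proof. by move=> n0 /orP[/perm_lp_val->|/lp_pos_sound/ltW->]. Qed.

(** Once both one-sided bounds are within half of [lp_val P] of their limits, they are separated. *)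
Lemma lp_pos_complete P : 0 < lp_val P ->
  exists N, forall n, (N <= n)%N -> lp_pos n P.
Proof.
move=> Pp; have [d1 _ c1 _] := approx_monos P.1; have [d2 _ _ c2] := approx_monos P.2.
have e0 : Rdefinitions.Rlt 0 (lp_val P / 2) by apply/RltP; rewrite divr_gt0.
have [N1 P1] := c1 _ e0; have [N2 P2] := c2 _ e0; exists (maxn N1 N2) => n.
rewrite geq_max => /andP[/ssrnat.leP /P1 /RltP H1 /ssrnat.leP /P2 /RltP H2].
rewrite /lp_pos frac_ltE; [|by case: (d2 n)|by case: (d1 n)].
move: H1 H2 e0; rewrite !RdistE => H1 H2 _; move: H1 H2.
by rewrite !ltr_norml => /andP[? ?] /andP[? ?]; have := erefl (lp_val P);
  rewrite {2}/lp_val => ?; lra.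
Qed.

(** * Soundness of potentials *)

Notation lnq r := (Rpower.ln (ratr r)).

Lemma lp_val_drift u ys : size u = (size ys).+1 ->
  (forall j, (j <= size ys)%N -> 0 < frac_val (nth (0, 1)%N u j)) -> all lp_wf ys ->
  lp_val (lp_drift u ys) = \sum_(j < size ys) lp_val (nth ([::], [::]) ys j) *
    (lnq (frac_val (nth (0, 1)%N u j.+1)) - lnq (frac_val (nth (0, 1)%N u 0))).
Proof.
have pos (v : nat * nat) : 0 < frac_val v -> (0 < v.1)%N /\ (0 < v.2)%N.
  case: v => a b; rewrite /frac_val /= => ab; split; rewrite lt0n; apply: contraTneq ab => ->.
    by rewrite mul0r ltxx.
  by rewrite invr0 mulr0 ltxx.
case: u => [//|a u] [su] up yw; have /= /pos[a1 a2] := up 0%N isT.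
rewrite /lp_drift /=.
have {}up j : (j < size ys)%N -> 0 < frac_val (nth (0, 1)%N u j) by move=> jy; apply: (up j.+1).
have wf l : all lp_wf [seq yb.1 | yb <- l] -> lp_wf (foldr (fun yb P => lp_add (lp_mul yb.1
   (lp_add (lp_log yb.2) (lp_opp (lp_log a)))) P) ([::], [::]) l).
  elim: l => //= -[y b] l IH /= /andP[yw' /IH ?]; apply: lp_wf_add => //.
  by apply: lp_wf_mul => //; apply: lp_wf_add; [|apply: lp_wf_opp]; apply: lp_wf_log.
elim: ys u su up yw => [|y ys IH] [|b u] //= su up; first by rewrite lp_val0 big_ord0.
move=> /andP[yw ysw]; rewrite big_ord_recl /= lp_valD lp_valM //; last first.
  by apply: lp_wf_add; [|apply: lp_wf_opp]; apply: lp_wf_log.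
have /= /pos[b1 b2] := up 0%N isT.
rewrite lp_valD lp_valN !lp_val_log //; congr (_ + _); apply: IH => //; first by case: su.
by move=> j jy; apply: (up j.+1).
Qed.

Section Bounds.
Variable x : instance.
Hypotheses (HA : well_ranged (alphabet x) (autA x)) (HB : well_ranged (alphabet x) (autB x)).

Lemma mem_edges p e : (e \in edges x p) = enabled x p e.
Proof.
rewrite mem_filter; case: (boolP (enabled x p e)) => //= en.
case: e en => -[a q] ps /and3P[/= eA /eqP se eB].
have [al _ qn] := HA eA.
apply/flatten_mapP; exists a; first by rewrite mem_iota.
apply/flatten_mapP; exists q; first by rewrite mem_iota.
apply/mapP; exists ps => //; rewrite mem_lists se eqxx /=.
apply/(all_nthP 0%N) => j jp; have jm : (j < size (moves p (a, q, ps)))%N.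
  by rewrite size_zip size_map -se minnn.
have := allP eB _ (mem_nth (0, 0)%N jm); rewrite nth_zip ?size_map //= => /HB[_ _ ->] //.
Qed.

Definition states p es : seq pstate := p :: scanl (step x) p es.

Lemma states_cons p e es : states p (e :: es) = p :: states (step x p e) es.
Proof. by []. Qed.

Lemma states_rcons p es e : states p (rcons es e) = rcons (states p es) (step x (run_end x p es) e).
Proof. by rewrite /states -cats1 scanl_cat cats1. Qed.

Lemma run_end_states p es : run_end x p es \in states p es.
Proof. by elim: es p => [|e es IH] p; rewrite ?mem_head // states_cons inE IH orbT. Qed.

(** The slack inequalities add up along the run and the potential telescopes. Only edges that stay
    in [T] are controlled, hence the condition on the visited states. *)
Lemma potential_telescope n T ys phis p es :
  (0 < n)%N -> check_potential x n T ys phis -> all lp_wf ys -> all lp_wf phis ->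
  size ys = size (tracks p) -> runs x p es -> {subset states p es <= T} ->
  0 <= lp_val (potential T phis p) - lp_val (potential T phis (run_end x p es)) +
     \sum_(j < size ys) lp_val (nth ([::], [::]) ys j) *
        (lnq (wprod x p es j.+1) - lnq (wprod x p es 0)).
Proof.
move=> n0 chk yw fw; elim: es p => [|e es IH] p sy /=.
  by move=> _ _; rewrite subrr add0r big1 // => j _; rewrite subrr mulr0.
move=> /andP[en rn] sub.
have sub' : {subset states (step x p e) es <= T}.
  by move=> q qs; apply: sub; rewrite states_cons inE qs orbT.
have := IH (step x p e) _ rn sub'; rewrite size_tracks_step // => /(_ sy).
have ep : e \in edges x p by rewrite mem_edges.
have sT : step x p e \in T by apply: sub'; rewrite mem_head.
have /allP /(_ _ ep) /implyP /(_ sT) := allP chk p (sub p (mem_head _ _)).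
move=> /(lp_nonneg_sound n0); rewrite /lp_slack !lp_valD lp_valN.
have ewp j : (j <= size ys)%N -> 0 < frac_val (nth (0, 1)%N (edge_weights x p e) j).
  by rewrite sy; apply: edge_weights_gt0.
rewrite lp_val_drift //; last by rewrite size_edge_weights // sy.
have wpp j : (j <= size ys)%N -> 0 < wprod x (step x p e) es j.
  by rewrite sy => jm; apply: wprod_gt0 => //; rewrite size_tracks_step.
have lnM r r' : 0 < r -> 0 < r' -> lnq (r * r') = lnq r + lnq r'.
  by move=> r0 r'0; rewrite rmorphM ln_mul ?ltr0q.
move=> S1 S2; apply: le_trans (addr_ge0 S1 S2) _.
set phi := potential T phis; set S := \sum_(j < _) _; set S' := \sum_(j < _) _.
have -> : \sum_(j < size ys) lp_val (nth ([::], [::]) ys j) *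
    (lnq (frac_val (nth (0, 1)%N (edge_weights x p e) j.+1) * wprod x (step x p e) es j.+1) -
     lnq (frac_val (raw_weight (autA x) e.1.1 p.1.1 e.1.2) * wprod x (step x p e) es 0)) = S + S'.
  rewrite -big_split /=; apply: eq_bigr => j _; rewrite -mulrDr; congr (_ * _).
  have e0 := ewp 0%N isT; rewrite /= in e0.
  by rewrite (lnM _ _ (ewp j.+1 (ltn_ord j)) (wpp j.+1 (ltn_ord j))) (lnM _ _ e0 (wpp 0%N isT))
    opprD addrACA.
by rewrite le_eqVlt; apply/orP; left; apply/eqP; ring.
Qed.

(** Closure under edges carries the visited set along the run, so the item at its end has seen every
    state of the run. *)
Lemma closed_run I m es : all (check_closed x I) I ->
  (init x m, [:: init x m]) \in [seq i.1 | i <- I] -> runs x (init x m) es ->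
  exists it, [/\ it \in I, it.1.1 = run_end x (init x m) es &
     {subset states (init x m) es <= it.1.2}].
Proof.
move=> cl /mapP[it0 it0I e0]; elim/last_ind: es => [|es e IH].
  by move=> _; exists it0; rewrite -e0; split=> // q; rewrite inE => /eqP->; rewrite mem_head.
rewrite -cats1 runs_cat /= andbT => /andP[/IH[it [itI itE sub]] en].
have ee : e \in edges x it.1.1 by rewrite mem_edges itE.
have /mapP[it' it'I e'] := allP (allP cl it itI) e ee.
exists it'; rewrite -e' foldl_cat /= itE; split=> // q.
rewrite cats1 states_rcons mem_rcons inE /visit => /orP[/eqP->|/sub qT].
  by case: ifP => // _; rewrite mem_head.
by case: ifP => // _; rewrite inE qT orbT.
Qed.

Definition item_bound (it : item) : Real :=
  Rtrigo_def.exp ((lp_val (potential it.1.2 it.2.2 (init x (size (tracks it.1.1)))) -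
    lp_val (potential it.1.2 it.2.2 it.1.1)) / \sum_(y <- it.2.1) lp_val y).

(* The nonnegative combination of the log-ratios is bounded, hence so is the
   smallest of them. *)
Lemma item_bound_run n it m es : (0 < n)%N -> check_item x n it -> runs x (init x m) es ->
  it.1.1 = run_end x (init x m) es -> {subset states (init x m) es <= it.1.2} ->
  exists2 j, (j < m)%N &
    ratr (wprod x (init x m) es 0) <= item_bound it * ratr (wprod x (init x m) es j.+1).
Proof.
move=> n0 /and5P[/eqP sy yw fw y0 /andP[yp pot]] rn itE sub.
have mE : size (tracks it.1.1) = m by rewrite itE size_tracks_run // size_nseq.
rewrite mE in sy; have sy' : size it.2.1 = size (tracks (init x m)) by rewrite size_nseq.
have := potential_telescope n0 pot yw fw sy' rn sub.
rewrite /item_bound mE -itE sy.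
set D := _ - _ => tel.
set Y := \sum_(y <- _) _.
have YE : Y = \sum_(j < m) lp_val (nth ([::], [::]) it.2.1 j).
  by rewrite /Y (big_nth ([::], [::])) big_mkord sy.
have Yge j : (j < m)%N -> 0 <= lp_val (nth ([::], [::]) it.2.1 j).
  by move=> jm; apply: (lp_nonneg_sound n0); apply: (allP y0); rewrite mem_nth ?sy.
have [j0 j0m yj0] : exists2 j0, (j0 < m)%N & 0 < lp_val (nth ([::], [::]) it.2.1 j0).
  by have /(has_nthP ([::], [::]))[j1 jy /(lp_pos_sound n0) yj] := yp; exists j1; rewrite -?sy.
have Yp : 0 < Y.
  rewrite YE (bigD1 (Ordinal j0m)) //= ltr_wpDr // sumr_ge0 // => i _; exact: Yge.
have wp j1 : (j1 <= m)%N -> 0 < ratr (wprod x (init x m) es j1) :> Real.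
  by move=> jm; rewrite ltr0q wprod_gt0 // size_nseq.
pose g j1 := lnq (wprod x (init x m) es 0) - lnq (wprod x (init x m) es j1.+1).
have [[j1 jm jle]|none] := pselect (exists2 j1, (j1 < m)%N & g j1 <= D / Y).
  have w0 := wp 0%N isT; have w1 := wp j1.+1 jm.
  exists j1 => //; rewrite -ler_pdivrMr // -[leLHS]exp_lnK; last exact: divr_gt0.
  by apply: le_exp; rewrite ln_div.
have gap j1 : (j1 < m)%N -> D / Y < g j1.
  by move=> jm; rewrite ltNge; apply/negP => le; apply: none; exists j1.
have : 0 < \sum_(j < m) lp_val (nth ([::], [::]) it.2.1 j) * (g j - D / Y).
  rewrite (bigD1 (Ordinal j0m)) //= ltr_wpDr //; last by rewrite mulr_gt0 // subr_gt0 gap.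
  by apply: sumr_ge0 => i _; rewrite mulr_ge0 ?Yge // subr_ge0 ltW // gap.
under eq_bigr do rewrite mulrBr.
rewrite sumrB -mulr_suml -YE mulrC divfK ?gt_eqF // => pos; exfalso.
suff : \sum_(j < m) lp_val (nth ([::], [::]) it.2.1 j) * g j <= D.
  by move: pos; rewrite subr_gt0 ltNge => /negP.
rewrite -subr_ge0 -sumrN; apply: le_trans tel _; rewrite lerD2l.
by apply: ler_sum => j _; rewrite -mulrN opprB.
Qed.
End Bounds.

Section SoundnessBigO.
Variables (s : nat) (A B : wa s).
Hypotheses (A0 : wa_nonneg A) (B0 : wa_nonneg B) (Afin : finitely_ambiguous A).
Notation x := (instance_of A B).

(** At most [K.+1] accepting runs of [B] are followed. If there were more than [K], then [K.+1]
    distinct ones would reach an accepting state with unique labels, which [check_final] excludes.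
    So all of them are followed and the state is complete. *)
Lemma check_bigO_run c w h : check_bigO x c -> racc (autA x) (rword w) h ->
  exists2 it, it \in c.2 &
    ratr (rweight (autA x) (rword w) h) <= item_bound x it * ratr (wa_fun B w).
Proof.
case: c => -[K n0] I /and3P[inits /= cl /= fin] /andP[hp hf].
have HA : well_ranged (alphabet x) (autA x) by move=> a i j /trans_wa.
have HB := @well_ranged_B _ A B.
pose l := [seq g <- lists (wa_n B) (size w) | racc (autB x) (rword w) g].
have lu : uniq l by rewrite filter_uniq ?uniq_lists.
have lP g : racc (autB x) (rword w) g -> g \in l.
  by move=> gr; rewrite mem_filter gr racc_lists.
pose hs := take K.+1 l.
have hsl : {subset hs <= l} by move=> g /mem_take.
have hsK : (size hs <= K.+1)%N by rewrite size_take; case: ltnP.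
have hsr : all (rpath (autB x) (rword w)) hs.
  by apply/allP => g /hsl; rewrite mem_filter => /andP[/andP[]].
have [es [rr rs rt rA rB]] := paths_represents HB hp hsr.
have ini : (init x (size hs), [:: init x (size hs)]) \in [seq i.1 | i <- I].
  by apply: (allP inits); rewrite mem_iota ltnS.
have [it [itI itE sub]] := closed_run HA HB cl ini rr.
have acc : accepting x it.1.1.
  rewrite /accepting itE (tracked_A rt) hf (tracked_B rt) all_map /=.
  by apply/allP => g /hsl; rewrite mem_filter => /andP[/andP[]].
have /implyP /(_ acc) /andP[amb /implyP comp] := allP fin it itI.
have szl : (size l <= K)%N.
  rewrite leqNgt; apply: contra amb => lK.
  have sK : size hs = K.+1 by rewrite size_take_min; apply/minn_idPl.
  rewrite itE (tracked_B rt) size_map sK ltnSn -map_comp /= map_inj_in_uniq ?take_uniq //.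
  by move=> g g' gh gh' /=; apply: (index_inj [::]).
have hsE : hs = l by rewrite /hs take_oversize // ltnW // ltnS.
have cmp : complete x it.1.1.
  apply/allP => r; rewrite itE => /(tracked_others rt) [g [gp gr gn]].
  apply/negP => gf; move: gn; rewrite hsE lP // /racc gp gr gf //.
have [j jm le] := item_bound_run HA HB (ltn0Sn n0) (comp cmp) rr itE sub.
exists it => //; rewrite -rA; apply: le_trans le _.
apply: ler_wpM2l; first exact/ltW/exp_gt0.
rewrite ler_rat.
rewrite rB //; apply: rweight_le_wa_fun => //.
have : nth [::] hs j \in l by apply: hsl; apply: mem_nth.
by rewrite mem_filter => /andP[].
Qed.

Lemma check_bigO_sound c : check_bigO x c -> bigO A B.
Proof.
move=> cP; have [k kP] := Afin.
pose S : Real := \sum_(it <- c.2) item_bound x it.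
have itS it : it \in c.2 -> item_bound x it <= S.
  move=> itc; rewrite /S (perm_big _ (perm_to_rem itc)) big_cons lerDl.
  by apply: sumr_ge0 => i _; apply/ltW/exp_gt0.
have S0 : 0 <= S by apply: sumr_ge0 => i _; apply/ltW/exp_gt0.
(* [S] bounds the factors of all items, [k] the number of paths of [A]; adding 1 makes the constant
   positive. *)
exists ((k * Num.bound S)%N%:R + 1); split; first by rewrite ltr_wpDl.
move=> w; have B0' : 0 <= wa_fun B w.
  by rewrite wa_funE // sumr_ge0 // => g _; apply: rweight_ge0.
apply: (@le_trans _ _ ((k * Num.bound S)%N%:R * ratr (wa_fun B w))); last first.
  by rewrite ler_wpM2r ?ler0q // lerDl.
rewrite natrM -mulrA -!(ratr_nat Real) -!rmorphM /= ler_rat.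
apply: wa_fun_le_mul => //; first by rewrite mulr_ge0.
  by move=> hs hu ha; apply: leq_trans (racc_size A0 hu ha) (kP w).
move=> h hh; have [it itc le] := check_bigO_run cP hh.
rewrite -(ler_rat Real) rmorphM /= ratr_nat; apply: le_trans le _.
rewrite ler_wpM2r ?ler0q //; apply: le_trans (itS it itc) _.
exact/ltW/archi_boundP.
Qed.

End SoundnessBigO.

(** * Schanuel's conjecture and the logarithms of primes *)

From mathcomp Require Import complex mpoly.

Section LogPrimes.
Variables (d : nat) (p : 'I_d -> nat).
Hypotheses (pp : forall i, prime (p i)) (p_inj : injective p).

Let p_gt0 i : (0 < p i)%N := prime_gt0 (pp i).

Let prod_gt0 (r : seq 'I_d) e : (0 < \prod_(i <- r) p i ^ e i)%N.
Proof. by rewrite prodn_gt0 // => i; rewrite expn_gt0 p_gt0. Qed.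

Lemma logn_prod_primes (e : 'I_d -> nat) k : logn (p k) (\prod_(i < d) p i ^ e i) = e k.
Proof.
have E (r : seq 'I_d) : logn (p k) (\prod_(i <- r) p i ^ e i)%N = (\sum_(i <- r) (k == i) * e i)%N.
  elim: r => [|i r IH]; first by rewrite !big_nil logn1.
  by rewrite !big_cons lognM ?expn_gt0 ?p_gt0 // IH lognX logn_prime // (inj_eq p_inj) mulnC.
rewrite E (bigD1 k) //= eqxx mul1n big1 ?addn0 // => i.
by rewrite eq_sym => /negbTE->.
Qed.

Lemma ln_prod_primes (e : 'I_d -> nat) :
  ln (\prod_(i < d) p i ^ e i)%N%:R = \sum_(i < d) (e i)%:R * ln (p i)%:R.
Proof.
have E (r : seq 'I_d) : ln (\prod_(i <- r) p i ^ e i)%N%:R = \sum_(i <- r) (e i)%:R * ln (p i)%:R.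
  elim: r => [|i r IH]; first by rewrite !big_nil ln1.
  rewrite !big_cons natrM ln_mul ?ltr0n ?expn_gt0 ?p_gt0 // IH; congr (_ + _);
    elim: (e i) => [|n IHn]; first by rewrite expn0 ln1 mul0r.
  by rewrite expnS natrM ln_mul ?ltr0n ?expn_gt0 ?p_gt0 // IHn -natr1; ring.
exact: E.
Qed.

Lemma ln_nat_inj (m n : nat) : (0 < m)%N -> (0 < n)%N -> ln m%:R = ln n%:R -> m = n.
Proof.
move=> m0 n0 e; apply/eqP; rewrite -(eqr_nat Real).
by rewrite -(exp_lnK (u := m%:R)) ?ltr0n // e exp_lnK ?ltr0n.
Qed.

(** Unique factorisation: the positive and the negative coefficients give two products of prime
    powers with the same logarithm, hence the same exponents, and their supports are disjoint. *)
Lemma ln_primes_int (a : 'I_d -> int) :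
  \sum_(i < d) (a i)%:~R * ln (p i)%:R = 0 -> forall i, a i = 0.
Proof.
move=> sa; pose pos i := if (0 <= a i) then `|a i|%N else 0%N.
pose neg i := if (0 <= a i) then 0%N else `|a i|%N.
have aE i : (a i)%:~R = (pos i)%:R - (neg i)%:R :> Real.
  rewrite /pos /neg; case: leP => a0; first by rewrite subr0 -{1}(gez0_abs a0).
  by rewrite sub0r -{1}[a i]opprK -(ltz0_abs a0) mulrNz.
have pn : (\prod_(i < d) p i ^ pos i)%N = (\prod_(i < d) p i ^ neg i)%N.
  apply: ln_nat_inj => //; rewrite !ln_prod_primes; apply/eqP; rewrite -subr_eq0 -sumrB.
  by rewrite -[X in _ == X]sa; apply/eqP; apply: eq_bigr => i _; rewrite aE mulrBl.
move=> i; have := logn_prod_primes pos i; rewrite pn logn_prod_primes.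
by rewrite /pos /neg; case: ifP => _ /eqP; rewrite ?[_ == absz _]eq_sym absz_eq0 => /eqP.
Qed.

Lemma ln_primes_rat (c : 'I_d -> rat) :
  \sum_(i < d) ratr (c i) * ln (p i)%:R = 0 -> forall i, c i = 0.
Proof.
move=> sc; pose a i := numq (c i) * \prod_(j < d | j != i) denq (c j).
have aE i : (a i)%:~R = (\prod_(j < d) denq (c j))%:~R * ratr (c i) :> Real.
  have -> : ratr (c i) = (numq (c i))%:~R / (denq (c i))%:~R :> Real.
    by rewrite -{1}[c i]divq_num_den fmorph_div /= !ratr_int.
  rewrite (bigD1 i) //= /a !intrM; field.
  by rewrite intr_eq0 denq_neq0.
have /ln_primes_int a0 : \sum_(i < d) (a i)%:~R * ln (p i)%:R = 0.
  under eq_bigr do rewrite aE -mulrA.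
  by rewrite -mulr_sumr sc mulr0.
move=> i; have /eqP := a0 i; rewrite mulf_eq0 numq_eq0 => /orP[/eqP//|].
by rewrite prodf_seq_eq0 => /hasP[j _ /andP[_]]; rewrite (negbTE (denq_neq0 _)).
Qed.

Definition log_vec (i : 'I_d) : Cplx := (ln (p i)%:R)%:C%C.

Lemma log_vec_lin_indep : Q_lin_indep log_vec.
Proof.
move=> c; under eq_bigr do rewrite /log_vec -(fmorph_rat (@real_complex Real)) -rmorphM.
rewrite -rmorph_sum /= => /(congr1 (@complex.Re Real)) /=.
exact: ln_primes_rat.
Qed.

Lemma cexp_log_vec i : cexp (log_vec i) = (p i)%:R.
Proof.
rewrite /cexp /log_vec /= Rtrigo_def.cos_0 Rtrigo_def.sin_0 exp_lnK ?ltr0n ?p_gt0 //.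
by rewrite mulr1 mulr0 -[RHS](rmorph_nat (@real_complex Real)).
Qed.

(** The conjecture selects [d] algebraically independent numbers among the [d] logarithms and their
    exponentials. The exponentials are the primes, which are rational, so only logarithms are
    selected; as the selection is injective, it is all of them. *)
Lemma schanuel_log_vec : Schanuel_conjecture ->
  exists g : 'I_d -> 'I_d, injective g /\ Q_alg_indep (fun i => log_vec (g i)).
Proof.
move=> /(_ d log_vec log_vec_lin_indep)[f [f_inj fP]].
have left_f i : exists k, f i = lshift d k.
  case: (split_ordP (f i)) => k fE; first by exists k.
  (* A selected exponential [p k] would be a root of the nonzero polynomial ['X_i - p k]. *)
  have := fP ('X_i - (p k)%:R%:MP); rewrite rmorphB /= map_mpolyX map_mpolyC /=.
  rewrite rmorphB /= mevalXU mevalC {1}fE /schanuel_gens.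
  have -> : split (rshift d k) = inr k by exact: (unsplitK (inr k)).
  rewrite cexp_log_vec rmorph_nat subrr => /(_ erefl) /(congr1 (mcoeff U_(i))).
  rewrite mcoeffB mcoeffX eqxx mcoeffC mcoeff0.
  by rewrite (_ : (U_(i) == 0)%MM = false) ?mulr0 ?subr0 // mnm1_eq0.
have [g gP] := choice left_f; exists g; split.
  by move=> i j gij; apply: f_inj; rewrite !gP gij.
suff <- : (fun i => schanuel_gens log_vec (f i)) = (fun i => log_vec (g i)) by [].
by apply/funext => i; rewrite gP /schanuel_gens (unsplitK (inl (g i))).
Qed.

End LogPrimes.

Lemma prod_count (T : eqType) (F : T -> Real) (l s : seq T) :
  uniq s -> {subset l <= s} -> \prod_(u <- l) F u = \prod_(v <- s) F v ^+ count_mem v l.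
Proof.
move=> us; elim: l => [|u l IH] sub.
  by rewrite big_nil big1_seq // => v _; rewrite expr0.
rewrite big_cons IH => [|v vl]; last by apply: sub; rewrite inE vl orbT.
have us' : u \in s by apply: sub; rewrite mem_head.
rewrite (bigD1_seq u us' us) [RHS](bigD1_seq u us' us) /= eqxx mulrA exprS; congr (_ * _).
by apply: eq_bigr => v; rewrite eq_sym => /negbTE->.
Qed.

(* Under Schanuel's conjecture the logarithms of the primes are algebraically
   independent, so vanishing can be tested on the coefficients. *)
Lemma lp_val_eq0 (P : logpoly) : Schanuel_conjecture -> lp_wf P ->
  lp_val P = 0 -> perm_eq P.1 P.2.
Proof.
move=> schanuel /andP[/allP P1 /allP P2] P0.
pose s := undup (flatten [seq factors m | m <- P.1 ++ P.2]).
have sub m : m \in P.1 ++ P.2 -> {subset factors m <= s}.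
  by move=> mP q qm; rewrite mem_undup; apply/flatten_mapP; exists m.
have sp : all prime s.
  apply/allP => q; rewrite mem_undup => /flatten_mapP[m _].
  by apply/allP/factors_prime.
have us : uniq s by apply: undup_uniq.
pose p (i : 'I_(size s)) := nth 0%N s i.
have pp i : prime (p i) by apply: (allP sp); apply: mem_nth.
have p_inj : injective p by move=> i j /eqP; rewrite nth_uniq // => /eqP/val_inj.
have [g [g_inj gP]] := schanuel_log_vec pp p_inj schanuel.
(* Independence is known for the logarithms in the order given by [g], so exponents are listed in
   that order. *)
pose mon m : 'X_{1..size s} := [multinom count_mem (p (g i)) (factors m) | i < size s].
pose Q (l : seq nat) : {mpoly rat[size s]} := \sum_(m <- l) 'X_[mon m].
pose ev (q : {mpoly rat[size s]}) : Cplx :=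
  (map_mpoly (ratr : rat -> Cplx) q).@[fun i => log_vec p (g i)].
have evB q r : ev (q - r) = ev q - ev r by rewrite /ev rmorphB /= rmorphB.
have QE l : {subset l <= P.1 ++ P.2} -> ev (Q l) =
  (\sum_(m <- l) mono_val m)%:C%C.
  move=> lP; rewrite /Q /ev (rmorph_sum (map_mpoly (ratr : rat -> Cplx))) (rmorph_sum (meval _)).
  rewrite (rmorph_sum (@real_complex Real)) big_seq [RHS]big_seq; apply: eq_bigr => m /lP mP.
  rewrite /= map_mpolyX mevalX /mono_val (prod_count _ us (sub m mP)) (big_nth 0%N) big_mkord.
  rewrite rmorph_prod /= [RHS](reindex_inj g_inj) /=; apply: eq_bigr => i _.
  by rewrite mnmE rmorphXn.
have Q0 : Q P.1 - Q P.2 = 0.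
  apply: gP; rewrite -/(ev _) evB !QE; [|by move=> m mP; rewrite mem_cat mP ?orbT ..].
  suff -> : \sum_(m <- P.1) mono_val m = \sum_(m <- P.2) mono_val m by rewrite subrr.
  by apply/eqP; rewrite -subr_eq0 -/(lp_val P) P0.
(* Distinct integers give distinct monomials by unique factorisation, so coefficients of [Q l] are
   multiplicities in [l]. *)
have mon_inj m m' : m \in P.1 ++ P.2 -> m' \in P.1 ++ P.2 -> mon m = mon m' -> m = m'.
  move=> mP mP' e.
  have m0 u : u \in P.1 ++ P.2 -> (0 < u)%N by rewrite mem_cat => /orP[/P1|/P2].
  apply: eqn_from_log => [||q]; rewrite ?m0 //= -!count_factors ?m0 //.
  case: (boolP (q \in s)) => [qs|qs]; last first.
    rewrite !(count_memPn _) //; last by apply: contra qs => /(sub m mP).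
    by apply: contra qs => /(sub m' mP').
  have qi : (index q s < size s)%N by rewrite index_mem.
  have [g' g'K gK] := injF_bij g_inj.
  have /mnmP /(_ (g' (Ordinal qi))) := e.
  by rewrite !mnmE gK /p /= nth_index.
have cQ l m : {subset l <= P.1 ++ P.2} -> m \in P.1 ++ P.2 ->
    (Q l)@_(mon m) = (count_mem m l)%:R.
  elim: l => [|u l IH] lP mP; first by rewrite /Q big_nil mcoeff0.
  rewrite /Q big_cons mcoeffD mcoeffX -/(Q l) IH //=; last first.
    by move=> v vl; apply: lP; rewrite inE vl orbT.
  rewrite natrD; congr (_%:R + _); case: (eqVneq u m) => [->|um]; first by rewrite eqxx.
  apply/eqP; rewrite eqb0; apply: contra um => /eqP /mon_inj.
  by move=> ->; rewrite ?mem_head // lP // mem_head.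
apply/allP => m mP /=; rewrite -(eqr_nat rat) -!cQ //; last 2 first.
- by move=> u uP; rewrite mem_cat uP orbT.
- by move=> u uP; rewrite mem_cat uP.
by rewrite -subr_eq0 -mcoeffB Q0 mcoeff0.
Qed.

(** * Gordan's alternative *)

Lemma exists_argmax (T : eqType) (f : T -> Real) (s : seq T) : s != [::] ->
  exists2 t, t \in s & forall u, u \in s -> f u <= f t.
Proof.
elim: s => // t s IH _; case: (eqVneq s [::]) => [->|/IH[t' t's t'm]].
  by exists t; rewrite ?mem_head // => u; rewrite inE => /eqP->.
case: (leP (f t) (f t')) => tt.
  by exists t'; rewrite ?inE ?t's ?orbT // => u; rewrite inE => /orP[/eqP->|/t'm].
exists t; rewrite ?mem_head // => u; rewrite inE => /orP[/eqP->//|/t'm ut].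
exact: le_trans ut (ltW tt).
Qed.

(** A rational number lies in the gap between the bounds; 0 joins the lower bounds so that it is a
    quotient of natural numbers. *)
Lemma separating_fraction (ls us : seq Real) :
  (forall l u, l \in ls -> u \in us -> l < u) -> (forall u, u \in us -> 0 < u) ->
  exists a b : nat, [/\ (0 < b)%N, forall l, l \in ls -> l < a%:R / b%:R &
    forall u, u \in us -> a%:R / b%:R < u].
Proof.
move=> lu u0; have [M Ml Mmax] := @exists_argmax _ id (0 :: ls) isT.
have M0 : 0 <= M by apply: Mmax; rewrite mem_head.
have Mu u : u \in us -> M < u.
  by move=> uus; move: Ml; rewrite inE => /orP[/eqP->|/lu]; [exact: u0 | apply].
have [m' M'm m'u] : exists2 m', M < m' & forall u, u \in us -> m' <= u.
  case: (eqVneq us [::]) => [->|/(exists_argmax (-%R))[m' mus mmin]].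
    by exists (M + 1) => //; rewrite ltrDl.
  by exists m'; [exact: Mu | move=> u /mmin; rewrite lerN2].
have [q] := reals.rat_in_itvoo M'm; rewrite inE /= => /andP[Mq qm].
have q0 : 0 < q by rewrite -(ltr0q Real); apply: le_lt_trans Mq.
exists `|numq q|%N, `|denq q|%N.
have -> : `|numq q|%N%:R / `|denq q|%N%:R = ratr q :> Real.
  have n0 : 0 <= numq q by rewrite numq_ge0 ltW.
  have d0 : 0 <= denq q by apply: denq_ge0.
  by rewrite -[in RHS](divq_num_den q) fmorph_div /= !ratr_int -{2}(gez0_abs n0) -{2}(gez0_abs d0).
split=> [|l ll|u uus]; first by rewrite absz_gt0 denq_neq0.
  by apply: le_lt_trans Mq; apply: Mmax; rewrite inE ll orbT.
exact: lt_le_trans qm (m'u u uus).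
Qed.

Section Gordan.
Variables (D : Real -> Prop) (m : nat).
Hypotheses (D0 : D 0) (D1 : D 1) (DB : forall a b, D a -> D b -> D (a - b))
  (DM : forall a b, D a -> D b -> D (a * b)).

Definition dot (g u : 'I_m -> Real) : Real := \sum_(j < m) g j * u j.

Lemma dotDr a b g u u' : dot g (fun j => a * u j + b * u' j) = a * dot g u + b * dot g u'.
Proof.
by rewrite /dot !mulr_sumr -big_split; apply: eq_bigr => j _ /=; ring.
Qed.

Lemma dotBl a b g g' u : dot (fun j => a * g j - b * g' j) u = a * dot g u - b * dot g' u.
Proof.
by rewrite /dot !mulr_sumr -sumrB; apply: eq_bigr => j _ /=; ring.
Qed.

Lemma D_dot g u : (forall j, D (g j)) -> (forall j, D (u j)) -> D (dot g u).
Proof.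
move=> gD uD; rewrite /dot; apply: big_ind => // [a b Da Db|j _]; last exact: DM.
by rewrite -[b]opprK -[- b]sub0r; apply: DB => //; apply: DB.
Qed.

(* The generators of the dual cone are produced by the double description method,
   which only uses ring operations on the data. *)
Lemma dual_generators (T : eqType) (v : T -> 'I_m -> Real) (cs : seq T) : uniq cs ->
  (forall c j, c \in cs -> D (v c j)) ->
  exists G : seq {ffun 'I_m -> Real},
    (forall g, g \in G -> [/\ forall j, D (g j) /\ 0 <= g j, exists j, 0 < g j &
       forall c, c \in cs -> dot g (v c) <= 0]) /\
    (forall u : 'I_m -> Real, (forall g, g \in G -> 0 < dot g u) ->
       exists (N : nat) (n : T -> nat), (0 < N)%N /\
         forall j, 0 < N%:R * u j + \sum_(c <- cs) (n c)%:R * v c j).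
Proof.
elim: cs => [_ _|c0 cs IH /= /andP[c0cs ucs] Dv].
  (* Without constraints the dual cone is the nonnegative orthant, generated by the unit vectors. *)
  exists [seq [ffun j => (i == j)%:R] | i <- enum 'I_m]; split.
    move=> g /mapP[i _ ->]; split=> // [j|].
      by rewrite ffunE ler0n; split=> //; case: (i == j).
    by exists i; rewrite ffunE eqxx.
  move=> u uG; exists 1%N, (fun=> 0%N); split=> // j; rewrite big_nil addr0 mul1r.
  have := uG [ffun k => (j == k)%:R] (map_f _ _); rewrite mem_enum => /(_ isT).
  rewrite /dot (bigD1 j) //= ffunE eqxx mul1r big1 ?addr0 // => k kj.
  by rewrite ffunE eq_sym (negbTE kj) mul0r.
have [|G [G1 G2]] := IH ucs; first by move=> c j cc; apply: Dv; rewrite inE cc orbT.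
pose x := v c0; have Dx j : D (x j) by apply: Dv; rewrite mem_head.
(* For [g] positive and [h] negative on [x], this is the positive combination of both that vanishes
   on [x]. *)
pose comb (g h : {ffun 'I_m -> Real}) : {ffun 'I_m -> Real} :=
  [ffun j => dot g x * h j - dot h x * g j].
have dot_comb g h u : dot (comb g h) u = dot g x * dot h u - dot h x * dot g u.
  by rewrite -dotBl /dot; apply: eq_bigr => j _; rewrite ffunE.
pose Gp := [seq g : {ffun 'I_m -> Real} <- G | 0 < dot g x];
  pose Gn := [seq g : {ffun 'I_m -> Real} <- G | dot g x < 0].
exists ([seq g : {ffun 'I_m -> Real} <- G | dot g x <= 0] ++ [seq comb g h | g : {ffun 'I_m ->
  Real} <- Gp, h : {ffun 'I_m -> Real} <- Gn]); split.
  move=> g; rewrite mem_cat => /orP[|/allpairsP[[g1 h1] /= []]].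
    rewrite mem_filter => /andP[gx /G1[g2 g3 g4]]; split=> // c.
    by rewrite inE => /orP[/eqP->//|/g4].
  rewrite !mem_filter => /andP[gx gG] /andP[hx hG] ->.
  have [g2 g3 g4] := G1 _ gG; have [h2 [j hj] h4] := G1 _ hG; split=> [k||c].
  - rewrite ffunE; have [Dg gk] := g2 k; have [Dh hk] := h2 k; split.
      by apply: DB; apply: DM => //; apply: D_dot => // i; [case: (g2 i) | case: (h2 i)].
    by rewrite subr_ge0 (@le_trans _ _ 0) // ?mulr_ge0 // ?(ltW gx) // mulr_le0_ge0 // ltW.
  - exists j; rewrite ffunE subr_gt0 (@le_lt_trans _ _ 0) ?mulr_gt0 //.
    by rewrite mulr_le0_ge0 // ?(ltW hx) //; case: (g2 j).
  - rewrite dot_comb inE => /orP[/eqP->|cc]; first by rewrite mulrC subrr.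
    have := g4 c cc; have := h4 c cc => hc gc.
    by rewrite subr_le0 (@le_trans _ _ 0) // ?mulr_ge0_le0 ?(ltW gx) // mulr_le0 // ltW.
move=> u uG.
have uGp g h : g \in Gp -> h \in Gn -> 0 < dot g x * dot h u - dot h x * dot g u.
  move=> gp hn; rewrite -dot_comb; apply: uG; rewrite mem_cat; apply/orP; right.
  exact: (allpairs_f comb).
have uGn g : g \in G -> dot g x <= 0 -> 0 < dot g u.
  by move=> gG gx; apply: uG; rewrite mem_cat mem_filter gx gG.
(* The vector [b * u + a * x] has to be positive on the old generators. Those negative on [x] bound
   [a / b] from above, those positive on [x] from below; positivity of [u] on the combinations makes
   the bounds compatible. *)
have [|l /mapP[h + ->]|a [b [b0 la au]]] := @separating_fraction
   [seq - dot g u / dot g x | g : {ffun 'I_m -> Real} <- Gp] [seq dot h u / - dot h x | h : {ffun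
     'I_m -> Real} <- Gn].
- move=> _ _ /mapP[g gp ->] /mapP[h hn ->]; have := uGp g h gp hn.
  move: gp hn; rewrite !mem_filter => /andP[gx _] /andP[hx _] gh.
  rewrite ltr_pdivrMr // mulrAC ltr_pdivlMr ?oppr_gt0 //; lra.
- rewrite mem_filter => /andP[hx hG].
  by rewrite divr_gt0 ?oppr_gt0 // uGn // ltW.
have b0' : 0 < b%:R :> Real by rewrite ltr0n.
have [|N [n [N0 nP]]] := G2 (fun j => b%:R * u j + a%:R * x j).
  move=> g gG; rewrite dotDr; case: (ltrgtP (dot g x) 0) => gx.
  - have /au : dot g u / - dot g x \in [seq dot h u / - dot h x | h : {ffun 'I_m -> Real} <- Gn].
      by apply: (map_f (fun h : {ffun 'I_m -> Real} => dot h u / - dot h x)); rewrite mem_filter gx.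
    by rewrite ltr_pdivrMr // mulrAC ltr_pdivlMr ?oppr_gt0 //; lra.
  - have /la : - dot g u / dot g x \in [seq - dot g u / dot g x | g : {ffun 'I_m -> Real} <- Gp].
      by apply: (map_f (fun g : {ffun 'I_m -> Real} => - dot g u / dot g x)); rewrite mem_filter gx.
    by rewrite ltr_pdivrMr // mulrAC ltr_pdivlMr //; lra.
  - by rewrite gx mulr0 addr0 mulr_gt0 // uGn // gx.
exists (N * b)%N, (fun c => if c == c0 then (N * a)%N else n c); split.
  by rewrite muln_gt0 N0.
move=> j; rewrite big_cons eqxx; have := nP j.
rewrite !natrM mulrDr !mulrA -addrA.
rewrite [X in _ -> _ < _ + (_ + X)](eq_big_seq (fun c => (n c)%:R * v c j)) // => c cc.
by case: eqP => // e; rewrite e (negbTE c0cs) in cc.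
Qed.

(** Any generator of the dual cone is a vector of multipliers. If there is none, the vector 0 meets
    the empty list of conditions and yields the positive combination. *)
Lemma gordan (T : eqType) (v : T -> 'I_m -> Real) (cs : seq T) : uniq cs ->
  (forall c j, c \in cs -> D (v c j)) ->
  (exists g : 'I_m -> Real, [/\ forall j, D (g j) /\ 0 <= g j, exists j, 0 < g j &
     forall c, c \in cs -> dot g (v c) <= 0]) \/
  (exists n : T -> nat, forall j, 0 < \sum_(c <- cs) (n c)%:R * v c j).
Proof.
move=> ucs /(dual_generators ucs)[[|g G] [G1 G2]]; last first.
  by left; exists g; apply: G1; rewrite mem_head.
by right; have [//|N [n [_ nP]]] := G2 (fun=> 0); exists n => j; have := nP j; rewrite mulr0 add0r.
Qed.
End Gordan.

(** * Existence of certificates *)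

Section Listable.
Local Open Scope nat_scope.

Definition listable (T : eqType) (P : T -> Prop) : Prop :=
  exists l : seq T, forall y, P y -> y \in l.

Lemma listable_bounded_seq (T : eqType) (l : seq T) k :
  listable (fun s => size s <= k /\ {subset s <= l}).
Proof.
elim: k => [|k [L LP]].
  by exists [:: [::]] => s []; rewrite leqn0 => /nilP->; rewrite mem_head.
exists ([::] :: [seq y :: t | y <- l, t <- L]) => -[|y s] [/= sk sl] //.
rewrite inE; apply/orP; right; apply: (allpairs_f cons); first by apply: sl; rewrite mem_head.
by apply: LP; split=> // z zs; apply: sl; rewrite inE zs orbT.
Qed.

Lemma listable_exact (T : eqType) (P : T -> Prop) : listable P ->
  exists l : seq T, forall y, y \in l <-> P y.
Proof.
case=> l lP; exists [seq y <- l | `[< P y >]] => y; rewrite mem_filter; split.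
  by case/andP => /asboolP.
by move=> Py; rewrite lP // andbT; apply/asboolP.
Qed.

End Listable.

Section Reach.
Local Open Scope nat_scope.
Variable x : instance.
Hypotheses (HA : well_ranged (alphabet x) (autA x)) (HB : well_ranged (alphabet x) (autB x)).
Hypotheses (iA : raw_init (autA x) < raw_size (autA x))
  (iB : raw_init (autB x) < raw_size (autB x)).
Variable K : nat.

Definition visit_step (pt : pstate * seq pstate) (e : edge) :=
  (step x pt.1 e, visit pt.2 (step x pt.1 e)).
Definition visit_run m es := foldl visit_step (init x m, [:: init x m]) es.

Lemma visit_run_rcons m es e : visit_run m (rcons es e) = visit_step (visit_run m es) e.
Proof. by rewrite /visit_run foldl_rcons. Qed.

Lemma visit_run_end m es : (visit_run m es).1 = run_end x (init x m) es.
Proof.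
elim/last_ind: es => // es e IH.
by rewrite visit_run_rcons /= IH -cats1 foldl_cat.
Qed.

Lemma mem_visit T p q : (q \in visit T p) = (q == p) || (q \in T).
Proof. by rewrite /visit; case: ifP => [pT|_]; rewrite ?inE //; case: eqP => [->|]. Qed.

Lemma runs_rcons p es e : runs x p (rcons es e) = runs x p es && enabled x (run_end x p es) e.
Proof. by rewrite -cats1 runs_cat /= andbT. Qed.

Lemma visit_run_props m es : runs x (init x m) es ->
  [/\ uniq (visit_run m es).2, (visit_run m es).1 \in (visit_run m es).2 &
      forall t, t \in (visit_run m es).2 ->
        exists2 fs, runs x (init x m) fs & t = run_end x (init x m) fs].
Proof.
elim/last_ind: es => [|es e IH].
  by move=> _; split=> //= [|t]; rewrite inE // => /eqP->; exists [::].
rewrite runs_rcons => /andP[res en]; have [u _ T] := IH res.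
rewrite visit_run_rcons /=; split=> [||t]; rewrite ?mem_visit ?eqxx //.
  by rewrite /visit; case: ifP => //= ->.
case/orP => [/eqP->|/T//]; exists (rcons es e); first by rewrite runs_rcons res.
by rewrite visit_run_end -cats1 foldl_cat.
Qed.

(** Labels are positions in the list of tracks and [others] has at most as many entries as [B] has
    states, so product states are bounded. *)
Lemma state_listable : listable (fun p => exists m es,
  [/\ m <= K.+1, runs x (init x m) es & p = run_end x (init x m) es]).
Proof.
pose nA := raw_size (autA x); pose nB := raw_size (autB x).
have [LT LTP] := listable_bounded_seq [seq (i, r) | i <- iota 0 K.+2, r <- iota 0 nB] K.+1.
have [LO LOP] := listable_bounded_seq (iota 0 nB) nB.
exists [seq (q, u) | q <- [seq (q, t) | q <- iota 0 nA, t <- LT], u <- LO].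
move=> p [m [es [mK]]]; elim/last_ind: es p => [|es e _] p.
  move=> _ -> /=; apply: (allpairs_f pair).
    apply: (allpairs_f pair); first by rewrite mem_iota.
    apply: LTP; rewrite size_nseq; split=> // z; rewrite mem_nseq => /andP[_ /eqP->].
    by apply: (allpairs_f pair); rewrite mem_iota.
  apply: LOP; case: (m == 0) => //=; split; first by apply: leq_ltn_trans iB.
  by move=> r; rewrite inE => /eqP->; rewrite mem_iota.
rewrite runs_rcons -cats1 foldl_cat /= => /andP[/size_tracks_run + en] ->.
set p0 := run_end _ _ _ in en *; rewrite size_nseq => sp0.
have /and3P[enA /eqP sz enB] := en; have sk : size (keys p0 e) = m.
  by rewrite size_zip size_map sz sp0 minnn.
apply: (allpairs_f pair); last first.
  apply: LOP; split; first by rewrite size_filter -[X in _ <= X](size_iota 0) count_size.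
  by move=> r; rewrite mem_filter => /andP[].
apply: (allpairs_f pair); first by have [_ _ ?] := HA enA; rewrite mem_iota.
apply: LTP; rewrite size_map sk; split=> // z /mapP[[l r] lr ->].
have [_ re] := mem_zip lr.
apply: (allpairs_f pair); rewrite mem_iota /=.
  by rewrite add0n ltnS (leq_trans (index_size _ _)) ?sk // ltnW.
have jr : index r e.2 < size e.2 by rewrite index_mem.
have jm : index r e.2 < size (moves p0 e) by rewrite size_zip size_map sz minnn -sz.
have := allP enB _ (mem_nth (0, 0) jm); rewrite nth_zip ?size_map //= nth_index //.
by case/HB.
Qed.

Definition reach (pt : pstate * seq pstate) : Prop :=
  exists m es, [/\ m <= K.+1, runs x (init x m) es & pt = visit_run m es].

(** Visited lists are duplicate-free, so their length is at most the number of possible states. *)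
Lemma reach_listable : exists L : seq (pstate * seq pstate), forall pt, pt \in L <-> reach pt.
Proof.
apply: listable_exact; have [U UP] := state_listable.
have [LT LTP] := listable_bounded_seq U (size U).
exists [seq (p, T) | p <- U, T <- LT] => pt [m [es [mK res ->]]].
have [uT pT TP] := visit_run_props res.
have sub : {subset (visit_run m es).2 <= U}.
  by move=> t /TP[fs rfs ->]; apply: UP; exists m, fs.
rewrite [visit_run m es]surjective_pairing; apply: (allpairs_f pair); first exact: sub.
by apply: LTP; split=> //; apply: uniq_leq_size.
Qed.

End Reach.

(** * Closed walks and certificates of non-big-O *)

Section Alternative.
Variable x : instance.
Hypotheses (HA : well_ranged (alphabet x) (autA x)) (HB : well_ranged (alphabet x) (autB x)).

Fixpoint walks (k : nat) (t : pstate) : seq (seq edge) :=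
  if k is k'.+1 then
    [::] :: flatten [seq [seq e :: w | w <- walks k' (step x t e)] | e <- edges x t]
  else [:: [::]].

Lemma mem_walks k t w : (w \in walks k t) = (size w <= k)%N && runs x t w.
Proof.
elim: k t w => [|k IH] t w /=; first by rewrite inE leqn0; case: w.
rewrite inE; case: w => [|e w] //=.
apply/flatten_mapP/idP => [[e' ee /mapP[w' + [-> ->]]]|/and3P[sw en rw]].
  by rewrite IH ltnS => /andP[-> ->]; rewrite -(mem_edges HA HB) ee.
by exists e; rewrite ?(mem_edges HA HB) //; apply: map_f; rewrite IH -ltnS sw.
Qed.

Definition log_ratio (tw : pstate * seq edge) (j : nat) : Real :=
  lnq (wprod x tw.1 tw.2 0) - lnq (wprod x tw.1 tw.2 j.+1).

Lemma lnqM (r r' : rat) : 0 < r -> 0 < r' -> lnq (r * r') = lnq r + lnq r'.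
Proof. by move=> r0 r'0; rewrite rmorphM ln_mul ?ltr0q. Qed.

Lemma log_ratio_cat t w w' j : runs x t (w ++ w') -> (j < size (tracks t))%N ->
  log_ratio (t, w ++ w') j = log_ratio (t, w) j + log_ratio (run_end x t w, w') j.
Proof.
rewrite runs_cat => /andP[rw rw'] jt; rewrite /log_ratio /= !wprod_cat.
have st := size_tracks_run rw.
by rewrite !lnqM ?wprod_gt0 ?st // opprD addrACA.
Qed.

Lemma log_ratio_nil t j : log_ratio (t, [::]) j = 0.
Proof. by rewrite /log_ratio subrr. Qed.

Definition stays_in (T : seq pstate) (t : pstate) (w : seq edge) : bool :=
  all (fun q => q \in T) (states x t w).

(** The length bound makes the family finite, as Gordan's alternative requires; longer walks are
    reduced by excising these cycles. *)
Definition cycles (T : seq pstate) : seq (pstate * seq edge) :=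
  undup [seq c <- [seq (t, w) | t <- T, w <- walks (size T) t] |
     (run_end x c.1 c.2 == c.1) && stays_in T c.1 c.2].

Lemma mem_cycles T t w : (t, w) \in cycles T =
  [&& t \in T, (size w <= size T)%N, runs x t w, run_end x t w == t & stays_in T t w].
Proof.
rewrite mem_undup mem_filter /=; apply/andP/and5P => [[/andP[e i]]|[tT sw rw e i]].
  case/allpairsPdep => t' [w' [tT + [et ew]]]; rewrite -et -ew mem_walks => /andP[sw rw].
  by split=> //; rewrite et.
split; first by rewrite e i.
by apply/allpairsPdep; exists t, w; rewrite mem_walks sw rw.
Qed.

Section Pumping.
Variables (T : seq pstate) (m : nat) (n : pstate * seq edge -> nat).
Hypotheses (uT : uniq T) (sT : forall t, t \in T -> size (tracks t) = m).

Definition loop (t : pstate) : seq edge :=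
  flatten [seq flatten (nseq (n c) c.2) | c <- [seq c <- cycles T | c.1 == t]].

Lemma loopP t : t \in T -> [/\ runs x t (loop t), run_end x t (loop t) = t &
  forall j, (j < m)%N -> log_ratio (t, loop t) j =
     \sum_(c <- [seq c <- cycles T | c.1 == t]) (n c)%:R * log_ratio c j].
Proof.
move=> tT; rewrite /loop.
have : all (fun c => (c \in cycles T) && (c.1 == t)) [seq c <- cycles T | c.1 == t].
  by apply/allP => c; rewrite mem_filter andbC.
elim: [seq c <- _ | _] => [|[t' w] l IH] /=.
  by move=> _; split=> // j _; rewrite big_nil log_ratio_nil.
move=> /andP[/andP[+ /= /eqP e] /IH[r1 e1 s1]]; rewrite {t'}e mem_cycles.
move=> /and5P[_ _ rw /eqP ew _]; have [r2 e2 w2] := runs_loop (n (t, w)) rw ew.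
split; first by rewrite runs_cat r2 e2.
  by rewrite foldl_cat e2.
move=> j jm; rewrite big_cons log_ratio_cat ?runs_cat ?r2 ?e2 ?sT // s1 //; congr (_ + _).
elim: (n (t, w)) => [|k IHk]; first by rewrite mul0r log_ratio_nil.
have [r3 e3 _] := runs_loop k rw ew.
by rewrite /= log_ratio_cat ?runs_cat ?rw ?ew ?r3 ?sT // IHk -natr1; ring.
Qed.

End Pumping.

Lemma walk_runs p es : runs x p es -> (walk x p es).1.1 /\ (walk x p es).1.2 = run_end x p es.
Proof. by move=> rn; have [<- /(_ rn)[-> _ _]] := walkP x p es. Qed.

(** [V t] is inserted at the first visit of [t] and the empty loop at later visits, so that each
    [V t] counts once. *)
Lemma pump_visit (V : pstate -> seq edge) m es : runs x (init x m) es ->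
  (forall t, t \in (visit_run x m es).2 -> runs x t (V t) /\ run_end x t (V t) = t) ->
  exists segs, [/\ (pump x m segs).1.1, (pump x m segs).1.2 = run_end x (init x m) es,
    size (pump x m segs).2 = m.+1 &
    forall j, (j <= m)%N -> frac_val (nth (0, 1)%N (pump x m segs).2 j) =
       \prod_(t <- (visit_run x m es).2) wprod x t (V t) j].
Proof.
pose Pump es segs := [/\ (pump x m segs).1.1, (pump x m segs).1.2 = run_end x (init x m) es,
    size (pump x m segs).2 = m.+1 &
    forall j, (j <= m)%N -> frac_val (nth (0, 1)%N (pump x m segs).2 j) =
       \prod_(t <- (visit_run x m es).2) wprod x t (V t) j].
have stepP es' segs u v : (pump x m segs).1.1 -> size (pump x m segs).2 = m.+1 ->
    runs x (pump x m segs).1.2 u ->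
    run_end x (pump x m segs).1.2 u = run_end x (init x m) es' ->
    runs x (init x m) es' ->
    runs x (run_end x (init x m) es') v -> 
    run_end x (run_end x (init x m) es') v = run_end x (init x m) es' ->
    [/\ (pump x m (rcons segs (u, v))).1.1,
      (pump x m (rcons segs (u, v))).1.2 = run_end x (init x m) es',
      size (pump x m (rcons segs (u, v))).2 = m.+1 &
      forall j, (j <= m)%N -> frac_val (nth (0, 1)%N (pump x m (rcons segs (u, v))).2 j) =
        frac_val (nth (0, 1)%N (pump x m segs).2 j) * wprod x (run_end x (init x m) es') v j].
  move=> ok sz ru eu re rv ev; rewrite /pump foldl_rcons -/(pump x m segs) /pump_step /=.
  have [u1 u2] := walk_runs ru; rewrite u1 u2 eu ok.
  have [_ /(_ rv)[w1 w2 w3]] := walkP x (run_end x (init x m) es') v.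
  have sm : size (tracks (run_end x (init x m) es')) = m by rewrite size_tracks_run // size_nseq.
  have [v1 _] := walk_runs rv; rewrite v1 w1 ev eqxx; rewrite sm in w2 w3.
  split=> //; first by rewrite /mul_weights size_map size_zip sz w2 minnn.
  by move=> j jm; rewrite nth_mul_weights ?sz ?w2 // w3.
elim/last_ind: es => [|es e IH].
  move=> _ /(_ (init x m) (mem_head _ _))[r0 e0].
  exists [:: ([::], V (init x m))].
  have [|||||| |ok en sz wj] := @stepP [::] [::] [::] (V (init x m)) => //.
    by rewrite /= size_nseq.
  split=> // j jm; rewrite wj // big_seq1 /= nth_nseq ltnS jm.
  by rewrite /frac_val divr1 mul1r.
rewrite runs_rcons => /andP[res en] VP.
have [|segs [ok ee sz wj]] := IH res.
  by move=> t tT; apply: VP; rewrite visit_run_rcons /= mem_visit tT orbT.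
set q := run_end x (init x m) es in en ee; have qE := visit_run_end x m es.
have eE : run_end x (init x m) (rcons es e) = step x q e by rewrite -cats1 foldl_cat.
pose v := if step x q e \in (visit_run x m es).2 then [::] else V (step x q e).
have [rv ev] : runs x (step x q e) v /\ run_end x (step x q e) v = step x q e.
  rewrite /v; case: ifP => // _; apply: VP.
  by rewrite visit_run_rcons /= qE mem_visit eqxx.
exists (rcons segs ([:: e], v)).
have [|||||| |ok' en' sz' wj'] := @stepP (rcons es e) segs [:: e] v => //.
- by rewrite ee /= en.
- by rewrite ee eE.
- by rewrite runs_rcons res.
- by rewrite eE.
- by rewrite eE.
split=> // j jm; rewrite wj' // wj // eE visit_run_rcons /= qE -/q /visit /v.
by case: ifP => _; rewrite /= ?mulr1 // big_cons mulrC.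
Qed.

Lemma lnq_prod (T : eqType) (l : seq T) (F : T -> rat) : (forall t, t \in l -> 0 < F t) ->
  lnq (\prod_(t <- l) F t) = \sum_(t <- l) lnq (F t).
Proof.
elim: l => [|t l IH] Fp; first by rewrite !big_nil rmorph1 ln1.
have Fl u : u \in l -> 0 < F u by move=> ul; apply: Fp; rewrite inE ul orbT.
rewrite !big_cons lnqM ?IH ?Fp ?mem_head // big_seq; exact: prodr_gt0.
Qed.

Lemma cross_lt (a b : nat * nat) : 0 < frac_val a -> 0 < frac_val b ->
  frac_val b < frac_val a -> (b.1 * a.2 < a.1 * b.2)%N.
Proof.
have den (c : nat * nat) : 0 < frac_val c -> (0 < c.2)%N.
  by rewrite lt0n; apply: contraTneq => c0; rewrite /frac_val c0 invr0 mulr0 ltxx.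
move=> /den a2 /den b2; rewrite /frac_val ltr_pdivrMr ?ltr0n // mulrAC ltr_pdivlMr ?ltr0n //.
by rewrite -!natrM ltr_nat.
Qed.

Lemma lnq_lt (r r' : rat) : 0 < r -> 0 < r' -> 0 < lnq r' - lnq r -> r < r'.
Proof.
move=> r0 r'0; rewrite subr_gt0 !ltNge; apply: contra => rr.
by apply: le_ln; rewrite ?ltr0q ?ler_rat.
Qed.

(** Each visited state receives its [loop]. Regrouped by base points, the total log-ratio of the
    loops is the combination of cycles assumed to be positive. *)
Lemma check_not_bigO_complete m es n :
  runs x (init x m) es -> accepting x (visit_run x m es).1 -> complete x (visit_run x m es).1 ->
  (forall j : 'I_m, 0 < \sum_(c <- cycles (visit_run x m es).2) (n c)%:R * log_ratio c j) ->
  exists c, check_not_bigO x c.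
Proof.
move=> res acc cmp pos; have [uT _ TP] := visit_run_props res.
set T := (visit_run x m es).2 in uT TP pos.
have sT t : t \in T -> size (tracks t) = m.
  by move=> /TP[fs rfs ->]; rewrite size_tracks_run // size_nseq.
have V t (tT : t \in T) := loopP n sT tT.
have [|segs [ok ee sz wj]] := @pump_visit (loop T n) m es res.
  by move=> t /V[].
exists (m, segs); rewrite visit_run_end in acc cmp; rewrite /check_not_bigO /= ok ee acc cmp /=.
set u := (pump x m segs).2 in sz wj *.
have up j : (j <= m)%N -> 0 < frac_val (nth (0, 1)%N u j).
  move=> jm; rewrite wj // big_seq; apply: prodr_gt0 => t tT.
  by have [rt _ _] := V t tT; rewrite wprod_gt0 // sT.
have lnu j : (j <= m)%N -> lnq (frac_val (nth (0, 1)%N u j)) =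
  \sum_(t <- T) lnq (wprod x t (loop T n t) j).
  move=> jm; rewrite wj // lnq_prod // => t tT.
  by have [rt _ _] := V t tT; rewrite wprod_gt0 // sT.
rewrite /dominates; apply/(all_nthP (0, 1)%N) => j; rewrite size_behead sz /= => jm.
rewrite nth_behead -nth0; apply: cross_lt; [exact: up|exact: up|].
apply: lnq_lt; [exact: up|exact: up|].
rewrite !lnu // -sumrB; have := pos (Ordinal jm); congr (_ < _).
rewrite [RHS](eq_big_seq (fun t => \sum_(c <- cycles T | c.1 == t) (n c)%:R * log_ratio c j));
  last first.
  by move=> t tT; have [_ _ L] := V t tT; rewrite -big_filter -L.
under [RHS]eq_bigr do rewrite big_mkcond.
rewrite exchange_big /= big_seq [RHS]big_seq; apply: eq_bigr => -[t w].
rewrite mem_cycles => /and5P[tT _ _ _ _] /=.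
by rewrite (bigD1_seq t) //= eqxx big1 ?addr0 // => t'; rewrite eq_sym => /negbTE->.
Qed.

End Alternative.

(** * Potentials and certificates of big-O *)

Definition eventually (P : nat -> bool) : Prop := exists N, forall n, (N <= n)%N -> P n.

(** Merges the precisions of finitely many numerical checks into the single one stored in a
    certificate. *)
Lemma eventually_all (T : eqType) (P : T -> nat -> bool) (s : seq T) :
  (forall t, t \in s -> eventually (P t)) -> eventually (fun n => all (P^~ n) s).
Proof.
elim: s => [|t s IH] Ps; first by exists 0%N.
have [N1 H1] := Ps t (mem_head _ _).
have [|N2 H2] := IH; first by move=> u us; apply: Ps; rewrite inE us orbT.
by exists (maxn N1 N2) => n; rewrite geq_max /= => /andP[/H1-> /H2->].
Qed.

Lemma eventually_and (P Q : nat -> bool) :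
  eventually P -> eventually Q -> eventually (fun n => P n && Q n).
Proof.
by move=> [N1 H1] [N2 H2]; exists (maxn N1 N2) => n; rewrite geq_max => /andP[/H1-> /H2->].
Qed.

(** The subring in which multipliers are sought: its elements have finite codes, and it contains the
    logarithms of positive weights. *)
Definition is_logpoly (r : Real) : Prop := exists2 P, lp_wf P & lp_val P = r.

Lemma is_logpoly0 : is_logpoly 0.
Proof. by exists ([::], [::]) => //; apply: lp_val0. Qed.

Lemma is_logpoly1 : is_logpoly 1.
Proof.
exists ([:: 1%N], [::]) => //; rewrite /lp_val big_seq1 big_nil subr0.
by rewrite /mono_val /factors /= big_nil.
Qed.

Lemma is_logpolyB r r' : is_logpoly r -> is_logpoly r' -> is_logpoly (r - r').
Proof.
move=> [P Pw <-] [Q Qw <-]; exists (lp_add P (lp_opp Q)); last by rewrite lp_valD lp_valN.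
by apply: lp_wf_add => //; apply: lp_wf_opp.
Qed.

Lemma is_logpolyM r r' : is_logpoly r -> is_logpoly r' -> is_logpoly (r * r').
Proof.
by move=> [P Pw <-] [Q Qw <-]; exists (lp_mul P Q); rewrite ?lp_valM //; apply: lp_wf_mul.
Qed.

Lemma is_logpolyD r r' : is_logpoly r -> is_logpoly r' -> is_logpoly (r + r').
Proof.
move=> Dr Dr'; rewrite -[r']opprK -[- r']sub0r; apply: is_logpolyB => //.
by apply: is_logpolyB => //; apply: is_logpoly0.
Qed.

Lemma is_logpoly_log u : 0 < frac_val u -> is_logpoly (lnq (frac_val u)).
Proof.
case: u => a b ab; exists (lp_log (a, b)); first exact: lp_wf_log.
by apply: lp_val_log => /=; rewrite lt0n; apply: contraTneq ab => ->;
  rewrite /frac_val /= ?mul0r ?invr0 ?mulr0 ltxx.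
Qed.

Lemma lp_wf_drift u ys : all lp_wf ys -> lp_wf (lp_drift u ys).
Proof.
rewrite /lp_drift; elim: ys (behead u) => [|y ys IH] [|b l] //= /andP[yw /IH ysw].
apply: lp_wf_add => //; apply: lp_wf_mul => //.
by apply: lp_wf_add; [|apply: lp_wf_opp]; apply: lp_wf_log.
Qed.

Section Potentials.
Variable x : instance.
Hypotheses (HA : well_ranged (alphabet x) (autA x)) (HB : well_ranged (alphabet x) (autB x)).
Hypothesis schanuel : Schanuel_conjecture.

(** Positive values are recognised numerically; the value zero is recognised on the monomials, by
    Schanuel's conjecture. *)
Lemma lp_nonneg_complete P : lp_wf P -> 0 <= lp_val P -> eventually (lp_nonneg^~ P).
Proof.
move=> Pw; rewrite le_eqVlt eq_sym => /orP[/eqP P0|/lp_pos_complete[N NP]].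
  by exists 0%N => n _; rewrite /lp_nonneg lp_val_eq0.
by exists N => n /NP; rewrite /lp_nonneg => ->; rewrite orbT.
Qed.

Lemma is_logpoly_wprod t w j : runs x t w -> (j <= size (tracks t))%N ->
  is_logpoly (lnq (wprod x t w j)).
Proof.
elim: w t => [|e w IH] t /=; first by rewrite rmorph1 ln1 => _ _; apply: is_logpoly0.
move=> /andP[en rw] jt; have st := size_tracks_step en.
rewrite lnqM ?edge_weights_gt0 ?wprod_gt0 ?st //; apply: is_logpolyD.
  by apply: is_logpoly_log; apply: edge_weights_gt0.
by apply: IH; rewrite ?st.
Qed.

Lemma is_logpoly_log_ratio t w j : runs x t w -> (j < size (tracks t))%N ->
  is_logpoly (log_ratio x (t, w) j).
Proof. by move=> rw jt; apply: is_logpolyB; apply: is_logpoly_wprod. Qed.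

Variables (T : seq pstate) (m : nat) (y : 'I_m -> Real).
Hypotheses (uT : uniq T) (sT : forall t, t \in T -> size (tracks t) = m).
Hypotheses (yD : forall j, is_logpoly (y j) /\ 0 <= y j) (y0 : exists j, 0 < y j).
Hypothesis ycyc : forall c, c \in cycles x T -> dot y (log_ratio x c) <= 0.

Notation gain tw := (dot y (log_ratio x tw)).

Lemma gain_cat t w w' : t \in T -> runs x t (w ++ w') ->
  gain (t, w ++ w') = gain (t, w) + gain (run_end x t w, w').
Proof.
move=> tT rw; rewrite /dot -big_split; apply: eq_bigr => j _ /=.
by rewrite log_ratio_cat ?sT // mulrDr.
Qed.

Lemma stays_in_cons t e w :
  stays_in x T t (e :: w) = (t \in T) && stays_in x T (step x t e) w.
Proof. by []. Qed.

Lemma stays_in_cat t w w' : stays_in x T t (w ++ w') =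
  stays_in x T t w && stays_in x T (run_end x t w) w'.
Proof.
elim: w t => [|e w IH] t.
  by rewrite /stays_in /= andbT; case: (t \in T).
by rewrite cat_cons !stays_in_cons IH andbA.
Qed.

Lemma stays_in_end t w : stays_in x T t w -> run_end x t w \in T.
Proof. by move=> /allP; apply; apply: run_end_states. Qed.

Lemma nth_states t0 t w i : (i <= size w)%N -> nth t0 (states x t w) i = run_end x t (take i w).
Proof. by case: i => [|i] iw; rewrite ?take0 //= nth_scanl. Qed.

(* Cutting a closed subwalk out of a long walk does not decrease its gain. *)
Lemma shorten_walk t w : t \in T -> runs x t w -> stays_in x T t w ->
  exists w', [/\ runs x t w', stays_in x T t w', (size w' < size T)%N &
    gain (t, w) <= gain (t, w')].
Proof.
have [k] := ubnP (size w); elim: k w => // k IH w; rewrite ltnS => wk tT rw iw.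
case: (ltnP (size w) (size T)) => [sw|Tw]; first by exists w.
(* The first [size T] edges already visit [(size T).+1] states of [T], so a state repeats and the
   closed subwalk is short enough to belong to [cycles]. *)
pose s := states x t (take (size T) w).
have ss : size s = (size T).+1 by rewrite /s /= size_scanl size_takel.
have : ~~ uniq s.
  apply/negP => us; suff : (size s <= size T)%N by rewrite ss ltnn.
  apply: uniq_leq_size => // q qs; apply: (allP iw).
  rewrite -[w](cat_take_drop (size T)) /states scanl_cat -cat_cons mem_cat.
  by apply/orP; left.
case/(uniqPn t) => i [j [ij]]; rewrite ss ltnS => jT.
have stk : size (take (size T) w) = size T by rewrite size_takel.
rewrite !nth_states ?stk ?(ltnW (leq_trans ij jT)) // !take_takel ?(ltnW (leq_trans ij jT)) // =>
  eij.
pose w1 := take i w; pose w2 := take (j - i) (drop i w); pose w3 := drop j w.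
have w12 : w1 ++ w2 = take j w.
  by rewrite /w1 /w2 -[in RHS](subnKC (ltnW ij)) takeD.
have wE : w = (w1 ++ w2) ++ w3 by rewrite w12 cat_take_drop.
have e1 : run_end x t (w1 ++ w2) = run_end x t w1 by rewrite w12.
have jw : (j <= size w)%N := leq_trans jT Tw.
move: rw iw; rewrite {1 2}wE runs_cat stays_in_cat e1 => /andP[r12 r3] /andP[i12 i3].
have := r12; rewrite runs_cat => /andP[r1 r2].
have := i12; rewrite stays_in_cat => /andP[i1 i2].
have [|||w' [rw' iw' sw' le]] := IH (w1 ++ w3) _ tT.
- have i_w : (i < size w)%N := leq_trans ij jw.
  rewrite size_cat /w1 /w3 size_takel ?size_drop ?(ltnW i_w) //; apply: leq_trans wk; lia.
- by rewrite runs_cat r1.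
- by rewrite stays_in_cat i1.
exists w'; split=> //; apply: le_trans le.
rewrite {1}wE !gain_cat ?runs_cat ?r1 ?r2 ?e1 ?r3 //= lerD2r gerDl.
apply: ycyc; rewrite (mem_cycles HA HB) (stays_in_end i1) r2 i2.
rewrite foldl_cat in e1; rewrite e1 eqxx /= andbT size_takel; last by rewrite size_drop leq_sub2r.
by rewrite (leq_trans (leq_subr _ _)).
Qed.

(** The maximal gain is attained because short walks suffice and are finite in number. Membership in
    [T] stands below the existential so that [choice] applies to all [t]. *)
Lemma best_walk t : exists w, t \in T -> [/\ runs x t w, stays_in x T t w &
  forall w', runs x t w' -> stays_in x T t w' -> gain (t, w') <= gain (t, w)].
Proof.
case: (boolP (t \in T)) => [tT|]; last by exists [::].
pose l := [seq w <- walks x (size T) t | stays_in x T t w].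
have lP w : (w \in l) = [&& stays_in x T t w, (size w <= size T)%N & runs x t w].
  by rewrite mem_filter (mem_walks HA HB).
have n0 : [::] \in l by rewrite lP /stays_in /= tT.
have [|w wl wmax] := exists_argmax (fun w => gain (t, w)) (_ : l != [::]).
  by apply: contraTneq n0 => ->.
move: wl; rewrite lP => /and3P[iw _ rw]; exists w => _; split=> // w' rw' iw'.
have [w'' [r'' i'' s'' le]] := shorten_walk tT rw' iw'.
by apply: le_trans le _; apply: wmax; rewrite lP i'' r'' ltnW.
Qed.

(** The potential of [t] is the largest gain of a walk from [t] inside [T]. An edge followed by a
    walk from its target is again a walk from [t], which is the slack inequality. *)
Lemma check_item_complete p : p \in T ->
  exists yp, eventually (fun n => check_item x n ((p, T), yp)).
Proof.
move=> pT; have [best bestP] := choice best_walk.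
have /choice[Y YP] : forall j, exists P, lp_wf P /\ lp_val P = y j.
  by move=> j; have [[P Pw Pv] _] := yD j; exists P.
have /choice[Phi PhiP] : forall t, exists P, lp_wf P /\
    (t \in T -> lp_val P = gain (t, best t)).
  move=> t; case: (boolP (t \in T)) => [tT|]; last by exists ([::], [::]).
  have [rt _ _] := bestP t tT.
  have [P Pw Pv] : is_logpoly (gain (t, best t)).
    apply: D_dot => //; [exact: is_logpoly0|exact: is_logpolyB|exact: is_logpolyM| |].
      by move=> j; case: (yD j).
    by move=> j; apply: is_logpoly_log_ratio => //; rewrite sT.
  by exists P.
pose ys := [seq Y j | j <- enum 'I_m]; pose phis := [seq Phi t | t <- T].
have sys : size ys = m by rewrite size_map size_enum_ord.
have wys : all lp_wf ys by apply/allP => P /mapP[j _ ->]; case: (YP j).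
have wphis : all lp_wf phis by apply/allP => P /mapP[t _ ->]; case: (PhiP t).
have potE t : t \in T -> potential T phis t = Phi t.
  by move=> tT; rewrite /potential (nth_map t) ?index_mem // nth_index.
have nthY (j : 'I_m) : nth ([::], [::]) ys j = Y j.
  by rewrite /ys (nth_map j) ?size_enum_ord // nth_ord_enum.
exists (ys, phis); rewrite /check_item /= sys sT // eqxx wys wphis /=.
apply: eventually_and.
  apply: (eventually_all (P := fun P n => lp_nonneg n P)) => P /mapP[j _ ->].
  by have [Yw Yv] := YP j; apply: lp_nonneg_complete => //; rewrite Yv; case: (yD j).
apply: eventually_and.
  have [j yj] := y0; have [N NP] : eventually (lp_pos^~ (Y j)).
    by apply: lp_pos_complete; have [_ ->] := YP j.
  exists N => n /NP H; apply/hasP; exists (Y j) => //.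
  by apply: map_f; rewrite mem_enum.
apply: (eventually_all (P := fun t n => all (fun e => (step x t e \in T) ==>
   lp_nonneg n (lp_slack x T ys phis t e)) (edges x t))) => t tT.
apply: (eventually_all (P := fun e n => (step x t e \in T) ==>
   lp_nonneg n (lp_slack x T ys phis t e))) => e.
rewrite (mem_edges HA HB) => en.
case: (boolP (step x t e \in T)) => [sT'|_]; last by exists 0%N.
have [Pw Pv] := PhiP t; have [Qw Qv] := PhiP (step x t e).
apply: lp_nonneg_complete.
  rewrite /lp_slack !potE //; apply: lp_wf_add => //.
  by apply: lp_wf_add; [exact: lp_wf_opp | exact: lp_wf_drift].
rewrite /lp_slack !potE // !lp_valD lp_valN Pv // Qv // lp_val_drift //; last first.
- by move=> j jm; apply: edge_weights_gt0; rewrite // sT // -sys.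
- by rewrite size_edge_weights // sT // sys.
have [r1 i1 _] := bestP _ sT'.
have [w [rw iw sw le]] := shorten_walk sT' r1 i1.
have [_ _ /(_ (e :: w))] := bestP t tT; rewrite /= en rw => /(_ isT).
rewrite stays_in_cons tT => /(_ iw) le'.
have cE : gain (t, e :: w) = gain (t, [:: e]) + gain (step x t e, w).
  by apply: (@gain_cat t [:: e] w); rewrite //= en.
have dE : \sum_(j < size ys) lp_val (nth ([::], [::]) ys j) *
   (lnq (frac_val (nth (0, 1)%N (edge_weights x t e) j.+1)) -
    lnq (frac_val (nth (0, 1)%N (edge_weights x t e) 0))) = - gain (t, [:: e]).
  rewrite sys /dot -sumrN; apply: eq_bigr => j _; rewrite nthY; have [_ ->] := YP j.
  by rewrite /log_ratio /= !mulr1 -mulrN opprB.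
by rewrite dE; move: le le'; rewrite cE => *; lra.
Qed.

End Potentials.

Lemma labels_uniq x p w h hs : tracked x p w h hs ->
  uniq [seq z.1 | z <- tracks p] -> uniq hs.
Proof. by move=> /tracked_B->; rewrite -map_comp => /map_uniq. Qed.

(** * One of the two certificates exists *)

Section Completeness.
Local Open Scope nat_scope.
Variables (s : nat) (A B : wa s).
Hypotheses (A0 : wa_nonneg A) (B0 : wa_nonneg B) (Bfin : finitely_ambiguous B).
Hypothesis schanuel : Schanuel_conjecture.
Notation x := (instance_of A B).

Lemma certificate_exists :
  (exists c, check_not_bigO x c) \/ (exists c, check_bigO x c).
Proof.
have HA : well_ranged (alphabet x) (autA x) by move=> a i j /trans_wa.
have HB := @well_ranged_B _ A B.
have [K KP] := Bfin.
have iA : raw_init (autA x) < raw_size (autA x) := ltn_ord (wa_q0 A).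
have iB : raw_init (autB x) < raw_size (autB x) := ltn_ord (wa_q0 B).
have [L LP] := reach_listable HA HB iA iB K.
have [|no0] := pselect (exists c, check_not_bigO x c); [by left | right].
have /choice[F FP] : forall pt, exists yp, pt \in L -> accepting x pt.1 -> complete x pt.1 ->
    eventually (fun n => check_item x n (pt, yp)).
  (* States that are not accepting and complete carry no obligation and receive empty lists. *)
  move=> pt; case: (pselect [/\ pt \in L, accepting x pt.1 & complete x pt.1]); last first.
    by move=> n; exists ([::], [::]) => ptL acc cmp; case: n.
  case=> /LP[m [es [mK res ptE]]] acc cmp.
  have [uT pT TP] := visit_run_props res; rewrite -ptE in uT pT TP.
  have sT t : t \in pt.2 -> size (tracks t) = m.
    by move=> /TP[fs rfs ->]; rewrite size_tracks_run // size_nseq.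
  (* Without tracks the multipliers cannot exist: [A] accepts a word that [B] rejects, and the
     pumping certificate has no run of [B] to beat. *)
  have [|[y [yD y0 ycyc]]|[n nP]] := gordan is_logpoly0 is_logpoly1 is_logpolyB is_logpolyM
    (v := fun c (j : 'I_m) => log_ratio x c j) (undup_uniq _ : uniq (cycles x pt.2)).
  - move=> [t w] j; rewrite (mem_cycles HA HB) => /and5P[tT _ rw _ _].
    by apply: is_logpoly_log_ratio => //; rewrite sT.
  - have [yp ypP] := check_item_complete HA HB schanuel uT sT yD y0 ycyc pT.
    by exists yp => _ _ _; case: pt {acc cmp ptE uT TP sT pT ycyc} ypP.
  - case: no0; rewrite ptE in acc cmp nP.
    exact: (check_not_bigO_complete HA HB res acc cmp nP).
have [N NP] : eventually (fun n => all (fun pt => (accepting x pt.1 && complete x pt.1) ==>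
    check_item x n (pt, F pt)) L).
  apply: (eventually_all (P := fun pt n => (accepting x pt.1 && complete x pt.1) ==>
    check_item x n (pt, F pt))) => pt ptL.
  case: (boolP (accepting x pt.1 && _)) => [/andP[acc cmp]|_]; last by exists 0.
  exact: FP.
exists (K, N, [seq (pt, F pt) | pt <- L]).
have key : [seq i.1 | i <- [seq (pt, F pt) | pt <- L]] = L.
  by rewrite -map_comp map_id_in.
rewrite /check_bigO key; apply/and3P; split.
- apply/allP => m; rewrite mem_iota add0n /= => mK; apply/LP.
  by exists m, [::].
- apply/allP => _ /mapP[pt /LP[m [es [mK res ptE]]] ->].
  apply/allP => e; rewrite (mem_edges HA HB) key /= => en; apply/LP.
  exists m, (rcons es e); split=> //; last by rewrite visit_run_rcons -ptE.
  by rewrite runs_rcons res /= -visit_run_end -ptE.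
apply/allP => _ /mapP[pt ptL ->]; apply/implyP => /= acc.
have /LP[m [es [mK res ptE]]] := ptL.
apply/andP; split; last first.
  apply/implyP => cmp; have := allP (NP N.+1 (leqnSn N)) _ ptL.
  by rewrite acc cmp.
(* Unique labels on more than [K] tracks would exhibit more than [K] distinct accepting runs of
   [B]. *)
apply/negP => /andP[Km labu].
have [w0 [h [hs [rr rs rt rA rB]]]] := runs_represents HB res.
rewrite -visit_run_end -ptE in rt.
have [w wE] := rpath_rword (tracked_rpathA rt); rewrite {w0}wE in rt rA rB.
have := racc_size B0 (labels_uniq rt labu) (w := w); rewrite leqNgt => /(_ _)/negP; apply;
  last first.
  rewrite (tracked_B rt) size_map in Km; exact: leq_ltn_trans (KP w) Km.
apply/allP => g gh; rewrite /racc (allP (tracked_rpathB rt) g gh) /=.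
case/andP: acc => _; rewrite (tracked_B rt) all_map => /allP /(_ g gh).
exact.
Qed.

End Completeness.

Theorem theorem9p2 :
  Schanuel_conjecture ->
  exists e : prcode, decides_wa_problem e fin_amb_instance bigO.
Proof.
move=> schanuel; apply: wa_decision => s A B [A0 B0 Afin Bfin]; split.
- exact: certificate_exists.
- exact: check_not_bigO_sound.
- exact: check_bigO_sound.
Qed.
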